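(* Let $X$ be a reduced analytic space with regular locus $U_0=Reg(X)$, let $(U_i,k_i,D_i)_{i\in I}$ be a family of embedding triples such that the $U_i$ are open subsets of $X$ which cover $Sing(X)$, and let $\mathcal{A}$ be the embedding atlas of $X$ consisting of these triples together with $(U_0,\mathrm{id},U_0)$. Then the restriction $r\mathcal{D}olb(\mathcal{A};\mathcal{O}_X)|U_0$ coincides with the Dolbeault-Grothendieck resolution $(\mathcal{E}_{U_0}^{0,\bullet},\bar\partial)$ on the manifold $U_0$.
   Context: Analytic space means complex analytic space. $Sing(X)$ and $Reg(X)$ are the singular and regular loci. An embedding triple $(X,i,D)$ is a closed embedding $i:X\hookrightarrow D$ of an analytic space in a complex manifold. An embedding atlas of $X$ is a family $\mathcal{A}=(U_i,k_i,D_i)_{i\in I}$ of embedding triples with $(U_i)_{i\in I}$ an open covering of $X$. Definition of $\mathcal{D}olb(\mathcal{A};\mathcal{F})$ for an $\mathcal{O}_X$-module $\mathcal{F}$. For a complex manifold $D$, $\mathcal{E}_D^{p,q}$ is the sheaf of smooth $(p,q)$-forms. For an embedding triple $(U,k,D)$ and an $\mathcal{O}_U$-module $\mathcal{F}$ put $\mathcal{D}olb(k;\mathcal{F})=k^{-1}(\mathcal{E}_D^{0,\bullet}\otimes_{\mathcal{O}_D}k_*\mathcal{F})$ with differential $\bar\partial\otimes\mathrm{id}$. Fix a total order on the index set. For finite nonempty $\alpha$ with $U_\alpha=\bigcap_{i\in\alpha}U_i\neq\emptyset$ put $|\alpha|=\mathrm{card}(\alpha)-1$, $D_\alpha=\prod_{i\in\alpha}D_i$,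 $k_\alpha=(k_i|U_\alpha)_{i\in\alpha}:U_\alpha\to D_\alpha$ (a closed embedding), $b_\alpha:U_\alpha\hookrightarrow X$ the inclusion. Then $\mathcal{D}olb(\mathcal{A};\mathcal{F})$ is the simple complex associated to the double complex $K^{p,q}=\prod_{|\alpha|=p}b_{\alpha*}\mathcal{D}olb^q(k_\alpha;\mathcal{F}|U_\alpha)$, with differential induced by $\bar\partial$ in the $q$-direction and Čech differential $(ds)_\beta=\sum_j(-1)^j\pi_j^*(s_{\beta\setminus\{i_j\}})$, $\beta=\{i_0<\dots<i_{p+1}\}$, in the $p$-direction, where $\pi_j:D_\beta\to D_{\beta\setminus\{i_j\}}$ is the projection and $\pi_j^*(\omega\otimes s)=\pi_j^*\omega\otimes s|U_\beta$. Definition of $r\mathcal{D}olb$. Let $(W_j)_j$ be a basis of open neighbourhoods of $Sing(X)$ in $X$. For each $j$ let $\mathcal{A}^{(j)}$ be the embedding atlas of $X$ consisting of the triples $(U_i\cap W_j,k_i|W_j,D_i')_{i\in I}$, where $D_i'\subset D_i$ is an open subset in which $k_i(U_i\cap W_j)$ is closed, together with $(Reg(X),\mathrm{id},Reg(X))$. The complex $\mathcal{D}olb(\mathcal{A}^{(j)};\mathcal{F})$ does not depend on the choice of the $D_i'$, and for $W_{j_1}\subset W_{j_2}$ restriction gives a natural morphism $\mathcal{D}olb(\mathcal{A}^{(j_2)};\mathcal{F})\to\mathcal{D}olb(\mathcal{A}^{(j_1)};\mathcal{F})$. One sets $r\mathcal{D}olb(\mathcal{A};\mathcal{F})=\varinjlim_j\mathcal{D}olb(\mathcal{A}^{(j)};\mathcal{F})$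 (inductive limit of complexes of sheaves); it is independent of the basis $(W_j)_j$. *)

(* Defs.v *)
From Stdlib Require List.
From HB Require Import structures.
From mathcomp Require Import all_boot all_order all_algebra.
From mathcomp Require Import all_classical all_reals all_analysis.
From mathcomp Require Import complex.
Set Implicit Arguments.
Unset Strict Implicit.
Unset Printing Implicit Defensive.
Import Order.TTheory GRing.Theory Num.Theory.
Import numFieldNormedType.Exports.
Local Open Scope classical_set_scope.
Local Open Scope ring_scope.
Local Open Scope complex_scope.

(* The usual topology of C = R[i], as that of any numFieldType. *)
HB.instance Definition _ (R : realType) :=
  NormedModule.copy R[i] (R[i] : numFieldType).

Section ComplexCalculus.
Context {R : realType} {n : nat}.
Implicit Types (f : 'rV[R[i]]_n -> R[i]) (z v : 'rV[R[i]]_n).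

(* Derivatives along v are taken with respect to a real parameter. *)
Definition re_along f v z (t : R) : R := complex.Re (f (z + t%:C *: v)).
Definition im_along f v z (t : R) : R := complex.Im (f (z + t%:C *: v)).

Definition has_dird f v z : Prop :=
  derivable (re_along f v z) 0 1 /\ derivable (im_along f v z) 0 1.

Definition dird f v z : R[i] :=
  derive1 (re_along f v z) 0 +i* derive1 (im_along f v z) 0.

(* The C-antilinear part, in v, of the real differential of f at z:
   the sum over j of (v_j)^* times the derivative of f along \bar z_j. *)
Definition dbard f v z : R[i] := (dird f v z + 'i * dird f ('i *: v) z) / 2.

Fixpoint Ck (k : nat) (V : set 'rV[R[i]]_n) f : Prop :=
  (forall z, V z -> {for z, continuous f}) /\
  match k with
  | 0 => True
  | k'.+1 => forall v, (forall z, V z -> has_dird f v z) /\ Ck k' V (dird f v)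
  end.

Definition smooth_at z f : Prop :=
  exists2 V, open_nbhs z V & forall k, Ck k V f.

Definition holomorphic_at z f : Prop :=
  exists2 V, open_nbhs z V &
    (forall k, Ck k V f) /\ (forall y v, V y -> dbard f v y = 0).
End ComplexCalculus.

(* A topological space with a sheaf of C-valued functions, given by its germs:
   [hol x f] reads "f is a section of the structure sheaf near x", so that the
   sections over an open V are the f with [hol x f] for all x in V, and the
   stalk at x is the set of f with [hol x f] modulo equality near x.  The
   structure sheaf of a reduced analytic space is of this kind. *)
Record fun_space (R : realType) := Space {
  carrier :> topologicalType;
  hol : carrier -> set (carrier -> R[i]) }.

Definition Cspace (R : realType) (n : nat) : fun_space R :=
  @Space R 'rV[R[i]]_n (@holomorphic_at R n).

Section AnalyticSpaces.
Context {R : realType}.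
Implicit Types S T : fun_space R.

(* phi maps the open set V isomorphically onto the subset phi(V) of T with its
   induced reduced structure: phi is a topological embedding, and the functions
   on V are locally the restrictions of functions on T. *)
Definition iso_onto_image S T (V : set S) (phi : S -> T) : Prop :=
  [/\ forall x y, V x -> V y -> phi x = phi y -> x = y,
      forall x, V x -> forall N : set S, nbhs x N <->
        exists2 M, nbhs (phi x) M & V `&` phi @^-1` M `<=` N
    & forall x, V x -> forall f, hol x f <->
        exists2 F, hol (phi x) F & \forall y \near x, f y = F (phi y)].

(* Since the condition is imposed at all points of B, A is closed in B. *)
Definition analytic_subset T (B A : set T) : Prop :=
  A `<=` B /\
  forall b, B b -> exists m (g : 'I_m -> T -> R[i]),
    (forall i, hol b (g i)) /\ (\forall z \near b, A z <-> forall i, g i z = 0).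

Definition closed_embedding S T (V : set S) (B : set T) (phi : S -> T) : Prop :=
  [/\ open V, open B, analytic_subset B (phi @` V) & iso_onto_image V phi].

Definition reduced_analytic_space S : Prop :=
  hausdorff_space S /\
  forall x, exists n (V : set S) (B : set (Cspace R n)) (phi : S -> Cspace R n),
    V x /\ closed_embedding V B phi.

Record chart S := Chart {
  cdim : nat;
  cdom : set S;
  cmap : S -> Cspace R cdim;
  cinv : Cspace R cdim -> S }.

Arguments cmap {S} c x.
Arguments cinv {S} c z.

Definition chart_at S (x : S) (c : chart S) : Prop :=
  [/\ open (cdom c), cdom c x, open (cmap c @` cdom c),
      forall y, cdom c y -> cinv c (cmap c y) = y
    & iso_onto_image (cdom c) (cmap c)].

Definition Reg S : set S := [set x | exists c, chart_at x c].
Arguments Reg : clear implicits.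
Definition Sing S : set S := ~` Reg S.
Arguments Sing : clear implicits.

(* A complex manifold is presented as an open set M of regular points in a
   space; this covers open subsets of manifolds and regular loci. *)
Definition manifold_in S (M : set S) : Prop :=
  [/\ hausdorff_space S, open M & M `<=` Reg S].

Definition prod_space m (D : 'I_m -> fun_space R) : fun_space R :=
  @Space R (prod_topology (fun i => carrier (D i))) (fun x f =>
    exists c : forall i, chart (D i), (forall i, chart_at (x i) (c i)) /\
    exists2 F, holomorphic_at (\mxrow_i (cmap (c i) (x i) : 'rV_(cdim (c i)))) F &
      \forall y \near x, f y = F (\mxrow_i (cmap (c i) (y i) : 'rV_(cdim (c i))))).
End AnalyticSpaces.
Arguments Reg {R} S.
Arguments Sing {R} S.
Arguments cmap {R S} c x.
Arguments cinv {R S} c z.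

(* Forms of type (0,q).  A form is a function of a point and a sequence of
   tangent vectors; only its values at regular points, on sequences of q
   vectors of the holomorphic tangent space, are meaningful. *)
Section Forms.
Context {R : realType} {S : fun_space R}.

Definition vec : Type := (S -> R[i]) -> R[i].

(* The vector field sum_j a_j d/dz_j in the coordinates c, at the point y, as a
   derivation of the germs at y, set to 0 outside the stalk at y. *)
Definition cfield (c : chart S) (a : 'rV[R[i]]_(cdim c)) (y : S) : vec :=
  fun f => if `[< hol y f >] then dird (f \o cinv c) a (cmap c y) else 0.

Definition tangent (x : S) : set vec :=
  [set v | exists c a, chart_at x c /\ v = @cfield c a x].

Definition tangents (q : nat) (x : S) : set (seq vec) :=
  [set vs | size vs = q /\ List.Forall (tangent x) vs].

Definition coords (c : chart S) (v : vec) : 'rV[R[i]]_(cdim c) :=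
  \row_j v (fun y => (cmap c y : 'rV_(cdim c)) 0 j).

Definition form : Type := S -> seq vec -> R[i].

Definition form_add (w1 w2 : form) : form := fun y vs => w1 y vs + w2 y vs.
Definition form_mul (f : S -> R[i]) (w : form) : form := fun y vs => f y * w y vs.
Definition form0 : form := fun _ _ => 0.

Definition form_eq_at (q : nat) (y : S) (w1 w2 : form) : Prop :=
  forall vs, tangents q y vs -> w1 y vs = w2 y vs.

Definition antilinear_alternating (q : nat) (x : S) (w : form) : Prop :=
  (forall s1 s2 u v a,
     tangents q x (s1 ++ u :: s2) -> tangents q x (s1 ++ v :: s2) ->
     w x (s1 ++ (fun f => a * u f + v f) :: s2) =
     a^* * w x (s1 ++ u :: s2) + w x (s1 ++ v :: s2)) /\
  (forall s1 s2 s3 v, tangents q x (s1 ++ v :: s2 ++ v :: s3) ->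
     w x (s1 ++ v :: s2 ++ v :: s3) = 0).

(* The coefficient w(d/d\bar a_1, ..., d/d\bar a_q) in the coordinates c. *)
Definition coef (c : chart S) (w : form) (s : seq 'rV[R[i]]_(cdim c))
    (z : 'rV[R[i]]_(cdim c)) : R[i] :=
  w (cinv c z) [seq @cfield c a (cinv c z) | a <- s].

(* Germs at x of smooth (0,q)-forms. *)
Definition smooth_form (q : nat) (x : S) (w : form) : Prop :=
  (\forall y \near x, antilinear_alternating q y w) /\
  (forall c, chart_at x c -> forall s, size s = q ->
     smooth_at (cmap c x) (@coef c w s)).

(* (dbar w)(v_0, ..., v_q)
     = sum_i (-1)^i dbar_{v_i} (w (v_0, .. omit v_i .., v_q)),
   each v_i being extended to a field with constant coefficients in a chart.
   On smooth forms this does not depend on the chart, which is chosen. *)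
Definition dbar (w : form) : form := fun x vs =>
  match pselect (exists c, chart_at x c) with
  | left h =>
      let c := projT1 (cid h) in
      let s := [seq coords c v | v <- vs] in
      \sum_(i < size s)
         (-1) ^+ i * dbard (@coef c w (take i s ++ drop i.+1 s)) (nth 0 s i)
                       (cmap c x)
  | right _ => 0
  end.
End Forms.
Arguments vec {R} S.
Arguments form {R} S.

Definition pushforward (R : realType) (S T : fun_space R) (pi : S -> T) (x : S)
    (v : vec S) : vec T :=
  fun f => if `[< hol (pi x) f >] then v (f \o pi) else 0.

Definition pullback (R : realType) (S T : fun_space R) (pi : S -> T) (w : form T) :
    form S :=
  fun x vs => w (pi x) [seq pushforward pi x v | v <- vs].

(* For a closed embedding k : U -> D, the stalk at x of
   k^-1 (E_D^{0,q} (x)_{O_D} k_* O_U) is the tensor product over O_{D,k(x)} of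
   E^{0,q}_{D,k(x)} and O_{U,x}; in particular it is unchanged when D is replaced
   by an open subset containing k(x).  Its elements are the classes of finite formal
   sums of pairs (w, s), standing for w (x) s. *)
Section Tensor.
Context {R : realType} {X S : fun_space R}.
Variables (k : X -> S) (q : nat).

Definition fsum : Type := seq (form S * (X -> R[i])).

Definition fsum_valid (x : X) (t : fsum) : Prop :=
  List.Forall (fun e => smooth_form q (k x) e.1 /\ hol x e.2) t.

Inductive fsum_eq (x : X) : fsum -> fsum -> Prop :=
| FeRefl t : fsum_valid x t -> fsum_eq x t t
| FeSym t u : fsum_eq x t u -> fsum_eq x u t
| FeTrans t u v : fsum_eq x t u -> fsum_eq x u v -> fsum_eq x t v
| FeCat t t' u u' : fsum_eq x t t' -> fsum_eq x u u' ->
    fsum_eq x (t ++ u) (t' ++ u')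
| FeComm t u : fsum_valid x t -> fsum_valid x u -> fsum_eq x (t ++ u) (u ++ t)
| FeGerm w w' s s' :
    fsum_valid x [:: (w, s)] -> fsum_valid x [:: (w', s')] ->
    (\forall y \near k x, form_eq_at q y w w') ->
    (\forall y \near x, s y = s' y) ->
    fsum_eq x [:: (w, s)] [:: (w', s')]
| FeZero s : fsum_valid x [:: (form0, s)] -> fsum_eq x [:: (form0, s)] [::]
| FeAddl w w' s : fsum_valid x [:: (w, s); (w', s)] ->
    fsum_eq x [:: (form_add w w', s)] [:: (w, s); (w', s)]
| FeAddr w s s' : fsum_valid x [:: (w, s); (w, s')] ->
    fsum_eq x [:: (w, fun y => s y + s' y)] [:: (w, s); (w, s')]
| FeBal f w s : hol (k x) f -> fsum_valid x [:: (w, s)] ->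
    fsum_eq x [:: (form_mul f w, s)] [:: (w, fun y => f (k y) * s y)].

(* The class of t in the stalk at x. *)
Definition tcls (x : X) (t : fsum) : set fsum := [set u | fsum_eq x t u].

Definition tzero (x : X) : set fsum := tcls x [::].
Definition tadd (x : X) (c1 c2 : set fsum) : set fsum :=
  [set u | exists t1 t2, [/\ c1 t1, c2 t2 & tcls x (t1 ++ t2) u]].

(* Sections over the open set V of the sheaf with these stalks: families of
   classes that are locally given by a fixed formal sum. *)
Definition tensor_section (V : set X) (s : X -> set fsum) : Prop :=
  forall x, V x -> exists t,
    \forall y \near x, V y -> fsum_valid y t /\ s y = tcls y t.
End Tensor.
Arguments fsum {R} X S.

(* The class in the stalk at x of k^-1 (E_S^{0,q} (x) k_* O) of the image of the
   class c under the map induced by the operation h on pairs. *)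
Definition tmap (R : realType) (X S S' : fun_space R) (k : X -> S) (q : nat) (x : X)
    (h : form S' * (X -> R[i]) -> form S * (X -> R[i])) (c : set (fsum X S')) :
    set (fsum X S) :=
  [set u | exists2 t, c t & tcls k q x (map h t) u].

(* A family (U_i, k_i, D_i) where D_i is the open subset [tdom i] of [tgt i]. *)
Record triples (R : realType) (X : fun_space R) (I : Type) := Triples {
  src : I -> set X;
  tgt : I -> fun_space R;
  tdom : forall i, set (tgt i);
  emb : forall i, X -> tgt i }.
Arguments tdom {R X I} t i.
Arguments emb {R X I} t i.

Section Atlases.
Context {R : realType} {X : fun_space R}.

Definition embedding_triples I (A : triples X I) : Prop :=
  forall i, manifold_in (tdom A i) /\
            closed_embedding (src A i) (tdom A i) (emb A i).

(* Adjunction of the triple (Reg X, id, Reg X), with index None. *)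
Definition reg_tgt I (A : triples X I) (i : option I) : fun_space R :=
  if i is Some i then tgt A i else X.
Definition with_reg I (A : triples X I) : triples X (option I) :=
  @Triples R X (option I)
    (fun i => if i is Some i then src A i else Reg X)
    (reg_tgt A)
    (fun i => if i is Some i return set (reg_tgt A i) then tdom A i else Reg X)
    (fun i => if i is Some i return X -> reg_tgt A i then emb A i else id).

(* The triples (U_i & W, k_i, D_i'), with D_i' the open set D_i \ k_i(U_i \ W),
   in which k_i(U_i & W) is closed. *)
Definition shrink I (A : triples X I) (W : set X) : triples X I :=
  @Triples R X I (fun i => src A i `&` W) (tgt A)
    (fun i => tdom A i `\` (emb A i @` (src A i `\` W)))
    (emb A).

(* The atlas A^(j) attached to the neighbourhood W = W_j of Sing X.  If A already
   contains (Reg X, id, Reg X), then A^(j) contains both its restriction to W_j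
   and the full triple. *)
Definition shrink_reg I (A : triples X I) (W : set X) : triples X (option I) :=
  with_reg (shrink A W).
End Atlases.

(* The complex Dolb(A; O_X).  The simplices are the strictly increasing
   sequences alpha of p.+1 indices; those with empty U_alpha contribute 0. *)
Section Dolb.
Context {R : realType} {X : fun_space R} {I : Type}.
Variables (lt : I -> I -> Prop) (A : triples X I).

Definition prod_tgt p (al : 'I_p.+1 -> I) : fun_space R :=
  prod_space (fun l => tgt A (al l)).
Definition prod_src p (al : 'I_p.+1 -> I) : set X :=
  [set x | forall l, src A (al l) x].
Definition prod_emb p (al : 'I_p.+1 -> I) : X -> prod_tgt al :=
  fun x l => emb A (al l) x.

Definition increasing p (al : 'I_p.+1 -> I) : Prop :=
  forall l l' : 'I_p.+1, (l < l')%N -> lt (al l) (al l').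

Definition cochain : Type :=
  forall p (al : 'I_p.+1 -> I), X -> set (fsum X (prod_tgt al)).

(* Degree n: the component indexed by al, of length p.+1, has type (0, n - p)
   and only the components with p <= n are meaningful. *)
Definition dolb_section (n : nat) (V : set X) (s : cochain) : Prop :=
  forall p (al : 'I_p.+1 -> I), (p <= n)%N -> increasing al ->
    tensor_section (@prod_emb p al) (n - p) (V `&` prod_src al) (s p al).

Definition dolb_eq (n : nat) (V : set X) (s t : cochain) : Prop :=
  forall p (al : 'I_p.+1 -> I), (p <= n)%N -> increasing al ->
    forall x, (V `&` prod_src al) x -> s p al x = t p al x.

Definition dolb_add (n : nat) (s t : cochain) : cochain := fun p al x =>
  tadd (@prod_emb p al) (n - p) x (s p al x) (t p al x).

Definition dolb_scale (n : nat) (f : X -> R[i]) (s : cochain) : cochain :=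
  fun p al x => tmap (@prod_emb p al) (n - p) x
    (fun e => (e.1, fun y => f y * e.2 y)) (s p al x).

(* The projection D_be -> D_{be \ be_j}. *)
Definition face_proj p (be : 'I_p.+2 -> I) (j : 'I_p.+2) :
    prod_tgt be -> prod_tgt (be \o lift j) :=
  fun y l => y (lift j l).

Definition cech (q p : nat) : cochain -> forall be : 'I_p.+1 -> I,
    X -> set (fsum X (prod_tgt be)) :=
  match p return cochain -> forall be : 'I_p.+1 -> I,
    X -> set (fsum X (prod_tgt be)) with
  | 0 => fun s be x => tzero (@prod_emb 0 be) q x
  | p'.+1 => fun s be x =>
      \big[tadd (@prod_emb p'.+1 be) q x / tzero (@prod_emb p'.+1 be) q x]_(j < p'.+2)
        tmap (@prod_emb p'.+1 be) q x
          (fun e => (form_mul (fun=> (-1) ^+ j)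
                              (pullback (@face_proj p' be j) e.1), e.2))
          (s p' (be \o lift j) x)
  end.

Arguments cech q p s be x : clear implicits.

(* The differential, from degree n to n.+1, of the simple complex: the Cech
   differential plus (-1)^p dbar (x) id on the components of Cech degree p. *)
Definition dolb_diff (n : nat) (s : cochain) : cochain := fun p al x =>
  let q := (n.+1 - p)%N in
  tadd (@prod_emb p al) q x
    (cech q p s al x)
    (if (p <= n)%N then
       tmap (@prod_emb p al) q x
         (fun e => (form_mul (fun=> (-1) ^+ p) (dbar e.1), e.2)) (s p al x)
     else tzero (@prod_emb p al) q x).
End Dolb.

(* Complexes of sheaves of O_X-modules.  The sections over V in degree n are the
   elements of [sh_sec n V] modulo [sh_eq n V], and restriction to a smaller
   open set leaves the underlying elements unchanged. *)
Record sheaf_complex (R : realType) (X : fun_space R) := SheafComplex {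
  sh_raw : Type;
  sh_sec : nat -> set X -> set sh_raw;
  sh_eq : nat -> set X -> sh_raw -> sh_raw -> Prop;
  sh_add : nat -> sh_raw -> sh_raw -> sh_raw;
  sh_scale : nat -> (X -> R[i]) -> sh_raw -> sh_raw;
  sh_diff : nat -> sh_raw -> sh_raw }.
Arguments sh_sec {R X} _ n V _.
Arguments sh_eq {R X} _ n V _ _.
Arguments sh_add {R X} _ n _ _.
Arguments sh_scale {R X} _ n f _.
Arguments sh_diff {R X} _ n _.

(* phi is an isomorphism E|U0 -> F|U0 of complexes of sheaves of O_X-modules. *)
Definition iso_of_complexes_on (R : realType) (X : fun_space R) (U0 : set X)
    (E F : sheaf_complex X) (phi : nat -> sh_raw E -> sh_raw F) : Prop :=
  forall n (V : set X), open V -> V `<=` U0 ->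
  [/\ forall s, sh_sec E n V s -> sh_sec F n V (phi n s),
      forall s t, sh_sec E n V s -> sh_sec E n V t ->
        (sh_eq E n V s t <-> sh_eq F n V (phi n s) (phi n t)),
      forall u, sh_sec F n V u ->
        exists2 s, sh_sec E n V s & sh_eq F n V (phi n s) u,
      forall s t f, sh_sec E n V s -> sh_sec E n V t ->
        (forall x, V x -> hol x f) ->
        sh_eq F n V (phi n (sh_add E n s t)) (sh_add F n (phi n s) (phi n t)) /\
        sh_eq F n V (phi n (sh_scale E n f s)) (sh_scale F n f (phi n s))
    & forall s, sh_sec E n V s ->
        [/\ sh_sec E n.+1 V (sh_diff E n s),
            sh_sec F n.+1 V (sh_diff F n (phi n s))
          & sh_eq F n.+1 V (phi n.+1 (sh_diff E n s)) (sh_diff F n (phi n s))]].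

Arguments iso_of_complexes_on {R X} U0 E F phi.

(* (E^{0,.}, dbar), to be considered over open subsets of Reg X only. *)
Definition dolbeault_complex (R : realType) (X : fun_space R) : sheaf_complex X :=
  {| sh_raw := form X;
     sh_sec := fun n V => [set w | forall x, V x -> smooth_form n x w];
     sh_eq := fun n V w w' => forall x, V x -> form_eq_at n x w w';
     sh_add := fun _ => form_add;
     sh_scale := fun _ => form_mul;
     sh_diff := fun _ => dbar |}.

(* The inductive limit over j of the complexes of sheaves Dolb(A^(j); O_X).  The
   stalk at x of the limit is the set of classes of pairs (j, s), with s a
   section of Dolb(A^(j); O_X) near x.  The spaces containing the D_i' do not
   depend on j, so the transition maps leave the underlying cochains unchanged. *)
Section RDolb.
Context {R : realType} {X : fun_space R} {I J : Type}.
Variables (A : triples X I) (lt : option I -> option I -> Prop) (W : J -> set X).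

Definition rcochain : Type := cochain (with_reg A).

Definition rgerm : Type := (J * rcochain)%type.

Definition rgerm_valid (n : nat) (x : X) (g : rgerm) : Prop :=
  exists2 N, open_nbhs x N & dolb_section lt (A := shrink_reg A (W g.1)) n N g.2.

Definition rgerm_eq (n : nat) (x : X) (g h : rgerm) : Prop :=
  [/\ rgerm_valid n x g, rgerm_valid n x h
    & exists j N, [/\ W j `<=` W g.1 `&` W h.1, open_nbhs x N
        & dolb_eq lt (A := shrink_reg A (W j)) n N g.2 h.2]].

Definition rcls (n : nat) (x : X) (g : rgerm) : set rgerm :=
  [set h | rgerm_eq n x g h].

Definition rDolb : sheaf_complex X :=
  {| sh_raw := X -> set rgerm;
     sh_sec := fun n V => [set s | forall x, V x ->
       exists g N, [/\ open_nbhs x N,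
         dolb_section lt (A := shrink_reg A (W g.1)) n N g.2
         & forall y, V y -> N y -> s y = rcls n y g]];
     sh_eq := fun n V s t => forall x, V x -> s x = t x;
     sh_add := fun n s t x => [set h | exists j a b,
       [/\ s x (j, a), t x (j, b)
         & rcls n x (j, dolb_add (A := shrink_reg A (W j)) n a b) h]];
     sh_scale := fun n f s x => [set h | exists j a,
       s x (j, a) /\ rcls n x (j, dolb_scale (A := shrink_reg A (W j)) n f a) h];
     sh_diff := fun n s x => [set h | exists j a,
       s x (j, a) /\ rcls n.+1 x (j, dolb_diff (A := shrink_reg A (W j)) n a) h]
  |}.

(* The (0,n)-form w, placed on Reg X if i is the index of (Reg X, id, Reg X). *)
Definition reg_form (w : form X) (i : option I) : form (tgt (with_reg A) i) :=
  match i return form (tgt (with_reg A) i) with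
  | None => w
  | Some _ => form0
  end.

(* The cochain with component w (x) 1 on the simplex (Reg X, id, Reg X), and
   with component 0 on the other ones. *)
Definition unit_cochain (n : nat) (w : form X) : rcochain := fun p =>
  match p return forall al : 'I_p.+1 -> option I,
    X -> set (fsum X (prod_tgt (with_reg A) al)) with
  | 0 => fun al x => tcls (@prod_emb _ _ _ (with_reg A) 0 al) n x
           [:: (pullback (fun y : prod_tgt (with_reg A) al => y ord0)
                         (@reg_form w (al ord0)), fun=> 1)]
  | p'.+1 => fun al x =>
      tzero (@prod_emb _ _ _ (with_reg A) p'.+1 al) (n - p'.+1) x
  end.

(* The canonical morphism E^{0,n} -> rDolb^n over Reg X: the class of
   [unit_cochain n w], seen in Dolb(A^(j); O_X) for any j. *)
Definition canonical_map (n : nat) (w : sh_raw (dolbeault_complex X)) :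
    sh_raw rDolb :=
  fun x => [set h | exists j, rcls n x (j, unit_cochain n w) h].
End RDolb.

Arguments canonical_map {R X I J} A lt W n w x.

Definition strict_total_order (I : Type) (lt : I -> I -> Prop) : Prop :=
  [/\ forall i, ~ lt i i, forall i j k, lt i j -> lt j k -> lt i k
    & forall i j, i <> j -> lt i j \/ lt j i].

Definition neighbourhood_basis (T : topologicalType) (Z : set T) (J : Type)
    (W : J -> set T) : Prop :=
  (forall j, open (W j) /\ Z `<=` W j) /\
  (forall N, open N -> Z `<=` N -> exists j, W j `<=` N).

(* Main.v *)
(* On the regular locus the limit is computed by one simplex.  A regular point has
   a compact neighbourhood inside Reg X, so some W_j misses a neighbourhood N of it;
   over N the only simplex of A^(j) with nonempty U_alpha is (Reg X, id, Reg X),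
   whose D_alpha is a one-factor product, isomorphic to X.  Over an isomorphism
   k : X -> D, every formal sum is equivalent to some w (x) 1, because
   w (x) s = (s o k^-1) w (x) 1, and w is determined by its class; so the stalk of
   rDolb^n is the stalk of E^{0,n}, compatibly with dbar.
   The analytic content is that dbar is independent of the chart in which it is
   computed: under a holomorphic change of coordinates h the extra terms contain
   second derivatives of h, which are symmetric, inside an alternating form, and
   cancel in pairs. *)
Require Import Defs.
From mathcomp Require Import all_boot all_order all_algebra.
From mathcomp Require Import all_classical all_reals all_analysis.
From mathcomp Require Import complex.
From mathcomp Require Import ring.
Set Implicit Arguments.
Unset Strict Implicit.
Unset Printing Implicit Defensive.
Import Order.TTheory GRing.Theory Num.Theory.
Import numFieldNormedType.Exports.
Local Open Scope classical_set_scope.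
Local Open Scope ring_scope.
Local Open Scope complex_scope.

(** * Real directional derivatives *)

(** [dird] is a derivative along one real line, so neither its linearity in the vector nor the chain
    rule comes with the definition. Both are derived from the continuity of the directional
    derivatives, by the mean value theorem along a broken path; linearity is the chain rule for the
    identity map. [dbar] picks a chart at every point separately, and the choice may jump from point
    to point. Hence even the smoothness of [dbar w], and its dependence on the germ of [w] alone,
    rest on the independence of the chart. The tensor product is presented by generators and
    relations. Instead of checking an operation against each relation, formal sums are sent to forms
    by [w (x) s |-> s k^* w]; over an isomorphism this is injective on classes, so equalities of
    classes become equalities of germs of forms. A class at one point thus determines a germ, and an
    element of the limit at a regular point is determined by the class at that point of one
    component. *)

Section ComplexTopology.
Context {R : realType}.

Lemma continuous_complexRe : continuous (@complex.Re R : R[i] -> R).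
Proof.
move=> z A /= /nbhs_ballP[e /= e0 sA]; apply/nbhs_ballP; exists e%:C => /=.
  by rewrite ltcR.
move=> y /= yz; apply: sA; move: yz; rewrite /ball/= -raddfB => yz.
by rewrite -ltcR; apply: le_lt_trans yz; exact: normc_ge_Re.
Qed.

Lemma continuous_complexIm : continuous (@complex.Im R : R[i] -> R).
Proof.
move=> z A /= /nbhs_ballP[e /= e0 sA]; apply/nbhs_ballP; exists e%:C => /=.
  by rewrite ltcR.
move=> y /= yz; apply: sA; move: yz; rewrite /ball/= -raddfB => yz.
rewrite -ltcR; apply: le_lt_trans yz; rewrite [leRHS]normc_def lecR.
by rewrite -sqrtr_sqr ler_wsqrtr// lerDr sqr_ge0.
Qed.

Lemma continuous_real_complex : continuous (fun t : R => t%:C : R[i]).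
Proof.
move=> t A /= /nbhs_ballP[e /= e0 sA]; apply/nbhs_ballP.
(* Balls of [R[i]] have radii in [R[i]]; a positive one is real. *)
have eE : e = (complex.Re e)%:C by rewrite RRe_real// gtr0_real.
exists (complex.Re e) => /=; first by rewrite -ltcR -eE.
move=> y /= yz; apply: sA; move: yz; rewrite /ball/= -raddfB => yz.
by rewrite eE normc_def /= expr0n /= addr0 sqrtr_sqr ltcR.
Qed.

Lemma cvg_complex (T : Type) (F : set_system T) (FF : Filter F) (f : T -> R[i]) (l : R[i]) :
  (fun t => complex.Re (f t)) @ F --> complex.Re l ->
  (fun t => complex.Im (f t)) @ F --> complex.Im l ->
  f @ F --> l.
Proof.
move=> fR fI; rewrite [l]complexE.
have -> : f = (fun t => (complex.Re (f t))%:C + 'i * (complex.Im (f t))%:C).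
  by apply/funext => t; rewrite -complexE.
apply: cvgD; first by exact: (cvg_comp _ _ fR (@continuous_real_complex _)).
apply: cvgM; first exact: cvg_cst.
by exact: (cvg_comp _ _ fI (@continuous_real_complex _)).
Qed.

Lemma continuous_affine n (z u : 'rV[R[i]]_n) : continuous (fun t : R => z + t%:C *: u).
Proof.
move=> t; apply: cvgD; first exact: cvg_cst.
apply: cvgZ; last exact: cvg_cst; exact: continuous_real_complex.
Qed.

Lemma cvg_affine0 n (z u : 'rV[R[i]]_n) : (fun t : R => z + t%:C *: u) @ (0:R) --> z.
Proof. by have := @continuous_affine n z u 0; rewrite /continuous_at scale0r addr0. Qed.

Lemma cvg_affine2 n (z u v : 'rV[R[i]]_n) :
  (fun p : R * R => z + p.1%:C *: u + p.2%:C *: v) @ ((0 : R), (0 : R)) --> z.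
Proof.
rewrite -[in X in _ --> X](addr0 z) -[in X in _ --> X](scale0r u).
rewrite -[in X in _ --> X](addr0 (z + _)) -[in X in _ --> X](scale0r v).
have H (f : R * R -> R) (l : R) : f @ ((0 : R), (0 : R)) --> l ->
  (fun p => (f p)%:C : R[i]) @ ((0 : R), (0 : R)) --> (l%:C : R[i]).
  by move=> fl; exact: (cvg_comp _ _ fl (@continuous_real_complex _)).
apply: cvgD; last by apply: cvgZ; [apply: H; exact: cvg_snd|exact: cvg_cst].
apply: cvgD; first exact: cvg_cst.
by apply: cvgZ; [apply: H; exact: cvg_fst|exact: cvg_cst].
Qed.
End ComplexTopology.

Section DirectionalDerivatives.
Context {R : realType}.

Lemma cvg_ext (T : Type) (U : topologicalType) (F : set_system T) (f g : T -> U) (l : U) :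
  f =1 g -> f @ F --> l -> g @ F --> l.
Proof. by move=> /funext ->. Qed.

Lemma is_derive_ext (f g : R -> R) (x d : R) :
  f =1 g -> is_derive x 1 f d -> is_derive x 1 g d.
Proof. by move=> /funext ->. Qed.

(** The library derivative has increment [h *: 1]; as a limit of ordinary quotients it can be
    handled by products of limits. *)
Lemma is_derive_ratio (f : R -> R) (x d : R) :
  h^-1 * (f (h + x) - f x) @[h --> (0 : R)^'] --> d <-> is_derive x 1 f d.
Proof.
have E : (fun h : R => h^-1 * (f (h + x) - f x)) =
         (fun h => h^-1 *: (f (h *: 1 + x) - f x)).
  by apply/funext => h; rewrite /GRing.scale /= mulr1.
split=> [fd|[dfx <-]]; last by rewrite E; exact: dfx.
by rewrite E in fd; split; [apply/cvg_ex; exists d|exact/cvg_lim].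
Qed.

Context {n : nat}.
Implicit Types (g : 'rV[R[i]]_n -> R) (z u v : 'rV[R[i]]_n).

Definition rdir g u z : R := derive1 (fun t : R => g (z + t%:C *: u)) 0.

Definition rderivable g u z : Prop := derivable (fun t : R => g (z + t%:C *: u)) 0 1.

Lemma rderivableP g u z :
  rderivable g u z -> is_derive (0 : R) 1 (fun t : R => g (z + t%:C *: u)) (rdir g u z).
Proof. by move=> h; rewrite /rdir derive1E; exact: derivableP. Qed.

(** A derivative at the parameter [s] is one at 0 for the line based at [z + s u]. *)
Lemma is_derive_line g u z (s : R) : rderivable g u (z + s%:C *: u) ->
  is_derive s 1 (fun t : R => g (z + t%:C *: u)) (rdir g u (z + s%:C *: u)).
Proof.
move=> /rderivableP/is_derive_ratio h; apply/is_derive_ratio.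
apply: (cvg_ext _ h) => t; rewrite addr0 scale0r addr0.
by rewrite -(addrA z) -scalerDl -raddfD (addrC s).
Qed.

(** The bound [|s| <= |d|] makes the statement insensitive to the sign of [d]: the displacements to
    which it is applied may change sign infinitely often near 0. *)
Lemma line_MVT g u z (d : R) :
  (forall s : R, `|s| <= `|d| -> rderivable g u (z + s%:C *: u)) ->
  exists2 s : R, `|s| <= `|d| &
    g (z + d%:C *: u) - g z = d * rdir g u (z + s%:C *: u).
Proof.
move=> gd; pose p (t : R) := g (z + t%:C *: u).
have pd (t : R) : `|t| <= `|d| -> is_derive t 1 p (rdir g u (z + t%:C *: u)).
  by move=> td; exact/is_derive_line/gd.
have p0 : p 0 = g z by rewrite /p scale0r addr0.
have [d0|d0] := leP 0 d.
  have sub (t : R) : t \in `[0, d] -> `|t| <= `|d|.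
    by rewrite in_itv /= => /andP[? ?]; rewrite !ger0_norm.
  have [| |s sd E] := @MVT_segment R p (fun t => rdir g u (z + t%:C *: u)) 0 d d0.
  - by move=> t td; apply/pd/sub; exact: subset_itv_oo_cc td.
  - by apply: derivable_within_continuous => t /sub/pd[].
  by exists s; [exact: sub|rewrite -p0 [LHS]E subr0 mulrC].
have sub (t : R) : t \in `[d, 0] -> `|t| <= `|d|.
  by rewrite in_itv /= => /andP[? ?]; rewrite !ler0_norm ?lerN2// ltW.
have [| |s sd E] := @MVT_segment R p (fun t => rdir g u (z + t%:C *: u)) d 0 (ltW d0).
- by move=> t td; apply/pd/sub; exact: subset_itv_oo_cc td.
- by apply: derivable_within_continuous => t /sub/pd[].
exists s; first exact: sub.
rewrite -p0; apply: oppr_inj; rewrite opprB [LHS]E sub0r mulrC.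
by rewrite mulNr.
Qed.

(* An item [x] is a displacement [x.1.1], with derivative [x.1.2] at 0, along [x.2]. *)
Definition path_at (ps : seq ((R -> R) * R * 'rV[R[i]]_n)) (t : R) : 'rV[R[i]]_n :=
  \sum_(x <- ps) (x.1.1 t)%:C *: x.2.

Definition path_ok (x : (R -> R) * R * 'rV[R[i]]_n) : Prop :=
  is_derive (0 : R) 1 x.1.1 x.1.2 /\ x.1.1 0 = 0.

Lemma is_derive0_cvg (f : R -> R) (x d : R) : is_derive x 1 f d -> f @ x --> f x.
Proof.
by move=> [fd _]; apply/differentiable_continuous/derivable1_diffP.
Qed.

Lemma path_at_cvg ps z : List.Forall path_ok ps -> (fun t => z + path_at ps t) @ (0 : R) --> z.
Proof.
elim: ps => [|x ps IH] h.
  by apply: (cvg_ext _ (cvg_cst z)) => t; rewrite /path_at big_nil addr0.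
have [[dx x0] /IH zps] := (List.Forall_inv h, List.Forall_inv_tail h).
have xc : (fun t => (x.1.1 t)%:C : R[i]) @ (0 : R) --> (0 : R[i]).
  have := is_derive0_cvg dx; rewrite x0 => xc.
  exact: (cvg_comp _ _ xc (@continuous_real_complex R 0)).
have zxc : (fun t => (z + path_at ps t) + (x.1.1 t)%:C *: x.2) @ (0 : R) -->
    z + (0 : R[i]) *: x.2.
  by apply: (cvgD zps); apply: (cvgZ xc); exact: cvg_cst.
rewrite scale0r addr0 in zxc.
by apply: (cvg_ext _ zxc) => t; rewrite /path_at big_cons (addrC (_ *: _)) addrA.
Qed.

(* Telescoping: replacing one displacement at a time, each increment is evaluated
   by the mean value theorem. *)
Lemma is_derive_path g z ps :
  List.Forall path_ok ps ->
  List.Forall (fun x => (\forall y \near z, rderivable g x.2 y) /\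
                        {for z, continuous (rdir g x.2)}) ps ->
  is_derive (0 : R) 1 (fun t => g (z + path_at ps t)) (\sum_(x <- ps) x.1.2 * rdir g x.2 z).
Proof.
elim: ps => [|x ps IH] ok dg.
  rewrite big_nil; apply: (is_derive_ext _ (is_derive_cst (g z) _ _)) => t.
  by rewrite /path_at big_nil addr0.
have [xok psok] := (List.Forall_inv ok, List.Forall_inv_tail ok).
have [[dx cx] dps] := (List.Forall_inv dg, List.Forall_inv_tail dg).
have {}IH := IH psok dps.
case: x xok dx cx ok dg => -[/= dl d] u [/= dld dl0] du cu _ _.
rewrite big_cons.
(* [K] is the increment along [u] alone, from the point that the rest of the path has reached. *)
pose K t := g (z + path_at ps t + (dl t)%:C *: u) - g (z + path_at ps t).
suff dK : is_derive (0 : R) 1 K (d * rdir g u z).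
  apply: (is_derive_ext _ (is_deriveD dK IH)) => t; rewrite /K fctE /= subrK.
  by rewrite /path_at big_cons /= (addrC (_ *: _)) addrA.
set L := rdir g u z.
(* The value [L] at the zeros of [dl] keeps [K = dl * m] true everywhere and does not disturb the
   limit of [m]. *)
pose m t := if dl t == 0 then L else K t / dl t.
have Km t : K t = dl t * m t.
  rewrite /m; case: eqP => [d0|/eqP d0]; last by rewrite mulrC divfK.
  by rewrite /K d0 mul0r scale0r addr0 subrr.
have m0 : m 0 = L by rewrite /m dl0 eqxx.
have mc : m @ (0 : R) --> L.
  apply/cvgrPdist_lt => e e0.
  have near_ok : \forall y \near z, rderivable g u y /\ `|L - rdir g u y| < e.
    by near=> y; split; near: y => //; move/cvgrPdist_lt: cu; exact.
  (* The mean value theorem yields an unknown displacement [s] with [|s| <= |dl t|], so [s] has to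
     be a variable independent of [t]. *)
  have cpath : (fun p : R * R => z + path_at ps p.1 + p.2%:C *: u) @ ((0 : R), (0 : R)) --> z.
    have pc := @path_at_cvg ps z psok.
    have pc1 : (fun p : R * R => z + path_at ps p.1) @ ((0 : R), (0 : R)) --> z.
      have h1 : (fun p : R * R => p.1) @ ((0 : R), (0 : R)) --> (0 : R) by exact: cvg_fst.
      exact: (cvg_comp _ _ h1 pc).
    have pc2 : (fun p : R * R => p.2%:C : R[i]) @ ((0 : R), (0 : R)) --> (0 : R[i]).
      have h2 : (fun p : R * R => p.2) @ ((0 : R), (0 : R)) --> (0 : R) by exact: cvg_snd.
      exact: (cvg_comp _ _ h2 (@continuous_real_complex R 0)).
    have : (fun p : R * R => z + path_at ps p.1 + p.2%:C *: u) @ ((0 : R), (0 : R)) -->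
        z + (0 : R[i]) *: u.
      by apply: (cvgD pc1); apply: (cvgZ pc2); exact: cvg_cst.
    by rewrite scale0r addr0.
  have := cpath _ near_ok => -[[A B] /= [A0 B0] AB].
  move/nbhs_ballP: B0 => [r /= r0 rB].
  have dlc : \forall t \near (0 : R), `|dl t| < r.
    have /cvgrPdist_lt/(_ r r0) := is_derive0_cvg dld.
    by apply: filterS => t; rewrite dl0 sub0r normrN.
  near=> t.
  rewrite /m; case: eqP => [_|/eqP dt0]; first by rewrite subrr normr0.
  have inB (s : R) : `|s| <= `|dl t| ->
      rderivable g u (z + path_at ps t + s%:C *: u) /\
      `|L - rdir g u (z + path_at ps t + s%:C *: u)| < e.
    move=> sd; apply: (AB (t, s)); split=> /=; first by near: t.
    apply: rB; rewrite /ball /= sub0r normrN; apply: le_lt_trans sd _.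
    by near: t.
  have [s sd E] := line_MVT (fun s sd => (inB s sd).1).
  rewrite /K E mulrC mulKf//; exact: (inB s sd).2.
have K0 : K 0 = 0 by rewrite Km dl0 mul0r.
have /is_derive_ratio dlr := dld.
have mr : m @ (0 : R)^' --> L by exact: cvg_within_filter.
(* [K h / h] is [(dl h / h) * m h], which tends to [d * L]. *)
apply/is_derive_ratio; apply: (cvg_ext _ (cvgM dlr mr)) => h.
by rewrite /= K0 dl0 !subr0 addr0 Km mulrA.
Unshelve. all: by end_near. Qed.
End DirectionalDerivatives.

(** * Symmetry of second derivatives *)

Section SecondDerivatives.
Context {R : realType} {n : nat}.
Implicit Types (g : 'rV[R[i]]_n -> R) (z u v : 'rV[R[i]]_n).

(** Mean value theorem twice: along [u] for the increment [p] of [g] in the direction [v], then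
    along [v] for [rdir g u]. *)
Lemma double_difference g u v z (h : R) :
  (forall s t : R, `|s| <= `|h| -> `|t| <= `|h| ->
     rderivable g u (z + s%:C *: u + t%:C *: v) /\
     rderivable (rdir g u) v (z + s%:C *: u + t%:C *: v)) ->
  exists s t : R, [/\ `|s| <= `|h|, `|t| <= `|h| &
    g (z + h%:C *: u + h%:C *: v) - g (z + h%:C *: u) - (g (z + h%:C *: v) - g z) =
    h * (h * rdir (rdir g u) v (z + s%:C *: u + t%:C *: v))].
Proof.
move=> gd; pose p y := g (y + h%:C *: v) - g y.
have pd (s : R) : `|s| <= `|h| ->
    is_derive (0 : R) 1 (fun t : R => p (z + s%:C *: u + t%:C *: u))
      (rdir g u (z + s%:C *: u + h%:C *: v) - rdir g u (z + s%:C *: u)).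
  move=> sh; have h0 : `|0 : R| <= `|h| by rewrite normr0.
  have [/rderivableP d1 _] := gd s h sh (lexx _).
  have [/rderivableP d0 _] := gd s 0 sh h0.
  rewrite scale0r addr0 in d0.
  by apply: (is_derive_ext _ (is_deriveB d1 d0)) => t; rewrite /p /= [in RHS]addrAC.
have pdv (s : R) : `|s| <= `|h| -> rdir p u (z + s%:C *: u) =
    rdir g u (z + s%:C *: u + h%:C *: v) - rdir g u (z + s%:C *: u).
  by move=> /pd[_ <-]; rewrite /rdir derive1E.
have [s sh E] := line_MVT (fun s sh => @ex_derive _ _ _ _ _ _ _ (pd s sh)).
have [t th E'] := @line_MVT _ _ (rdir g u) v (z + s%:C *: u) h (fun t th => (gd s t sh th).2).
exists s, t; split => //.
by rewrite pdv// E' in E; rewrite -E /p.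
Qed.

(* Schwarz: both mixed derivatives are limits of the same double difference. *)
Lemma rdir_sym g u v z :
  (\forall y \near z, [/\ rderivable g u y, rderivable g v y,
     rderivable (rdir g u) v y & rderivable (rdir g v) u y]) ->
  {for z, continuous (rdir (rdir g u) v)} -> {for z, continuous (rdir (rdir g v) u)} ->
  rdir (rdir g u) v z = rdir (rdir g v) u z.
Proof.
move=> gd cuv cvu; apply/eqP; rewrite -subr_eq0 -normr_eq0 eq_le normr_ge0 andbT.
apply/ler_addgt0Pl => e e0; rewrite addr0.
have e20 : 0 < e / 2 by rewrite divr_gt0.
pose N y := [/\ rderivable g u y, rderivable g v y,
     rderivable (rdir g u) v y & rderivable (rdir g v) u y] /\
     `|rdir (rdir g u) v z - rdir (rdir g u) v y| < e / 2 /\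
     `|rdir (rdir g v) u z - rdir (rdir g v) u y| < e / 2.
have NN : nbhs z N.
  have /cvgrPdist_lt/(_ _ e20) c1 := cuv; have /cvgrPdist_lt/(_ _ e20) c2 := cvu.
  exact: (filterI gd (filterI c1 c2)).
have [[A B] /= [/nbhs_ballP[r1 /= r10 rA] /nbhs_ballP[r2 /= r20 rB]] AB] :=
  cvg_affine2 u v NN.
(* All intermediate points of both double differences have parameters bounded by [h], hence lie in
   [N]. *)
pose h := Num.min r1 r2 / 2.
have r0 : 0 < Num.min r1 r2 by rewrite lt_min r10 r20.
have h0 : 0 < h by rewrite divr_gt0.
have hr1 : h < r1.
  by apply: (@lt_le_trans _ _ (Num.min r1 r2)); [rewrite /h ltr_pdivrMr// mulr_natr mulr2n ltrDl|rewrite ge_min lexx ?orbT].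
have hr2 : h < r2.
  by apply: (@lt_le_trans _ _ (Num.min r1 r2)); [rewrite /h ltr_pdivrMr// mulr_natr mulr2n ltrDl|rewrite ge_min lexx ?orbT].
have inN (s t : R) : `|s| <= `|h| -> `|t| <= `|h| -> N (z + s%:C *: u + t%:C *: v).
  rewrite (gtr0_norm h0) => sh th; apply: (AB (s, t)); split => /=.
    by apply: rA; rewrite /ball /= sub0r normrN (le_lt_trans sh).
  by apply: rB; rewrite /ball /= sub0r normrN (le_lt_trans th).
have comm (a b : R) : z + a%:C *: v + b%:C *: u = z + b%:C *: u + a%:C *: v.
  exact: addrAC.
have [|s [t [sh th E]]] := @double_difference g u v z h.
  by move=> s t sh th; have [[? ? ? ?] _] := inN s t sh th.
have [|s' [t' [sh' th' E']]] := @double_difference g v u z h.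
  by move=> s' t' sh' th'; rewrite comm; have [[? ? ? ?] _] := inN t' s' th' sh'.
have EE : rdir (rdir g u) v (z + s%:C *: u + t%:C *: v) =
    rdir (rdir g v) u (z + t'%:C *: u + s'%:C *: v).
  have hn0 : h != 0 by rewrite gt_eqF.
  rewrite !comm in E'; apply: (mulfI hn0); apply: (mulfI hn0).
  apply: etrans (esym E) (etrans _ E').
  (* The double difference is symmetric in [u] and [v]. *)
  have swap (a b c d : R) : a - b - (c - d) = a - c - (b - d) by ring.
  exact: swap.
have [_ [A1 _]] := inN s t sh th; have [_ [_ B1]] := inN t' s' th' sh'.
rewrite EE in A1; rewrite (splitr e).
have tri (x y c : R) : `|x - c| < e / 2 -> `|y - c| < e / 2 -> `|x - y| <= e / 2 + e / 2.
  move=> xc yc; have -> : x - y = (x - c) - (y - c) by ring.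
  by apply: le_trans (ler_normB _ _) _; apply: lerD; exact: ltW.
exact: tri A1 B1.
Qed.
End SecondDerivatives.

(** * Derivatives of complex functions *)

Section ComplexDerivatives.
Context {R : realType}.

Lemma cReD (x y : R[i]) : complex.Re (x + y) = complex.Re x + complex.Re y.
Proof. by case: x y => ? ? []. Qed.

Lemma cImD (x y : R[i]) : complex.Im (x + y) = complex.Im x + complex.Im y.
Proof. by case: x y => ? ? []. Qed.

Lemma cReM (x y : R[i]) :
  complex.Re (x * y) = complex.Re x * complex.Re y - complex.Im x * complex.Im y.
Proof. by case: x y => ? ? []. Qed.

Lemma cImM (x y : R[i]) :
  complex.Im (x * y) = complex.Re x * complex.Im y + complex.Im x * complex.Re y.
Proof. by case: x y => ? ? []. Qed.

Lemma cReJ (x : R[i]) : complex.Re (x^*)%R = complex.Re x.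
Proof. by case: x. Qed.

Lemma cImJ (x : R[i]) : complex.Im (x^*)%R = - complex.Im x.
Proof. by case: x. Qed.

Section OneSpace.
Context {n : nat}.
Implicit Types (f g : 'rV[R[i]]_n -> R[i]) (z u v : 'rV[R[i]]_n).

(** Existence and value in one relation, like [is_derive]: the rules of calculus then compose
    without separate derivability conditions. *)
Definition is_dird f v z (d : R[i]) : Prop :=
  is_derive (0 : R) 1 (re_along f v z) (complex.Re d) /\
  is_derive (0 : R) 1 (im_along f v z) (complex.Im d).

Lemma has_dirdP f v z : has_dird f v z -> is_dird f v z (dird f v z).
Proof. 
move=> [/derivableP fr /derivableP fi]; rewrite -derive1E in fr; rewrite -derive1E in fi.
exact: (conj fr fi). Qed.

Lemma is_dird_has f v z d : is_dird f v z d -> has_dird f v z.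
Proof. by move=> [[fr _] [fi _]]; exact: (conj fr fi). Qed.

Lemma is_dird_val f v z d : is_dird f v z d -> dird f v z = d.
Proof. by case: d => a b [/= [_ fa] [_ fb]]; rewrite /dird !derive1E fa fb. Qed.

Lemma near_line (P : set 'rV[R[i]]_n) v z :
  (\forall y \near z, P y) -> \forall t \near (0 : R), P (z + t%:C *: v).
Proof. by move=> zP; exact: (@cvg_affine0 R n z v). Qed.

Lemma is_dird_near f g v z d :
  (\forall y \near z, f y = g y) -> is_dird f v z d -> is_dird g v z d.
Proof.
move=> /(near_line v) fg [fr fi]; split.
  by apply: near_eq_is_derive fr; apply: filterS fg => t; rewrite /re_along => ->.
by apply: near_eq_is_derive fi; apply: filterS fg => t; rewrite /im_along => ->.
Qed.

Lemma dird_near f g v z : (\forall y \near z, f y = g y) -> dird f v z = dird g v z.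
Proof.
move=> /(near_line v) fg; rewrite /dird !derive1E.
congr (_ +i* _); apply: near_eq_derive; rewrite ?oner_neq0//.
  by apply: filterS fg => t; rewrite /re_along => ->.
by apply: filterS fg => t; rewrite /im_along => ->.
Qed.

Lemma is_dird_cst c v z : is_dird (fun=> c) v z 0.
Proof. by split; exact: is_derive_cst. Qed.

Lemma is_dirdD f g v z a b :
  is_dird f v z a -> is_dird g v z b -> is_dird (fun y => f y + g y) v z (a + b).
Proof.
move=> [fr fi] [gr gi]; split; rewrite ?cReD ?cImD.
  by apply: (is_derive_ext _ (is_deriveD fr gr)) => t; rewrite /re_along cReD.
by apply: (is_derive_ext _ (is_deriveD fi gi)) => t; rewrite /im_along cImD.
Qed.

Lemma is_dirdM f g v z a b :
  is_dird f v z a -> is_dird g v z b ->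
  is_dird (fun y => f y * g y) v z (a * g z + f z * b).
Proof.
move=> [fr fi] [gr gi].
have z0 : z + (0 : R)%:C *: v = z by rewrite scale0r addr0.
split.
  have h := is_deriveB (is_deriveM fr gr) (is_deriveM fi gi).
  apply: is_derive_eq (is_derive_ext _ h) _.
    by move=> t; rewrite /re_along cReM.
  rewrite /re_along /im_along z0 cReD !cReM /GRing.scale /=; ring.
have h := is_deriveD (is_deriveM fr gi) (is_deriveM fi gr).
apply: is_derive_eq (is_derive_ext _ h) _.
  by move=> t; rewrite /im_along cImM.
rewrite /re_along /im_along z0 cImD !cImM /GRing.scale /=; ring.
Qed.

Lemma is_dird_conj f v z a : is_dird f v z a -> is_dird (fun y => ((f y)^*)%R) v z (a^*)%R.
Proof.
move=> [fr fi]; split; rewrite ?cReJ ?cImJ.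
  by apply: (is_derive_ext _ fr) => t; rewrite /re_along cReJ.
by apply: (is_derive_ext _ (is_deriveN fi)) => t; rewrite /im_along cImJ.
Qed.

Lemma is_dird_coord (j : 'I_n) v z : is_dird (fun y => y 0 j) v z (v 0 j).
Proof.
split.
  have h : is_derive (0 : R) 1
      (cst (complex.Re (z 0 j)) + (complex.Re (v 0 j) *: id : R -> R))
      (0 + complex.Re (v 0 j) *: 1).
    by apply: is_deriveD.
  apply: is_derive_eq (is_derive_ext _ h) _.
    move=> t; rewrite /re_along !mxE cReD fctE /=; congr (_ + _).
    by case: (v 0 j) => a b /=; rewrite mul0r subr0 mulrC.
  by rewrite add0r /GRing.scale /= mulr1.
have h : is_derive (0 : R) 1
    (cst (complex.Im (z 0 j)) + (complex.Im (v 0 j) *: id : R -> R))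
    (0 + complex.Im (v 0 j) *: 1).
  by apply: is_deriveD.
apply: is_derive_eq (is_derive_ext _ h) _.
  move=> t; rewrite /im_along !mxE cImD fctE /=; congr (_ + _).
  by case: (v 0 j) => a b /=; rewrite mul0r addr0 mulrC.
by rewrite add0r /GRing.scale /= mulr1.
Qed.

(** Existence is asked near [z] and continuity at [z], which is what [is_derive_path] consumes. *)
Definition C1at (g : 'rV[R[i]]_n -> R) z : Prop :=
  forall u, (\forall y \near z, rderivable g u y) /\ {for z, continuous (rdir g u)}.

(** The real differential of [g] at [z] applied to [b], expanded in the real frame [e_j, i e_j]. *)
Definition frame_sum (g : 'rV[R[i]]_n -> R) (b : 'rV[R[i]]_n) z : R :=
  \sum_j complex.Re (b 0 j) * rdir g (delta_mx 0 j) z +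
  \sum_j complex.Im (b 0 j) * rdir g ('i *: delta_mx 0 j) z.
End OneSpace.

(** The displacement of [h] along the line is split into real multiples of [e_j] and [i e_j], which
    makes it a path to which [is_derive_path] applies. *)
Lemma is_derive_comp_frame m n (h : 'rV[R[i]]_m -> 'rV[R[i]]_n) (g : 'rV[R[i]]_n -> R) v z
    (b : 'rV[R[i]]_n) :
  C1at g (h z) -> (forall j, is_dird (fun y => h y 0 j) v z (b 0 j)) ->
  is_derive (0 : R) 1 (fun t : R => g (h (z + t%:C *: v))) (frame_sum g b (h z)).
Proof.
move=> gC hb.
pose dR j (t : R) := re_along (fun y => h y 0 j) v z t - complex.Re (h z 0 j).
pose dI j (t : R) := im_along (fun y => h y 0 j) v z t - complex.Im (h z 0 j).
pose ps := [seq (dR j, complex.Re (b 0 j), delta_mx 0 j : 'rV[R[i]]_n) | j <- index_enum 'I_n] ++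
  [seq (dI j, complex.Im (b 0 j), 'i *: delta_mx 0 j : 'rV[R[i]]_n) | j <- index_enum 'I_n].
have z0 : z + (0 : R)%:C *: v = z by rewrite scale0r addr0.
have ok : List.Forall path_ok ps.
  apply/List.Forall_app; split; apply/List.Forall_map/List.Forall_forall => j _.
    split; last by rewrite /= /dR /re_along z0 subrr.
    have h' := is_deriveB (hb j).1 (is_derive_cst (complex.Re (h z 0 j)) (0 : R) (1 : R)).
    by apply: is_derive_eq h' _; rewrite subr0.
  split; last by rewrite /= /dI /im_along z0 subrr.
  have h' := is_deriveB (hb j).2 (is_derive_cst (complex.Im (h z 0 j)) (0 : R) (1 : R)).
  by apply: is_derive_eq h' _; rewrite subr0.
have okg : List.Forall (fun x => (\forall y \near h z, rderivable g x.2 y) /\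
                        {for h z, continuous (rdir g x.2)}) ps.
  by apply/List.Forall_forall => x _; exact: gC.
have := is_derive_path ok okg.
rewrite /ps big_cat !big_map /= => D.
apply: (is_derive_ext _ D) => t; congr g.
rewrite /path_at big_cat !big_map /= -big_split /=; apply/rowP => k.
rewrite mxE summxE (bigD1 k)//= big1 ?addr0; last first.
  by move=> j jk; rewrite !mxE eqxx /= eq_sym (negbTE jk) !mulr0 addr0.
rewrite !mxE !eqxx /= !mulr1 /dR /dI /re_along /im_along.
move: (h z 0 k) (h _ 0 k) => [a1 a2] [b1 b2] /=.
by apply/eqP; rewrite eq_complex /=; apply/andP; split; apply/eqP; ring.
Qed.

(** The chain rule for [h = id]. As [frame_sum] is real linear in [b], so is the directional
    derivative. *)
Lemma C1at_rdir n (g : 'rV[R[i]]_n -> R) z b : C1at g z -> rdir g b z = frame_sum g b z.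
Proof.
move=> gC; have [_ <-] := @is_derive_comp_frame n n id g b z b gC (fun j => is_dird_coord j b z).
by rewrite /rdir derive1E.
Qed.

Lemma is_derive_comp m n (h : 'rV[R[i]]_m -> 'rV[R[i]]_n) (g : 'rV[R[i]]_n -> R) v z
    (b : 'rV[R[i]]_n) :
  C1at g (h z) -> (forall j, is_dird (fun y => h y 0 j) v z (b 0 j)) ->
  is_derive (0 : R) 1 (fun t : R => g (h (z + t%:C *: v))) (rdir g b (h z)).
Proof. by move=> gC hb; rewrite C1at_rdir//; exact: is_derive_comp_frame. Qed.
End ComplexDerivatives.

(** * Smooth and holomorphic functions *)

Section SmoothFunctions.
Context {R : realType} {n : nat}.
Implicit Types (f g : 'rV[R[i]]_n -> R[i]) (z u v : 'rV[R[i]]_n).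

Lemma Ck_sub k (V V' : set 'rV[R[i]]_n) f : V' `<=` V -> Ck k V f -> Ck k V' f.
Proof.
elim: k f => [|k IH] f VV [cf df].
  by split=> // z /VV/cf.
split=> [z /VV/cf//|v].
by have [hf kf] := df v; split=> [z /VV|]; [exact: hf|exact: IH].
Qed.

Lemma CkS k (V : set 'rV[R[i]]_n) f : Ck k.+1 V f -> Ck k V f.
Proof.
elim: k f => [|k IH] f [cf df]; first by split.
by split=> [//|v]; have [hf kf] := df v; split=> //; exact: IH.
Qed.

Lemma continuous_at_near (T U : topologicalType) (p q : T -> U) (x : T) :
  (\forall y \near x, p y = q y) -> {for x, continuous p} -> {for x, continuous q}.
Proof.
move=> pq; rewrite /prop_for /continuous_at (nbhs_singleton pq) => px.
by apply: cvg_trans px; apply: near_eq_cvg; apply: filterS pq => y ->.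
Qed.

Lemma continuous_at_add (T : topologicalType) (p q : T -> R[i]) (x : T) :
  {for x, continuous p} -> {for x, continuous q} ->
  {for x, continuous (fun y => p y + q y)}.
Proof. exact: cvgD. Qed.

Lemma continuous_at_mul (T : topologicalType) (p q : T -> R[i]) (x : T) :
  {for x, continuous p} -> {for x, continuous q} ->
  {for x, continuous (fun y => p y * q y)}.
Proof. exact: cvgM. Qed.

Lemma Ck_eq k (V : set 'rV[R[i]]_n) f g :
  open V -> (forall z, V z -> f z = g z) -> Ck k V f -> Ck k V g.
Proof.
move=> oV; elim: k f g => [|k IH] f g fg [cf df].
all: have nfg z : V z -> \forall y \near z, f y = g y
  by move=> Vz; have := open_nbhs_nbhs (conj oV Vz); apply: filterS => y; exact: fg.
all: have cg z : V z -> {for z, continuous g} by move=> Vz;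
  exact: continuous_at_near (nfg z Vz) (cf z Vz).
  by split.
split=> [//|v]; have [hf kf] := df v; split=> [z Vz|].
  by apply: is_dird_has (is_dird_near (nfg z Vz) (has_dirdP (hf z Vz))).
by apply: IH kf => z Vz; exact/dird_near/nfg.
Qed.

Lemma Ck_cst k (V : set 'rV[R[i]]_n) (c : R[i]) : Ck k V (fun=> c).
Proof.
elim: k c => [|k IH] c; first by split=> // z _; apply: cst_continuous.
split=> [z _|v]; first by apply: cst_continuous.
split=> [z _|]; first exact: is_dird_has (is_dird_cst c v z).
rewrite (_ : dird _ v = fun=> 0); first exact: IH.
by apply/funext => z; exact: is_dird_val (is_dird_cst c v z).
Qed.

Lemma CkD k (V : set 'rV[R[i]]_n) f g :
  open V -> Ck k V f -> Ck k V g -> Ck k V (fun y => f y + g y).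
Proof.
move=> oV; elim: k f g => [|k IH] f g [cf df] [cg dg].
all: have cfg z : V z -> {for z, continuous (fun y => f y + g y)}
  by move=> Vz; exact: continuous_at_add (cf z Vz) (cg z Vz).
  by split.
split=> [//|v]; have [[hf kf] [hg kg]] := (df v, dg v).
have dfg z : V z -> is_dird (fun y => f y + g y) v z (dird f v z + dird g v z).
  by move=> Vz; apply: is_dirdD; apply: has_dirdP; [exact: hf|exact: hg].
split=> [z /dfg/is_dird_has//|].
by apply: Ck_eq (IH _ _ kf kg) => // z /dfg/is_dird_val.
Qed.

Lemma CkM k (V : set 'rV[R[i]]_n) f g :
  open V -> Ck k V f -> Ck k V g -> Ck k V (fun y => f y * g y).
Proof.
(* [Cf] and [Cg] are kept whole: the product rule contains [f] and [g] undifferentiated, and the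
   induction needs their class. *)
move=> oV; elim: k f g => [|k IH] f g Cf Cg.
all: have [[cf df] [cg dg]] := (Cf, Cg).
all: have cfg z : V z -> {for z, continuous (fun y => f y * g y)}
  by move=> Vz; exact: continuous_at_mul (cf z Vz) (cg z Vz).
  by split.
split=> [//|v]; have [[hf kf] [hg kg]] := (df v, dg v).
have dfg z : V z ->
    is_dird (fun y => f y * g y) v z (dird f v z * g z + f z * dird g v z).
  by move=> Vz; apply: is_dirdM; apply: has_dirdP; [exact: hf|exact: hg].
split=> [z /dfg/is_dird_has//|].
apply: Ck_eq (CkD oV (IH _ _ kf (CkS Cg)) (IH _ _ (CkS Cf) kg)) => //.
by move=> z /dfg/is_dird_val.
Qed.

Lemma Ck_coord k (V : set 'rV[R[i]]_n) (j : 'I_n) :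
  Ck k V (fun y : 'rV[R[i]]_n => y 0 j).
Proof.
case: k => [|k]; first by split=> // z _; exact: coord_continuous.
split=> [z _|v]; first exact: coord_continuous.
split=> [z _|]; first exact: is_dird_has (is_dird_coord j v z).
rewrite (_ : dird _ v = fun=> v 0 j); first exact: Ck_cst.
by apply/funext => z; exact: is_dird_val (is_dird_coord j v z).
Qed.

Lemma smooth_at_near f g z :
  (\forall y \near z, f y = g y) -> smooth_at z f -> smooth_at z g.
Proof.
move=> fg [V [oV Vz] Vf].
have [N [oN Nz] NE] : exists2 N, open_nbhs z N & N `<=` [set y | f y = g y].
  by move: fg; rewrite /prop_near1 nbhsE.
have oVN : open (V `&` N) by exact: openI.
exists (V `&` N) => // k; apply: Ck_eq (Ck_sub (@subIsetl _ V N) (Vf k)) => //.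
by move=> y [_ /NE].
Qed.

Lemma smooth_at_cst (c : R[i]) z : smooth_at z (fun=> c).
Proof. by exists setT; [split=> //; exact: openT|move=> k; exact: Ck_cst]. Qed.

Lemma smooth_at_coord (j : 'I_n) z : smooth_at z (fun y : 'rV[R[i]]_n => y 0 j).
Proof. by exists setT; [split=> //; exact: openT|move=> k; exact: Ck_coord]. Qed.

Lemma smooth_atD f g z :
  smooth_at z f -> smooth_at z g -> smooth_at z (fun y => f y + g y).
Proof.
move=> [V [oV Vz] Vf] [W [oW Wz] Wg]; have oVW : open (V `&` W) by exact: openI.
exists (V `&` W) => // k; apply: CkD => //.
  exact: (Ck_sub (@subIsetl _ V W) (Vf k)).
exact: (Ck_sub (@subIsetr _ V W) (Wg k)).
Qed.

Lemma smooth_atM f g z :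
  smooth_at z f -> smooth_at z g -> smooth_at z (fun y => f y * g y).
Proof.
move=> [V [oV Vz] Vf] [W [oW Wz] Wg]; have oVW : open (V `&` W) by exact: openI.
exists (V `&` W) => // k; apply: CkM => //.
  exact: (Ck_sub (@subIsetl _ V W) (Vf k)).
exact: (Ck_sub (@subIsetr _ V W) (Wg k)).
Qed.

Lemma smooth_at_sum (J : Type) (s : seq J) (F : J -> 'rV[R[i]]_n -> R[i]) z :
  (forall j, smooth_at z (F j)) -> smooth_at z (fun y => \sum_(j <- s) F j y).
Proof.
move=> Fs; elim: s => [|j s IH].
  by apply: smooth_at_near (smooth_at_cst 0 z); near=> y; rewrite big_nil.
by apply: smooth_at_near (smooth_atD (Fs j) IH); near=> y; rewrite big_cons.
Unshelve. all: by end_near. Qed.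

Lemma smooth_at_open f z : smooth_at z f -> \forall y \near z, smooth_at y f.
Proof.
move=> [V [oV Vz] Vf]; have := open_nbhs_nbhs (conj oV Vz).
by apply: filterS => y Vy; exists V.
Qed.

Lemma smooth_at_dird f v z : smooth_at z f -> smooth_at z (dird f v).
Proof. by move=> [V oV Vf]; exists V => // k; have [_ /(_ v)[]] := Vf k.+1. Qed.

Lemma smooth_at_has_dird f v z : smooth_at z f -> has_dird f v z.
Proof. by move=> [V [oV Vz] Vf]; have [_ /(_ v)[+ _]] := Vf 1%N; exact. Qed.

Lemma smooth_at_is_dird f v z : smooth_at z f -> is_dird f v z (dird f v z).
Proof. by move=> /(smooth_at_has_dird v)/has_dirdP. Qed.

Lemma smooth_at_continuous f z : smooth_at z f -> {for z, continuous f}.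
Proof. by move=> [V [oV Vz] Vf]; have [+ _] := Vf 0%N; exact. Qed.

Lemma smooth_at_dbard f v z : smooth_at z f -> smooth_at z (dbard f v).
Proof.
move=> fs; apply: smooth_atM (smooth_at_cst _ _); apply: smooth_atD.
  exact: smooth_at_dird.
by apply: smooth_atM (smooth_at_cst _ _) _; exact: smooth_at_dird.
Qed.

Lemma smooth_at_C1Re f z : smooth_at z f -> C1at (fun y => complex.Re (f y)) z.
Proof.
move=> fs u; split.
  by apply: filterS (smooth_at_open fs) => y /(smooth_at_has_dird u)[+ _]; exact.
have := smooth_at_continuous (smooth_at_dird u fs) => c.
exact: (cvg_comp _ _ c (@continuous_complexRe R _)).
Qed.

Lemma smooth_at_C1Im f z : smooth_at z f -> C1at (fun y => complex.Im (f y)) z.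
Proof.
move=> fs u; split.
  by apply: filterS (smooth_at_open fs) => y /(smooth_at_has_dird u)[_ +]; exact.
have := smooth_at_continuous (smooth_at_dird u fs) => c.
exact: (cvg_comp _ _ c (@continuous_complexIm R _)).
Qed.

Lemma frame_sum_linear (g : 'rV[R[i]]_n -> R) (t : R) u v z :
  frame_sum g (t%:C *: u + v) z = t * frame_sum g u z + frame_sum g v z.
Proof.
have S (F G H : 'I_n -> R) : (forall j, F j = t * G j + H j) ->
    \sum_j F j = t * (\sum_j G j) + \sum_j H j.
  by move=> FGH; rewrite mulr_sumr -big_split /=; apply: eq_bigr.
have AC (a b c d : R) : (t * a + b) + (t * c + d) = t * (a + c) + (b + d) by ring.
rewrite /frame_sum -AC; congr (_ + _); apply: S => j.
  by rewrite !mxE cReD cReM /= mul0r subr0 mulrDl mulrA.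
by rewrite !mxE cImD cImM /= mul0r addr0 mulrDl mulrA.
Qed.

Lemma dird_linear f (t : R) u v z : smooth_at z f ->
  dird f (t%:C *: u + v) z = t%:C * dird f u z + dird f v z.
Proof.
move=> fs; have [fR fI] := (smooth_at_C1Re fs, smooth_at_C1Im fs).
apply/eqP; rewrite eq_complex cReD cImD cReM cImM /= !mul0r subr0 addr0.
have := frame_sum_linear (fun y => complex.Re (f y)) t u v z.
have := frame_sum_linear (fun y => complex.Im (f y)) t u v z.
by rewrite -!C1at_rdir// => hI hR; apply/andP; split; apply/eqP; [exact: hR|exact: hI].
Qed.

Lemma dird_sym f u v z : smooth_at z f -> dird (dird f u) v z = dird (dird f v) u z.
Proof.
move=> fs.
have fd w w' : \forall y \near z, has_dird f w y /\ has_dird (dird f w) w' y.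
  by apply: filterS (smooth_at_open fs) => y ys; split;
    apply: smooth_at_has_dird => //; exact: smooth_at_dird.
have fc w w' : {for z, continuous (dird (dird f w) w')}.
  by apply: smooth_at_continuous; do 2 apply: smooth_at_dird.
apply/eqP; rewrite eq_complex; apply/andP; split; apply/eqP.
  apply: (@rdir_sym _ _ (fun y => complex.Re (f y)) u v z).
  - apply: filterS (filterI (fd u v) (fd v u)) => y [[[a _] [b _]] [[c _] [d _]]];
    exact: And4 a c b d.
  - exact: (cvg_comp _ _ (fc u v) (@continuous_complexRe R _)).
  - exact: (cvg_comp _ _ (fc v u) (@continuous_complexRe R _)).
apply: (@rdir_sym _ _ (fun y => complex.Im (f y)) u v z).
- apply: filterS (filterI (fd u v) (fd v u)) => y [[[_ a] [_ b]] [[_ c] [_ d]]];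
  exact: And4 a c b d.
- exact: (cvg_comp _ _ (fc u v) (@continuous_complexIm R _)).
- exact: (cvg_comp _ _ (fc v u) (@continuous_complexIm R _)).
Qed.
End SmoothFunctions.

Lemma is_dird_comp (R : realType) m n (h : 'rV[R[i]]_m -> 'rV[R[i]]_n)
    (f : 'rV[R[i]]_n -> R[i]) v z (b : 'rV[R[i]]_n) :
  smooth_at (h z) f -> (forall j, is_dird (fun y => h y 0 j) v z (b 0 j)) ->
  is_dird (f \o h) v z (dird f b (h z)).
Proof.
move=> fs hb; split; first exact: is_derive_comp (smooth_at_C1Re fs) hb.
exact: is_derive_comp (smooth_at_C1Im fs) hb.
Qed.

(** * The antilinear part of the differential, and holomorphic functions *)

Section Dbar.
Context {R : realType} {n : nat}.
Implicit Types (f g : 'rV[R[i]]_n -> R[i]) (z u v : 'rV[R[i]]_n).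

Lemma mulii : 'i * 'i = -1 :> R[i].
Proof. by rewrite -expr2 -complexiE complex.sqr_i. Qed.

Definition is_dbard f v z (d : R[i]) : Prop :=
  exists a b, [/\ is_dird f v z a, is_dird f ('i *: v) z b & d = (a + 'i * b) / 2].

Lemma is_dbard_val f v z d : is_dbard f v z d -> dbard f v z = d.
Proof. by move=> [a [b [/is_dird_val fa /is_dird_val fb ->]]]; rewrite /dbard fa fb. Qed.

Lemma smooth_at_is_dbard f v z : smooth_at z f -> is_dbard f v z (dbard f v z).
Proof.
move=> fs; exists (dird f v z), (dird f ('i *: v) z).
exact: And3 (smooth_at_is_dird v fs) (smooth_at_is_dird ('i *: v) fs) erefl.
Qed.

Lemma is_dbard_near f g v z d :
  (\forall y \near z, f y = g y) -> is_dbard f v z d -> is_dbard g v z d.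
Proof.
move=> fg [a [b [fa fb ->]]]; exists a, b.
exact: And3 (is_dird_near fg fa) (is_dird_near fg fb) erefl.
Qed.

Lemma dbard_near f g v z : (\forall y \near z, f y = g y) -> dbard f v z = dbard g v z.
Proof. by move=> fg; rewrite /dbard !(dird_near _ fg). Qed.

Lemma is_dbard_cst c v z : is_dbard (fun=> c) v z 0.
Proof.
exists 0, 0; split; [exact: is_dird_cst|exact: is_dird_cst|].
by rewrite mulr0 addr0 mul0r.
Qed.

Lemma is_dbardD f g v z a b :
  is_dbard f v z a -> is_dbard g v z b -> is_dbard (fun y => f y + g y) v z (a + b).
Proof.
move=> [a1 [a2 [fa1 fa2 ->]]] [b1 [b2 [gb1 gb2 ->]]].
exists (a1 + b1), (a2 + b2); split; [exact: is_dirdD|exact: is_dirdD|ring].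
Qed.

Lemma is_dbardM f g v z a b :
  is_dbard f v z a -> is_dbard g v z b ->
  is_dbard (fun y => f y * g y) v z (a * g z + f z * b).
Proof.
move=> [a1 [a2 [fa1 fa2 ->]]] [b1 [b2 [gb1 gb2 ->]]].
exists (a1 * g z + f z * b1), (a2 * g z + f z * b2).
split; [exact: is_dirdM|exact: is_dirdM|ring].
Qed.

Lemma is_dbard_sum (J : Type) (s : seq J) (F : J -> 'rV[R[i]]_n -> R[i]) v z d :
  (forall j, is_dbard (F j) v z (d j)) ->
  is_dbard (fun y => \sum_(j <- s) F j y) v z (\sum_(j <- s) d j).
Proof.
move=> Fd; elim: s => [|j s IH].
  rewrite big_nil; have := is_dbard_cst 0 v z.
  by apply: is_dbard_near; near=> y; rewrite big_nil.
rewrite big_cons; have := is_dbardD (Fd j) IH.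
by apply: is_dbard_near; near=> y; rewrite big_cons.
Unshelve. all: by end_near. Qed.

Lemma dirdD f u v z : smooth_at z f -> dird f (u + v) z = dird f u z + dird f v z.
Proof. by move=> fs; have := dird_linear 1 u v fs; rewrite scale1r mul1r. Qed.

Lemma dird0 f z : smooth_at z f -> dird f 0 z = 0.
Proof.
by move=> fs; have := dirdD 0 0 fs; rewrite addr0 -{1}[dird f 0 z]addr0 => /addrI.
Qed.

Lemma dirdZ f (t : R) u z : smooth_at z f -> dird f (t%:C *: u) z = t%:C * dird f u z.
Proof. by move=> fs; rewrite -[_ *: u]addr0 dird_linear// dird0// addr0. Qed.

(** Real linearity reduces everything to the derivatives along [u], [i u], [v], [i v]; replacing [u]
    by [i u] multiplies [df(u) + i df(i u)] by [- i]. *)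
Lemma dbard_antilinear f (a : R[i]) u v z : smooth_at z f ->
  dbard f (a *: u + v) z = a^* * dbard f u z + dbard f v z.
Proof.
move=> fs; case: a => x y.
have -> : (x +i* y) = x%:C + 'i * y%:C by rewrite [LHS]complexE.
have -> : ((x%:C + 'i * y%:C)^*)%R = x%:C - 'i * y%:C.
  rewrite -complexiE; apply/eqP; rewrite eq_complex /=; apply/andP.
  by split; apply/eqP; ring.
have e1 : (x%:C + 'i * y%:C) *: u = x%:C *: u + y%:C *: ('i *: u).
  by rewrite scalerDl scalerA (mulrC y%:C).
have e2 : 'i *: (x%:C *: u + y%:C *: ('i *: u)) = x%:C *: ('i *: u) + (- y)%:C *: u.
  rewrite scalerDr !scalerA; congr (_ *: u + _ *: u); first by rewrite mulrC.
  rewrite rmorphN /=; have := mulii; move: ('i : R[i])%R => j jj; ring: jj.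
rewrite /dbard e1 scalerDr e2 !dirdD// !dirdZ// rmorphN /=.
move: (dird f u z) (dird f ('i *: u) z) (dird f v z) (dird f ('i *: v) z) => p q r s.
move: (x%:C) (y%:C) => X Y; have := mulii; move: ('i : R[i])%R => j jj.
rewrite mulrA -mulrDl; congr (_ / _).
ring: jj.
Qed.

Lemma dird_dbard f u v z : smooth_at z f ->
  dird (fun y => dbard f u y) v z = (dird (dird f u) v z + 'i * dird (dird f ('i *: u)) v z) / 2.
Proof.
move=> fs; have d1 w := smooth_at_is_dird v (smooth_at_dird w fs).
have h1 := is_dirdM (is_dird_cst 'i v z) (d1 ('i *: u)).
have h2 := is_dirdM (is_dirdD (d1 u) h1) (is_dird_cst 2^-1 v z).
by rewrite (is_dird_val h2) mul0r add0r mulr0 addr0.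
Qed.

Lemma holomorphic_atP z f :
  holomorphic_at z f <->
  smooth_at z f /\ \forall y \near z, forall v, dbard f v y = 0.
Proof.
split=> [[V [oV Vz] [Vf Vd]]|[[V [oV Vz] Vf] Nd]].
  split; first by exists V.
  have := open_nbhs_nbhs (conj oV Vz); apply: filterS => y Vy v; exact: Vd.
have [N [oN Nz] NE] : exists2 N, open_nbhs z N & N `<=` [set y | forall v, dbard f v y = 0].
  by move: Nd; rewrite /prop_near1 nbhsE.
exists (V `&` N); first by split=> //; exact: openI.
split=> [k|y v [_ Ny]]; last exact: NE.
exact: (Ck_sub (@subIsetl _ V N) (Vf k)).
Qed.

Lemma holomorphic_at_smooth z f : holomorphic_at z f -> smooth_at z f.
Proof. by move=> /holomorphic_atP[]. Qed.

Lemma holomorphic_at_open f z : holomorphic_at z f -> \forall y \near z, holomorphic_at y f.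
Proof.
move=> [V [oV Vz] Vf]; have := open_nbhs_nbhs (conj oV Vz).
by apply: filterS => y Vy; exists V.
Qed.

Lemma holomorphic_at_dbard f v z : holomorphic_at z f -> dbard f v z = 0.
Proof. by move=> [V [oV Vz] [_ Vd]]; exact: Vd. Qed.

Lemma holomorphic_at_is_dbard f v z : holomorphic_at z f -> is_dbard f v z 0.
Proof.
move=> fh; have := smooth_at_is_dbard v (holomorphic_at_smooth fh).
by rewrite holomorphic_at_dbard.
Qed.

(** Cauchy-Riemann: [dbard = 0] says [p + i q = 0], and multiplication by [i] gives [q = i p]. *)
Lemma holomorphic_at_dirdi f v z : holomorphic_at z f ->
  dird f ('i *: v) z = 'i * dird f v z.
Proof.
move=> /(@holomorphic_at_dbard f v z); rewrite /dbard.
move: (dird f v z) (dird f ('i *: v) z) => p q /eqP.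
rewrite mulf_eq0 invr_eq0 (negbTE (_ : 2%:R != 0)) ?pnatr_eq0// orbF => /eqP pq.
have : 'i * (p + 'i * q) = 0 by rewrite pq mulr0.
rewrite mulrDr mulrA mulii mulN1r => /eqP; rewrite subr_eq0 => /eqP ->; by [].
Qed.

Lemma holomorphic_at_dird_linear f (a : R[i]) u v z : holomorphic_at z f ->
  dird f (a *: u + v) z = a * dird f u z + dird f v z.
Proof.
move=> fh; have fs := holomorphic_at_smooth fh.
case: a => x y; rewrite [x +i* y]complexE /= scalerDl -!scalerA.
rewrite (_ : 'i *: (y%:C *: u) = y%:C *: ('i *: u)); last by rewrite !scalerA mulrC.
by rewrite !dirdD// !dirdZ// holomorphic_at_dirdi// mulrDl mulrA (mulrC _%:C 'i).
Qed.

Lemma holomorphic_at_near f g z :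
  (\forall y \near z, f y = g y) -> holomorphic_at z f -> holomorphic_at z g.
Proof.
move=> fg /holomorphic_atP[fs fd]; apply/holomorphic_atP; split.
  exact: smooth_at_near fs.
have fg' : \forall y \near z, \forall x \near y, f x = g x by exact: nbhs_interior.
by apply: filterS (filterI fg' fd) => y [fgy dy] v; rewrite -(dbard_near v fgy).
Qed.

Lemma holomorphic_at_cst (c : R[i]) z : holomorphic_at z (fun=> c).
Proof.
apply/holomorphic_atP; split; first exact: smooth_at_cst.
by near=> y; move=> v; exact: is_dbard_val (is_dbard_cst c v y).
Unshelve. all: by end_near. Qed.

Lemma holomorphic_at_coord (j : 'I_n) z : holomorphic_at z (fun y : 'rV[R[i]]_n => y 0 j).
Proof.
apply/holomorphic_atP; split; first exact: smooth_at_coord.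
near=> y; move=> v; rewrite /dbard !(is_dird_val (is_dird_coord _ _ _)) mxE.
by rewrite mulrA mulii mulN1r subrr mul0r.
Unshelve. all: by end_near. Qed.

Lemma holomorphic_atD f g z :
  holomorphic_at z f -> holomorphic_at z g -> holomorphic_at z (fun y => f y + g y).
Proof.
move=> fh gh; apply/holomorphic_atP; split.
  by apply: smooth_atD; exact: holomorphic_at_smooth.
apply: filterS (filterI (holomorphic_at_open fh) (holomorphic_at_open gh)).
move=> y [fy gy] v; rewrite (is_dbard_val (is_dbardD (holomorphic_at_is_dbard v fy)
  (holomorphic_at_is_dbard v gy))).
by rewrite addr0.
Qed.

Lemma holomorphic_atM f g z :
  holomorphic_at z f -> holomorphic_at z g -> holomorphic_at z (fun y => f y * g y).
Proof.
move=> fh gh; apply/holomorphic_atP; split.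
  by apply: smooth_atM; exact: holomorphic_at_smooth.
apply: filterS (filterI (holomorphic_at_open fh) (holomorphic_at_open gh)).
move=> y [fy gy] v; rewrite (is_dbard_val (is_dbardM (holomorphic_at_is_dbard v fy)
  (holomorphic_at_is_dbard v gy))).
by rewrite mul0r mulr0 addr0.
Qed.

(** By symmetry of second derivatives, dbar of the derivative along [u] is the derivative along [u]
    of [dbard f], which vanishes near the point. *)
Lemma holomorphic_at_dird f u z : holomorphic_at z f -> holomorphic_at z (dird f u).
Proof.
move=> fh; apply/holomorphic_atP; split.
  by apply: smooth_at_dird; exact: holomorphic_at_smooth.
have oo : \forall y \near z, \forall x \near y, holomorphic_at x f.
  by apply: nbhs_interior; exact: holomorphic_at_open.
apply: filterS oo => y fy v; have fhy := nbhs_singleton fy.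
have fs := holomorphic_at_smooth fhy.
have dd w : dird (dird f u) w y = dird (dird f w) u y by exact: dird_sym.
rewrite /dbard !dd -dird_dbard//.
rewrite (@dird_near _ _ _ (fun=> 0) u y); first exact: is_dird_val (is_dird_cst 0 u y).
by apply: filterS fy => x fx; exact: holomorphic_at_dbard.
Qed.

(** Conjugation turns [i] into [- i], so the two halves of [dbard] add up instead of cancelling:
    dbar is the whole differential of an antiholomorphic function. *)
Lemma is_dbard_conj f v z : holomorphic_at z f ->
  is_dbard (fun y => ((f y)^*)%R) v z ((dird f v z)^*)%R.
Proof.
move=> fh; have fs := holomorphic_at_smooth fh.
exists ((dird f v z)^*)%R, (('i * dird f v z)^*)%R; split.
- exact/is_dird_conj/smooth_at_is_dird.
- by rewrite -holomorphic_at_dirdi//; exact/is_dird_conj/smooth_at_is_dird.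
have -> : (('i * dird f v z)^*)%R = - 'i * (dird f v z)^*.
  rewrite -complexiE; case: (dird f v z) => a b; apply/eqP; rewrite eq_complex /=.
  by apply/andP; split; apply/eqP; ring.
by rewrite mulrA mulrN mulii opprK mul1r; field.
Qed.
End Dbar.

Definition pushvec (R : realType) m n (h : 'rV[R[i]]_m -> 'rV[R[i]]_n)
    (v z : 'rV[R[i]]_m) : 'rV[R[i]]_n :=
  \row_j dird (fun y => h y 0 j) v z.

Section Composition.
Context {R : realType} {m n : nat}.
Variable h : 'rV[R[i]]_m -> 'rV[R[i]]_n.
Implicit Types (f : 'rV[R[i]]_n -> R[i]) (z u v : 'rV[R[i]]_m).

Definition holmap z : Prop := forall j, holomorphic_at z (fun y => h y 0 j).

Lemma holmap_is_dird f v z : holmap z -> smooth_at (h z) f ->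
  is_dird (f \o h) v z (dird f (pushvec h v z) (h z)).
Proof.
move=> hh fs; apply: is_dird_comp fs _ => j; rewrite mxE.
exact/smooth_at_is_dird/holomorphic_at_smooth.
Qed.

Lemma holmap_dird f v z : holmap z -> smooth_at (h z) f ->
  dird (f \o h) v z = dird f (pushvec h v z) (h z).
Proof. by move=> hh fs; exact: is_dird_val (holmap_is_dird v hh fs). Qed.

(** The differential of a holomorphic map commutes with multiplication by [i], so both halves of
    [dbard] are pushed forward compatibly. *)
Lemma holmap_is_dbard f v z : holmap z -> smooth_at (h z) f ->
  is_dbard (f \o h) v z (dbard f (pushvec h v z) (h z)).
Proof.
move=> hh fs; have E : pushvec h ('i *: v) z = 'i *: pushvec h v z.
  by apply/rowP => j; rewrite !mxE holomorphic_at_dirdi.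
have hv := holmap_is_dird v hh fs; have hiv := holmap_is_dird ('i *: v) hh fs.
by rewrite E in hiv; exact: (ex_intro _ _ (ex_intro _ _ (And3 hv hiv erefl))).
Qed.
End Composition.

(** * The operator dbar in coordinates *)

(** Spelled as in [dbar], whose terms are then instances of it by conversion. *)
Definition omit (T : Type) (i : nat) (s : seq T) : seq T := take i s ++ drop i.+1 s.

Definition upd (T : Type) (s : seq T) (k : nat) (x : T) : seq T :=
  take k s ++ x :: drop k.+1 s.

Section Lists.
Context {T : Type}.
Implicit Types (s A B C : seq T) (x y : T).

Lemma omit_cat A x C : omit (size A) (A ++ x :: C) = A ++ C.
Proof. by rewrite /omit take_size_cat// -[A ++ x :: C]cat_rcons drop_size_cat ?size_rcons. Qed.

Lemma upd_cat A x C y : upd (A ++ x :: C) (size A) y = A ++ y :: C.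
Proof. by rewrite /upd take_size_cat// -[A ++ x :: C]cat_rcons drop_size_cat ?size_rcons. Qed.

Lemma omitS i x s : omit i.+1 (x :: s) = x :: omit i s.
Proof. by []. Qed.

Lemma omit_map (T' : Type) (f : T -> T') i s : omit i (map f s) = map f (omit i s).
Proof. by rewrite /omit map_cat map_take map_drop. Qed.

Lemma size_omit i s : (i < size s)%N -> size (omit i s) = (size s).-1.
Proof.
by move=> h; rewrite /omit size_cat size_take h size_drop -{2}(subnKC h).
Qed.

Lemma size_upd i s x : (i < size s)%N -> size (upd s i x) = size s.
Proof.
by move=> h; rewrite /upd size_cat size_take h /= size_drop -addSnnS subnKC.
Qed.

Lemma omit_lt i A x C : (i < size A)%N -> omit i (A ++ x :: C) = omit i A ++ x :: C.
Proof.
move=> h; rewrite /omit takel_cat 1?ltnW// drop_cat.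
have := h; rewrite leq_eqVlt => /orP[/eqP e|h']; last by rewrite h' -catA.
by rewrite e ltnn subnn drop0 drop_size cats0.
Qed.

Lemma omit_gt i A x C : omit (size A + i.+1) (A ++ x :: C) = A ++ x :: omit i C.
Proof.
rewrite /omit take_cat ltnNge leq_addr /= addKn /= -catA /=; congr (_ ++ _ :: (_ ++ _)).
by rewrite drop_cat -addnS ltnNge leq_addr /= addKn.
Qed.

Lemma updS y s k x : upd (y :: s) k.+1 x = y :: upd s k x.
Proof. by []. Qed.

Lemma omit0 y s : omit 0%N (y :: s) = s.
Proof. by rewrite /omit /= drop0. Qed.

Lemma upd0 y s x : upd (y :: s) 0 x = x :: s.
Proof. by rewrite /upd /= drop0. Qed.

Lemma bumpS i k : bump i.+1 k.+1 = (bump i k).+1.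
Proof. by rewrite /bump ltnS addnS. Qed.

Lemma bump0l k : bump 0 k = k.+1.
Proof. by rewrite /bump leq0n. Qed.

Lemma bumpS0 i : bump i.+1 0 = 0%N.
Proof. by []. Qed.

(** The entry at [k] after the omission of [i] comes from position [bump i k] of the full list. *)
Lemma upd_omit s i k x : (k.+1 < size s)%N ->
  upd (omit i s) k x = omit i (upd s (bump i k) x).
Proof.
elim: s i k => [|y s IH] [|i] [|k] //=; rewrite ltnS => ks.
- by rewrite bump0l omit0 updS omit0.
- by rewrite bump0l omit0 updS omit0.
- by rewrite bumpS0 omitS !upd0 omitS.
- by rewrite bumpS omitS !updS omitS IH.
Qed.

Lemma nth_omit x0 s i k : nth x0 (omit i s) k = nth x0 s (bump i k).
Proof.
elim: s i k => [|y s IH] [|i] [|k]; rewrite ?bump0l ?omit0 ?nth_nil//.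
by rewrite omitS bumpS /= IH.
Qed.

Lemma split_at2 s i k : (i < k < size s)%N ->
  exists A x B y C, [/\ s = A ++ x :: B ++ y :: C, size A = i & (size A + (size B).+1)%N = k].
Proof.
move=> /andP[ik ks]; have is_ := ltn_trans ik ks.
case: s ks is_ => // x0 s' ks is_; set s := x0 :: s' in ks is_ *.
exists (take i s), (nth x0 s i), (take (k - i.+1) (drop i.+1 s)), (nth x0 s k), (drop k.+1 s).
have si : size (take i s) = i by rewrite size_takel// ltnW.
have sk : size (take (k - i.+1) (drop i.+1 s)) = (k - i.+1)%N.
  by rewrite size_takel// size_drop leq_sub2r// ltnW.
split=> //; last by rewrite si sk -addSnnS subnKC.
rewrite -{1}(cat_take_drop i s) (drop_nth x0)//; congr (_ ++ _ :: _).
rewrite -{1}(cat_take_drop (k - i.+1) (drop i.+1 s)) drop_drop subnK//.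
by rewrite [drop k s](drop_nth x0).
Qed.
End Lists.

(** * Alternating antilinear forms on coordinate vectors *)

Section AlternatingForms.
Context {R : realType} {n : nat}.
Notation V := 'rV[R[i]]_n.

(** The counterpart of [antilinear_alternating] on coordinate vectors, where the length of a list is
    the only condition on it. *)
Definition alt_form (q : nat) (w : seq V -> R[i]) : Prop :=
  (forall s1 s2 u v (a : R[i]), size (s1 ++ u :: s2) = q ->
     w (s1 ++ (a *: u + v) :: s2) = (a^*)%R * w (s1 ++ u :: s2) + w (s1 ++ v :: s2)) /\
  (forall s1 s2 s3 v, size (s1 ++ v :: s2 ++ v :: s3) = q ->
     w (s1 ++ v :: s2 ++ v :: s3) = 0).

Section Fixed.
Variables (q : nat) (w : seq V -> R[i]).
Hypothesis wa : alt_form q w.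

Lemma alt_formD s1 s2 u v : size (s1 ++ u :: s2) = q ->
  w (s1 ++ (u + v) :: s2) = w (s1 ++ u :: s2) + w (s1 ++ v :: s2).
Proof. by move=> h; have := wa.1 s1 s2 u v 1 h; rewrite scale1r rmorph1 mul1r. Qed.

Lemma alt_form0 s1 s2 : size (s1 ++ 0 :: s2) = q -> w (s1 ++ 0 :: s2) = 0.
Proof.
by move=> h; have := alt_formD 0 h; rewrite addr0 -[LHS]addr0 => /addrI.
Qed.

(** Polarization: expand the value with [u + v] in both slots, which is 0. *)
Lemma alt_form_swap s1 s2 u v : size (s1 ++ u :: v :: s2) = q ->
  w (s1 ++ v :: u :: s2) = - w (s1 ++ u :: v :: s2).
Proof.
move=> h; have sz x y : size (s1 ++ x :: y :: s2) = q by rewrite -h !size_cat.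
have sz' x y : size ((s1 ++ [:: x]) ++ y :: s2) = q by rewrite -catA; exact: sz.
have := wa.2 s1 [::] s2 (u + v) (sz _ _).
rewrite /= alt_formD//.
rewrite -[s1 ++ [:: u, u + v & s2]]/(s1 ++ [:: u] ++ _) catA alt_formD// -!catA /=.
rewrite -[s1 ++ [:: v, u + v & s2]]/(s1 ++ [:: v] ++ _) catA alt_formD// -!catA /=.
rewrite (wa.2 s1 [::] s2 u (sz _ _)) (wa.2 s1 [::] s2 v (sz _ _)) add0r addr0.
by move=> /eqP; rewrite addrC addr_eq0 => /eqP.
Qed.

(** Passing [b] across [B] takes [size B] adjacent transpositions. *)
Lemma alt_form_move A B C b : size (A ++ b :: B ++ C) = q ->
  w (A ++ B ++ b :: C) = (-1) ^+ size B * w (A ++ b :: B ++ C).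
Proof.
elim: B A => [|x B IH] A h; first by rewrite mul1r.
have := IH (rcons A x); rewrite !cat_rcons => -> /=; last first.
  by rewrite -h !size_cat.
rewrite alt_form_swap//.
by rewrite /= exprS !mulNr mul1r mulrN.
Qed.

(** Turns an argument that varies with the point into scalar coefficients times values at constant
    basis vectors, a form that can be differentiated. *)
Lemma alt_form_expand s1 s2 (b : V) : size (s1 ++ b :: s2) = q ->
  w (s1 ++ b :: s2) = \sum_j ((b 0 j)^*)%R * w (s1 ++ delta_mx 0 j :: s2).
Proof.
move=> h; have sz x : size (s1 ++ x :: s2) = q by rewrite -h !size_cat.
rewrite {1}(row_sum_delta b).
elim: (index_enum _) => [|j r IH]; first by rewrite !big_nil alt_form0.
by rewrite !big_cons wa.1// IH.
Qed.
End Fixed.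
End AlternatingForms.

Lemma split_gt i j : (i < j)%N -> exists k, j = (i + k.+1)%N.
Proof. by move=> ij; exists (j - i.+1)%N; rewrite -addSnnS subnKC. Qed.

(** * The operator dbar on families of alternating forms *)

Section DbarForms.
Context {R : realType} {n : nat}.
Notation V := 'rV[R[i]]_n.
Implicit Types (f g : V -> R[i]) (W : seq V -> V -> R[i]) (z : V).

Definition dbarV W (vs : seq V) z : R[i] :=
  \sum_(i < size vs) (-1) ^+ i * dbard (W (omit i vs)) (nth 0 vs i) z.

Lemma dbard_comb (a : R[i]) f g v z : smooth_at z f -> smooth_at z g ->
  dbard (fun y => a * f y + g y) v z = a * dbard f v z + dbard g v z.
Proof.
move=> /(smooth_at_is_dbard v) fd /(smooth_at_is_dbard v) gd.
rewrite (is_dbard_val (is_dbardD (is_dbardM (is_dbard_cst a v z) fd) gd)).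
by rewrite mul0r add0r.
Qed.

Variables (q : nat) (W : seq V -> V -> R[i]) (z : V).
Hypothesis Walt : \forall y \near z, alt_form q (W^~ y).
Hypothesis Wsm : forall s, size s = q -> smooth_at z (W s).

(** The identity in the slot holds at all points near [z], so it may be differentiated. *)
Lemma dbard_comb_slot s1 s2 u u' (a : R[i]) v : size (s1 ++ u :: s2) = q ->
  dbard (W (s1 ++ (a *: u + u') :: s2)) v z =
  (a^*)%R * dbard (W (s1 ++ u :: s2)) v z + dbard (W (s1 ++ u' :: s2)) v z.
Proof.
move=> h; rewrite -dbard_comb; [|exact: Wsm|apply: Wsm; by rewrite -h !size_cat].
by apply: dbard_near; apply: filterS Walt => y Wy; exact: Wy.1.
Qed.

Lemma dbard_expand s1 s2 (b : V) v : size (s1 ++ b :: s2) = q ->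
  dbard (W (s1 ++ b :: s2)) v z =
  \sum_j ((b 0 j)^*)%R * dbard (W (s1 ++ delta_mx 0 j :: s2)) v z.
Proof.
move=> h; have sz x : size (s1 ++ x :: s2) = q by rewrite -h !size_cat.
rewrite (@dbard_near _ _ _
  (fun y => \sum_j ((b 0 j)^*)%R * W (s1 ++ delta_mx 0 j :: s2) y)); last first.
  by apply: filterS Walt => y Wy; exact: (alt_form_expand Wy h).
apply: is_dbard_val; apply: is_dbard_sum => j.
have := is_dbardM (is_dbard_cst ((b 0 j)^*)%R v z) (smooth_at_is_dbard v (Wsm (sz (delta_mx 0 j)))).
by rewrite mul0r add0r.
Qed.

Lemma dbard_move A B C b v : size (A ++ b :: B ++ C) = q ->
  dbard (W (A ++ B ++ b :: C)) v z = (-1) ^+ size B * dbard (W (A ++ b :: B ++ C)) v z.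
Proof.
move=> h; rewrite (@dbard_near _ _ _ (fun y => (-1) ^+ size B * W (A ++ b :: B ++ C) y)).
  have := is_dbardM (is_dbard_cst ((-1) ^+ size B) v z) (smooth_at_is_dbard v (Wsm h)).
  by rewrite mul0r add0r => /is_dbard_val.
by apply: filterS Walt => y Wy; exact: (alt_form_move Wy).
Qed.

Lemma dbard_alt0 s1 s2 s3 u v : size (s1 ++ u :: s2 ++ u :: s3) = q ->
  dbard (W (s1 ++ u :: s2 ++ u :: s3)) v z = 0.
Proof.
move=> h; rewrite (@dbard_near _ _ _ (fun=> 0)).
  exact: is_dbard_val (is_dbard_cst 0 v z).
by apply: filterS Walt => y Wy; exact: Wy.2.
Qed.

Lemma alt_form_dbarV : alt_form q.+1 (dbarV W ^~ z).
Proof.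
split=> [s1 s2 u v a h|s1 s2 s3 v h].
  have sz x : size (s1 ++ x :: s2) = q.+1 by rewrite -h !size_cat.
  rewrite /dbarV !sz mulr_sumr -big_split /=; apply: eq_bigr => -[i hi] _ /=.
  have comb (c b p r t : R[i]) : p = b * r + t -> c * p = b * (c * r) + c * t.
    by move=> ->; rewrite mulrDr mulrCA.
  apply: comb.
  have szo x : size (omit i (s1 ++ x :: s2)) = q by rewrite size_omit sz.
  (* The omitted index lies before, at or after the slot; at the slot, the antilinearity is that of
     [dbard] in its vector. *)
  have [is1|s1i] := ltnP i (size s1).
    rewrite !omit_lt// !nth_cat is1; apply: dbard_comb_slot.
    by rewrite -(szo u) omit_lt.
  move: s1i; rewrite leq_eqVlt => /orP[/eqP s1i|s1i].
    rewrite -s1i !omit_cat !nth_cat ltnn subnn /=; apply: dbard_antilinear.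
    by apply: Wsm; rewrite -(szo u) -s1i omit_cat.
  have [k ik] := split_gt s1i; rewrite ik in szo *.
  rewrite !omit_gt !nth_cat ltnNge leq_addr /= addKn /=.
  by apply: dbard_comb_slot; rewrite -(szo u) omit_gt.
have sz x : size (s1 ++ x :: s2 ++ v :: s3) = q.+1 by rewrite -h !size_cat.
pose L := s1 ++ v :: s2 ++ v :: s3.
pose term i : R[i] := (-1) ^+ i * dbard (W (omit i L)) (nth 0 L i) z.
rewrite [LHS](_ : _ = \sum_(i < size L) term i) // h.
have e2 : L = (s1 ++ v :: s2) ++ v :: s3 by rewrite -catA.
have j1 : (size s1 < q.+1)%N by rewrite -h size_cat /= addnS ltnS leq_addr.
have j2 : (size (s1 ++ v :: s2) < q.+1)%N.
  by rewrite -h -/L e2 [X in (_ < X)%N]size_cat /= addnS ltnS leq_addr.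
have s12 : size (s1 ++ v :: s2) = (size s1 + (size s2).+1)%N by rewrite size_cat.
(* Omitting any other index leaves both copies of [v] among the arguments. *)
have zero i : (i < q.+1)%N -> i != size s1 -> i != size (s1 ++ v :: s2) -> term i = 0.
  rewrite /term => hi i1 i2; have szi : size (omit i L) = q by rewrite size_omit h.
  have [is1|s1i] := ltnP i (size s1).
    by rewrite /L omit_lt// dbard_alt0 ?mulr0// -omit_lt.
  have {i1}s1i : (size s1 < i)%N by rewrite ltn_neqAle eq_sym i1.
  have [is2|s2i] := ltnP i (size (s1 ++ v :: s2)).
    have [k ik] := split_gt s1i; rewrite ik in szi is2 *.
    have ks2 : (k < size s2)%N by move: is2; rewrite s12 ltn_add2l.
    by rewrite /L omit_gt omit_lt// dbard_alt0 ?mulr0// -omit_lt// -omit_gt.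
  have {}s2i : (size (s1 ++ v :: s2) < i)%N by rewrite ltn_neqAle eq_sym i2.
  have [k ik] := split_gt s2i; rewrite ik e2 omit_gt -catA /= in szi *.
  by rewrite dbard_alt0 ?mulr0.
rewrite (bigD1 (Ordinal j1))//= (bigD1 (Ordinal j2))/=; last first.
  by rewrite -val_eqE /= s12 -{2}[size s1]addn0 eqn_add2l.
have key (x y t : R[i]) : t = 0 -> x + y = 0 -> x + (y + t) = 0.
  by move=> -> ; rewrite addr0.
apply: key; first by apply: big1 => -[i hi] /andP[i1 i2]; exact: zero.
have hq : size (s1 ++ v :: s2 ++ s3) = q.
  by apply/eqP; rewrite -eqSS -h !size_cat /= !size_cat /= !addnS.
(* The two remaining values differ by moving [v] across [s2], a sign [(-1) ^+ size s2], while their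
   prefactors differ by [(-1) ^+ (size s2).+1]: they cancel. *)
rewrite /term {1 2}/L omit_cat nth_cat ltnn subnn /= e2 omit_cat nth_cat ltnn subnn /= -catA /=.
rewrite dbard_move// s12 exprD exprS mulN1r mulrN mulNr mulrA; exact: addrN.
Qed.
End DbarForms.

(** * Invariance of dbar under holomorphic changes of coordinates *)

Section CoordinateChange.
Context {R : realType} {m n : nat}.
Variables (h : 'rV[R[i]]_m -> 'rV[R[i]]_n) (z : 'rV[R[i]]_m).
Variables (q : nat) (W : seq 'rV[R[i]]_n -> 'rV[R[i]]_n -> R[i]).
Hypothesis hh : holmap h z.
Hypothesis hc : h @ z --> h z.
Hypothesis Walt : \forall y \near h z, alt_form q (W^~ y).
Hypothesis Wsm : forall s, size s = q -> smooth_at (h z) (W s).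

Definition pullW (s : seq 'rV[R[i]]_m) (y : 'rV[R[i]]_m) : R[i] :=
  W [seq pushvec h a y | a <- s] (h y).

Let b0 (s : seq 'rV[R[i]]_m) := [seq pushvec h a z | a <- s].

Definition hess (a v : 'rV[R[i]]_m) : 'rV[R[i]]_n :=
  \row_j dird (fun y => pushvec h a y 0 j) v z.

Lemma hess_sym a v : hess a v = hess v a.
Proof.
apply/rowP => j; rewrite [LHS]mxE [RHS]mxE.
have E u : (fun y => pushvec h u y 0 j) = dird (fun y => h y 0 j) u.
  by apply/funext => y; rewrite mxE.
by rewrite !E; apply: dird_sym; exact: holomorphic_at_smooth.
Qed.

Let Waltz : alt_form q (W^~ (h z)). Proof. exact: nbhs_singleton Walt. Qed.

Let Walth : \forall y \near z, alt_form q (W^~ (h y)). Proof. exact: hc Walt. Qed.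

(* Since [h] is holomorphic and [W] antilinear, differentiating the moving
   arguments [pushvec h a y] brings in the second derivatives [hess]. *)
Lemma is_dbard_moving (pre : seq 'rV[R[i]]_n) s v : (size pre + size s)%N = q ->
  is_dbard (fun y => W (pre ++ [seq pushvec h a y | a <- s]) (h y)) v z
    (dbard (W (pre ++ b0 s)) (pushvec h v z) (h z) +
     \sum_(k < size s) W (pre ++ upd (b0 s) k (hess (nth 0 s k) v)) (h z)).
Proof.
(* The prefix [pre] holds constant vectors: each step expands one moving argument in the basis and
   hands a basis vector over to the prefix. *)
elim: s pre => [|a s IH] pre sz.
  by rewrite big_ord0 addr0; apply: holmap_is_dbard; [|apply: Wsm; rewrite -sz size_cat].
have szc x (s' : seq 'rV[R[i]]_n) : size s' = size s -> size (pre ++ x :: s') = q.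
  by move=> ss; rewrite -sz !size_cat /= ss.
have sp y : size [seq pushvec h a y | a <- s] = size s by rewrite size_map.
have IHj (j : 'I_n) : is_dbard (fun y => W (pre ++ delta_mx 0 j :: [seq pushvec h a y | a <- s]) (h y)) v z
    (dbard (W (pre ++ delta_mx 0 j :: b0 s)) (pushvec h v z) (h z) +
     \sum_(k < size s) W (pre ++ delta_mx 0 j :: upd (b0 s) k (hess (nth 0 s k) v)) (h z)).
  have H := IH (rcons pre (delta_mx 0 j)); rewrite size_rcons addSnnS in H.
  have := is_dbard_near _ (H sz); rewrite cat_rcons.
  rewrite (eq_bigr (fun k : 'I_(size s) =>
    W (pre ++ delta_mx 0 j :: upd (b0 s) k (hess (nth 0 s k) v)) (h z))); last first.
    by move=> k _; rewrite cat_rcons.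
  by apply; near=> y; rewrite cat_rcons.
have push_hol (j : 'I_n) : holomorphic_at z (fun y => pushvec h a y 0 j).
  by apply: holomorphic_at_near (holomorphic_at_dird a (hh j)); near=> y; rewrite mxE.
(* The coefficients are conjugates of holomorphic functions, whose [dbard] is the conjugate of their
   derivative, an entry of [hess a v]. *)
have D := is_dbard_sum (index_enum 'I_n) (fun j => is_dbardM (is_dbard_conj v (push_hol j)) (IHj j)).
have near_expand : \forall y \near z,
    \sum_j ((pushvec h a y 0 j)^*)%R * W (pre ++ delta_mx 0 j :: [seq pushvec h a y | a <- s]) (h y)
    = W (pre ++ [seq pushvec h a y | a <- a :: s]) (h y).
  by apply: filterS Walth => y Wy; rewrite -(alt_form_expand Wy)//; exact: szc.
(* Contraction over [j]: the derivatives of the coefficients give the new term [k = 0], the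
   induction hypothesis gives the [dbard] term and the terms [k > 0]. *)
have E : \sum_j (((dird (fun y => pushvec h a y 0 j) v z)^*)%R * W (pre ++ delta_mx 0 j :: b0 s) (h z) +
     ((pushvec h a z 0 j)^*)%R * (dbard (W (pre ++ delta_mx 0 j :: b0 s)) (pushvec h v z) (h z) +
     \sum_(k < size s) W (pre ++ delta_mx 0 j :: upd (b0 s) k (hess (nth 0 s k) v)) (h z))) =
  dbard (W (pre ++ b0 (a :: s))) (pushvec h v z) (h z) +
     \sum_(k < size (a :: s)) W (pre ++ upd (b0 (a :: s)) k (hess (nth 0 (a :: s) k) v)) (h z).
  rewrite big_split /= addrC.
  rewrite (eq_bigr _ (fun j _ => mulrDr _ _ _)) big_split /= -addrA.
  rewrite big_ord_recl /= upd0; congr (_ + _).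
    by rewrite -(dbard_expand Walt Wsm)//; apply: szc; rewrite size_map.
  rewrite addrC; congr (_ + _).
    rewrite (alt_form_expand Waltz); last by apply: szc; rewrite size_map.
    by apply: eq_bigr => j _; rewrite !mxE.
  under eq_bigr do rewrite mulr_sumr.
  rewrite exchange_big /=; apply: eq_bigr => k _.
  rewrite updS -(alt_form_expand Waltz)//.
  by apply: szc; rewrite size_upd size_map.
by move: D; rewrite E; exact: is_dbard_near near_expand.
Unshelve. all: by end_near. Qed.

(** Positions refer to the full list [vs], so that [i] and [k] play symmetric roles; the value 0 on
    the diagonal lets both run through the whole index range. *)
Let corr (vs : seq 'rV[R[i]]_m) (i k : nat) : R[i] :=
  if i == k then 0 else
  (-1) ^+ i * W (omit i (upd (b0 vs) k (hess (nth 0 vs k) (nth 0 vs i)))) (h z).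

(* [hess] is symmetric, and moving the changed argument from position [k] to
   position [i] in an alternating form costs a sign [(-1) ^ (k - 1 - i)]. *)
Lemma corr_antisym vs i k : size vs = q.+1 -> (i < q.+1)%N -> (k < q.+1)%N ->
  corr vs i k = - corr vs k i.
Proof.
have lt i' k' : size vs = q.+1 -> (i' < k')%N -> (k' < q.+1)%N ->
    corr vs i' k' = - corr vs k' i'.
  move=> szv ik kq; rewrite /corr (ltn_eqF ik) (gtn_eqF ik).
  rewrite (hess_sym (nth 0 vs i')); move: (hess _ _) => H.
  have [|A [x [B [y [C [E sA sB]]]]]] := @split_at2 _ (b0 vs) i' k'.
    by rewrite size_map szv ik.
  have szE : size (A ++ x :: B ++ y :: C) = q.+1 by rewrite -E size_map.
  have E2 : A ++ x :: B ++ y :: C = (A ++ x :: B) ++ y :: C by rewrite -catA.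
  have sk : size (A ++ x :: B) = k' by rewrite size_cat.
  have e1 : omit i' (upd (b0 vs) k' H) = A ++ B ++ H :: C.
    by rewrite E E2 -sk upd_cat -catA /= -sA omit_cat.
  have e2 : omit k' (upd (b0 vs) i' H) = A ++ H :: B ++ C.
    rewrite E -sA upd_cat -cat_cons catA.
    have -> : k' = size (A ++ H :: B) by rewrite -sk !size_cat.
    by rewrite omit_cat -catA.
  rewrite e1 e2 (alt_form_move Waltz); last first.
    by apply/eqP; rewrite -eqSS -szE !size_cat /= !size_cat /= !addnS.
  by rewrite -sB sA exprD exprS mulN1r mulrN mulNr opprK mulrA.
move=> szv iq kq; have [ik|ki|->] := ltngtP i k; first exact: lt.
  by rewrite (lt k i) ?opprK.
by rewrite /corr eqxx oppr0.
Qed.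

Lemma dbarV_pull vs : size vs = q.+1 ->
  dbarV pullW vs z = dbarV W [seq pushvec h v z | v <- vs] (h z).
Proof.
move=> szv.
have szo i : (i < size vs)%N -> size (omit i vs) = q by move=> ivs; rewrite size_omit// szv.
have E (i : 'I_(size vs)) : dbard (pullW (omit i vs)) (nth 0 vs i) z =
    dbard (W (b0 (omit i vs))) (pushvec h (nth 0 vs i) z) (h z) +
     \sum_(k < size (omit i vs)) W (upd (b0 (omit i vs)) k
        (hess (nth 0 (omit i vs) k) (nth 0 vs i))) (h z).
  exact: is_dbard_val (@is_dbard_moving [::] _ (nth 0 vs i) (szo i (ltn_ord i))).
rewrite /dbarV (eq_bigr _ (fun i _ => congr1 _ (E i))).
rewrite (eq_bigr _ (fun i _ => mulrDr _ _ _)) big_split /= size_map.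
have -> : \sum_(i < size vs) (-1) ^+ i * \sum_(k < size (omit i vs))
   W (upd (b0 (omit i vs)) k (hess (nth 0 (omit i vs) k) (nth 0 vs i))) (h z) = 0.
  rewrite szv (eq_bigr (fun i : 'I_q.+1 => \sum_(k < q.+1) corr vs i k)); last first.
    move=> i _; rewrite szo ?szv// (bigD1_ord i)//= {1}/corr eqxx add0r mulr_sumr.
    apply: eq_bigr => k _; rewrite /corr /b0 /= (negbTE (neq_bump i k)) nth_omit -omit_map upd_omit//.
    by rewrite size_map szv ltnS.
  (* An antisymmetric double sum equals its opposite, hence is 0 in characteristic 0. *)
  set S := \sum_i _; have SN : S = - S.
    rewrite {1}/S exchange_big /= -sumrN; apply: eq_bigr => k _; rewrite -sumrN.
    by apply: eq_bigr => i _; exact: corr_antisym.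
  have : S *+ 2 == 0 by rewrite mulr2n {1}SN addNr.
  by rewrite mulrn_eq0 => /eqP.
rewrite addr0; apply: eq_bigr => i _.
by rewrite /b0 -omit_map (nth_map 0).
Qed.
End CoordinateChange.

(** * Forms in charts *)

Section Charts.
Context {R : realType} {S : fun_space R}.
Implicit Types (x y : S) (f g : S -> R[i]) (c : chart S).

Lemma chart_at_dom x y c : chart_at x c -> cdom c y -> chart_at y c.
Proof. by move=> [oc _ oi ck iso] cy; exact: And5 oc cy oi ck iso. Qed.

Lemma chart_at_near x c : chart_at x c -> \forall y \near x, chart_at y c.
Proof.
move=> cx; have [oc cxd _ _ _] := cx.
have := open_nbhs_nbhs (conj oc cxd); apply: filterS => y; exact: (chart_at_dom cx).
Qed.

Lemma open_Reg : open (Reg S).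
Proof.
rewrite openE => x [c cx]; rewrite /interior; apply: filterS (chart_at_near cx) => y cy.
by exists c.
Qed.

Lemma chart_atK x c : chart_at x c -> cinv c (cmap c x) = x.
Proof. by move=> [_ xd _ ck _]; exact: ck. Qed.

Lemma near_cmap x c (P : set 'rV[R[i]]_(cdim c)) : chart_at x c ->
  (\forall z \near cmap c x, P z) -> \forall y \near x, P (cmap c y).
Proof.
move=> [_ xd _ _ [_ emb _]] MP.
have : nbhs x (cdom c `&` cmap c @^-1` P) by apply/(emb x xd); exists P.
by apply: filterS => y [].
Qed.

(** [cinv] is arbitrary off the image of the chart; as the image is open, it is still an inverse
    near [cmap c x]. *)
Lemma near_cinv x c (P : set S) : chart_at x c ->
  (\forall y \near x, P y) ->
  \forall z \near cmap c x, [/\ P (cinv c z), chart_at (cinv c z) c & cmap c (cinv c z) = z].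
Proof.
move=> cx xP; have [oc xd oi ck [_ emb _]] := cx.
have [M MN sM] := (emb x xd P).1 xP.
have im : nbhs (cmap c x) (cmap c @` cdom c).
  by apply: open_nbhs_nbhs; split=> //; exists x.
apply: filterS (filterI MN im) => z [Mz [y yd yz]].
rewrite -yz ck//; split=> //; last exact: chart_at_dom cx yd.
by apply: sM; split=> //=; rewrite yz.
Qed.

Lemma near_cinv1 x c (P : set S) : chart_at x c ->
  (\forall y \near x, P y) -> \forall z \near cmap c x, P (cinv c z).
Proof. by move=> cx xP; apply: filterS (near_cinv cx xP) => z []. Qed.

(** At a regular point the stalk is that of C^n, and the closure properties of [hol] are read off
    from [holomorphic_at]. *)
Lemma holP x c f : chart_at x c -> hol x f <-> holomorphic_at (cmap c x) (f \o cinv c).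
Proof.
move=> cx; have [oc xd oi ck [_ emb hl]] := cx; split=> [/(hl x xd)[F Fh fF]|fh].
  apply: holomorphic_at_near Fh; apply: filterS (near_cinv cx fF) => z [E _ zK].
  by rewrite /= E zK.
apply/(hl x xd); exists (f \o cinv c) => //.
have := open_nbhs_nbhs (conj oc xd); apply: filterS => y yd.
by rewrite /= ck.
Qed.

Lemma hol_cst x (a : R[i]) : Reg S x -> hol x (fun=> a).
Proof. by move=> [c cx]; apply/(holP _ cx); exact: holomorphic_at_cst. Qed.

Lemma holD x f g : Reg S x -> hol x f -> hol x g -> hol x (fun y => f y + g y).
Proof.
move=> [c cx] /(holP _ cx) fh /(holP _ cx) gh; apply/(holP _ cx).
exact: holomorphic_atD fh gh.
Qed.

Lemma holM x f g : Reg S x -> hol x f -> hol x g -> hol x (fun y => f y * g y).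
Proof.
move=> [c cx] /(holP _ cx) fh /(holP _ cx) gh; apply/(holP _ cx).
exact: holomorphic_atM fh gh.
Qed.

Lemma hol_open x f : Reg S x -> hol x f -> \forall y \near x, hol y f.
Proof.
move=> [c cx] /(holP _ cx)/holomorphic_at_open/(near_cmap cx) fh.
by apply: filterS (filterI fh (chart_at_near cx)) => y [fy cy]; apply/(holP _ cy).
Qed.

Lemma hol_coord x c j : chart_at x c -> hol x (fun y => cmap c y 0 j).
Proof.
move=> cx; apply/(holP _ cx); apply: holomorphic_at_near (holomorphic_at_coord j _).
by apply: filterS (near_cinv cx (filterT : nbhs x setT)) => z [_ _ zK]; rewrite /= zK.
Qed.

Definition transition c' c (z : 'rV[R[i]]_(cdim c')) : 'rV[R[i]]_(cdim c) :=
  cmap c (cinv c' z).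

Lemma transition_cmap x c' c : chart_at x c' -> transition c (cmap c' x) = cmap c x.
Proof. by move=> cx; rewrite /transition chart_atK. Qed.

Lemma holmap_transition x c' c : chart_at x c' -> chart_at x c ->
  holmap (transition c (c' := c')) (cmap c' x).
Proof. by move=> cx' cx j; exact: (holP _ cx').1 (hol_coord j cx). Qed.

Lemma transition_cvg x c' c : chart_at x c' -> chart_at x c ->
  transition c (c' := c') @ cmap c' x --> transition c (cmap c' x).
Proof.
move=> cx' cx P; rewrite transition_cmap// => /(near_cmap cx) xP.
exact: (near_cinv1 cx' xP).
Qed.

(** Chain rule: near the point, [f \o cinv c'] is [f \o cinv c] composed with the transition map. *)
Lemma cfield_change x c' c (a : 'rV[R[i]]_(cdim c')) : chart_at x c' -> chart_at x c ->
  cfield a x = cfield (pushvec (transition c (c' := c')) a (cmap c' x)) x.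
Proof.
move=> cx' cx; apply/funext => f; rewrite /cfield; case: asboolP => // fh.
have /(holP _ cx)/holomorphic_at_smooth fs := fh; rewrite -(transition_cmap c cx') in fs.
rewrite -(transition_cmap c cx') -(holmap_dird _ (holmap_transition cx' cx) fs).
apply: dird_near.
apply: filterS (near_cinv cx' (chart_at_near cx)) => z [cz _ _].
by rewrite /= /transition chart_atK.
Qed.

Lemma cfield_linear x c (a : R[i]) (u v : 'rV[R[i]]_(cdim c)) : chart_at x c ->
  cfield (a *: u + v) x = fun f => a * cfield u x f + cfield v x f.
Proof.
move=> cx; apply/funext => f; rewrite /cfield; case: asboolP => fh.
  by apply: holomorphic_at_dird_linear; exact/(holP _ cx).
by rewrite mulr0 addr0.
Qed.

(** The coordinate functions have to be recognised as members of the stalk first, since [cfield] is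
    0 on all other functions. *)
Lemma coords_cfield x c (a : 'rV[R[i]]_(cdim c)) : chart_at x c ->
  coords c (cfield a x) = a.
Proof.
move=> cx; apply/rowP => j; rewrite mxE /cfield asboolT; last exact: hol_coord.
apply: is_dird_val; apply: is_dird_near (is_dird_coord j a _).
by apply: filterS (near_cinv cx (filterT : nbhs x setT)) => z [_ _ zK]; rewrite /= zK.
Qed.

Lemma tangentP x c v : chart_at x c -> tangent x v -> v = cfield (coords c v) x.
Proof.
move=> cx [c' [a [cx' ->]]]; rewrite (cfield_change a cx' cx).
by rewrite coords_cfield.
Qed.

Lemma coords_change x c' c v : chart_at x c' -> chart_at x c -> tangent x v ->
  coords c v = pushvec (transition c (c' := c')) (coords c' v) (cmap c' x).
Proof.
move=> cx' cx vt; rewrite {1}(tangentP cx' vt) (cfield_change _ cx' cx).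
by rewrite coords_cfield.
Qed.

Lemma tangent_cfield x c (a : 'rV[R[i]]_(cdim c)) : chart_at x c -> tangent x (cfield a x).
Proof. by move=> cx; exists c, a. Qed.

Lemma tangents_cfield q x c (s : seq 'rV[R[i]]_(cdim c)) : chart_at x c -> size s = q ->
  tangents q x [seq cfield a x | a <- s].
Proof.
move=> cx sq; split; first by rewrite size_map.
by apply/List.Forall_map/List.Forall_forall => a _; exact: tangent_cfield.
Qed.

Lemma tangentsP x c vs : chart_at x c -> List.Forall (tangent x) vs ->
  vs = [seq cfield a x | a <- [seq coords c v | v <- vs]].
Proof.
move=> cx; elim: vs => //= v vs IH h.
by rewrite -(tangentP cx (List.Forall_inv h)) -IH//; exact: List.Forall_inv_tail h.
Qed.
End Charts.

(** * Smoothness of all coefficients near a point *)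

Section SmoothFamilies.
Context {R : realType} {n : nat}.
Notation V := 'rV[R[i]]_n.

Lemma alt_form_ext q (w w' : seq V -> R[i]) :
  (forall s, size s = q -> w s = w' s) -> alt_form q w -> alt_form q w'.
Proof.
move=> ww [wl wa]; split=> [s1 s2 u v a h|s1 s2 s3 v h]; last by rewrite -ww ?wa.
have sz x : size (s1 ++ x :: s2) = q by rewrite -h !size_cat.
by rewrite -!ww// wl.
Qed.

(* Smoothness of the coefficients along all argument lists holds on one common
   neighbourhood, because finitely many basis lists determine the form. *)
Lemma smooth_family_open q (W : seq V -> V -> R[i]) (z : V) :
  (\forall y \near z, alt_form q (W^~ y)) ->
  (forall s, size s = q -> smooth_at z (W s)) ->
  \forall y \near z, forall s, size s = q -> smooth_at y (W s).
Proof.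
move=> Walt Wsm; have Walt2 := nbhs_interior Walt.
(* Induction on the number [k] of free vectors; the other [q - k] arguments are basis vectors. *)
suff H k : (k <= q)%N -> \forall y \near z, forall s (J : (q - k).-tuple 'I_n), size s = k ->
    smooth_at y (W (s ++ [seq delta_mx 0 j | j <- J])).
  have := H q (leqnn q); apply: filterS => y Hy s sq.
  by have := Hy s (tcast (esym (subnn q)) [tuple]) sq; rewrite val_tcast /= cats0.
elim: k => [|k IH] kq.
  have : \forall y \near z, forall J : (q - 0).-tuple 'I_n,
      smooth_at y (W [seq delta_mx 0 j | j <- J]).
    have FF : Filter (nbhs z) by exact: nbhs_filter.
    have := @filter_forall V ((q - 0).-tuple 'I_n)%type
      (fun J y => smooth_at y (W [seq delta_mx 0 j | j <- J])) (nbhs z) FF.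
    apply=> J; apply/smooth_at_open/Wsm.
    by rewrite size_map size_tuple subn0.
  by apply: filterS => y Hy s J /size0nil ->; exact: Hy.
have qk : (q - k = (q - k.+1).+1)%N by rewrite -subSn.
apply: filterS (filterI Walt2 (IH (ltnW kq))) => y [Wy Hy] s J sk.
case/lastP: s sk => // s b; rewrite size_rcons => -[sk].
have sz x : size (s ++ x :: [seq delta_mx 0 j | j <- J] : seq V) = q.
  by rewrite size_cat /= size_map size_tuple sk -qk subnKC// ltnW.
rewrite cat_rcons.
apply: (@smooth_at_near _ _ (fun y => \sum_j ((b 0 j)^*)%R *
  W (s ++ delta_mx 0 j :: [seq delta_mx 0 j | j <- J]) y)).
  by apply: filterS Wy => x Wx; rewrite -(alt_form_expand Wx).
apply: smooth_at_sum => j; apply: smooth_atM; first exact: smooth_at_cst.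
by have := Hy s (tcast (esym qk) [tuple of j :: J]) sk; rewrite val_tcast.
Qed.
End SmoothFamilies.

Section FormsOnCharts.
Context {R : realType} {S : fun_space R}.
Implicit Types (x y : S) (c : chart S) (w : Defs.form S).

Lemma coefE c w s z : coef w s z = w (cinv c z) [seq cfield a (cinv c z) | a <- s].
Proof. by []. Qed.

Lemma alt_form_of q y c w : chart_at y c -> antilinear_alternating q y w ->
  alt_form q (fun s => w y [seq cfield a y | a : 'rV[R[i]]_(cdim c) <- s]).
Proof.
move=> cy [wl wa].
have tg s : size s = q -> tangents q y [seq cfield a y | a : 'rV[R[i]]_(cdim c) <- s].
  by move=> sq; exact: tangents_cfield.
split=> [s1 s2 u v a h|s1 s2 s3 v h].
  have sz t : size (s1 ++ t :: s2) = q by rewrite -h !size_cat.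
  have := tg _ (sz u); have := tg _ (sz v); rewrite !map_cat /= => tv tu.
  by rewrite cfield_linear// wl.
by have := tg _ h; rewrite !map_cat /= map_cat /= => /wa.
Qed.

Lemma alternating_of q y c w : chart_at y c ->
  alt_form q (fun s => w y [seq cfield a y | a : 'rV[R[i]]_(cdim c) <- s]) ->
  antilinear_alternating q y w.
Proof.
move=> cy [wl wa].
have E s v s' : List.Forall (tangent y) (s ++ v :: s') ->
   [/\ s = [seq cfield a y | a : 'rV[R[i]]_(cdim c) <- [seq coords c v | v <- s]],
       v = cfield (coords c v) y &
       s' = [seq cfield a y | a : 'rV[R[i]]_(cdim c) <- [seq coords c v | v <- s']]].
  move=> /List.Forall_app[hs hvs].
  split; [exact: tangentsP|exact: tangentP (List.Forall_inv hvs)|].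
  exact: tangentsP (List.Forall_inv_tail hvs).
split=> [s1 s2 u v a [su tu] [sv tv]|s1 s2 s3 v [sz tg]].
  have [-> -> ->] := E _ _ _ tu; have [_ -> _] := E _ _ _ tv.
  rewrite -cfield_linear//.
  have := wl [seq coords c v | v <- s1] [seq coords c v | v <- s2] (coords c u) (coords c v) a.
  by rewrite !map_cat /=; apply; rewrite -su !size_cat /= !size_map.
have [E1 E2 E3] := E _ _ _ tg.
have tg3 : List.Forall (tangent y) (s2 ++ v :: s3).
  have [_ h] := (List.Forall_app _ _ _).1 tg; exact: List.Forall_inv_tail h.
have [F1 _ F3] := E _ _ _ tg3.
rewrite E1 E2 F1 F3.
have := wa [seq coords c v | v <- s1] [seq coords c v | v <- s2] [seq coords c v | v <- s3] (coords c v).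
rewrite !map_cat /= map_cat /=; apply.
by rewrite -sz !size_cat /= !size_cat /= !size_map.
Qed.

Lemma coef_cmap y c w s : chart_at y c ->
  coef w s (cmap c y) = w y [seq cfield a y | a <- s].
Proof. by move=> cy; rewrite coefE chart_atK. Qed.

Lemma smooth_form_alt q x c w : chart_at x c -> smooth_form q x w ->
  \forall z \near cmap c x, alt_form q (fun s => @coef _ _ c w s z).
Proof.
move=> cx [wa _]; apply: filterS (near_cinv cx wa) => z [wz cz zK].
exact: alt_form_of.
Qed.

Lemma smooth_form_smooth q x c w : chart_at x c -> smooth_form q x w ->
  forall s, size s = q -> smooth_at (cmap c x) (@coef _ _ c w s).
Proof. by move=> cx [_ ws]; exact: ws. Qed.

(** Alternation concerns tangent vectors, so one chart settles it; smoothness is asked in every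
    chart. *)
Lemma smooth_formP q x w :
  (exists2 c, chart_at x c & \forall y \near x, alt_form q (fun s => @coef _ _ c w s (cmap c y))) ->
  (forall c, chart_at x c -> forall s, size s = q -> smooth_at (cmap c x) (@coef _ _ c w s)) ->
  smooth_form q x w.
Proof.
move=> [c cx wa] ws; split=> //.
apply: filterS (filterI wa (chart_at_near cx)) => y [wy cy]; apply: (alternating_of cy).
by apply: alt_form_ext wy => s _; rewrite coef_cmap.
Qed.

Lemma coef_near q x c w w' s : chart_at x c -> size s = q ->
  (\forall y \near x, form_eq_at q y w w') ->
  \forall z \near cmap c x, coef w s z = @coef _ _ c w' s z.
Proof.
move=> cx sq ww; apply: filterS (near_cinv cx ww) => z [wz cz _].
by rewrite !coefE; apply: wz; exact: tangents_cfield.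
Qed.

Lemma smooth_form_near q x w w' : Reg S x ->
  (\forall y \near x, form_eq_at q y w w') -> smooth_form q x w -> smooth_form q x w'.
Proof.
move=> [c cx] ww ws; apply: smooth_formP.
  exists c => //; have := near_cmap cx (smooth_form_alt cx ws).
  move=> wa; apply: filterS (filterI wa (filterI ww (chart_at_near cx))) => y [wy [wwy cy]].
  apply: alt_form_ext wy => s sq; rewrite !coef_cmap//.
  by apply: wwy; exact: tangents_cfield.
move=> c' cx' s sq; apply: smooth_at_near (smooth_form_smooth cx' ws sq).
exact: (coef_near cx' sq ww).
Qed.

Lemma smooth_form0 q x : Reg S x -> smooth_form q x (@form0 R S).
Proof.
move=> [c cx]; apply: smooth_formP.
  exists c => //; near=> y; split=> [*|*]; rewrite /coef /form0 //.
  by rewrite mulr0 addr0.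
by move=> c' cx' s sq; exact: smooth_at_cst.
Unshelve. all: by end_near. Qed.

Lemma smooth_form_add q x w w' : Reg S x -> smooth_form q x w -> smooth_form q x w' ->
  smooth_form q x (form_add w w').
Proof.
move=> [c cx] ws ws'; apply: smooth_formP.
  exists c => //.
  apply: filterS (filterI (near_cmap cx (smooth_form_alt cx ws))
    (near_cmap cx (smooth_form_alt cx ws'))) => y [[wl wa] [wl' wa']].
  have E s : coef (form_add w w') s (cmap c y) = coef w s (cmap c y) + coef w' s (cmap c y).
    by [].
  split=> [s1 s2 u v a h|s1 s2 s3 v h].
    by rewrite !E wl// wl'// mulrDr addrACA.
  by rewrite E wa// wa'// addr0.
move=> c' cx' s sq.
exact: smooth_atD (smooth_form_smooth cx' ws sq) (smooth_form_smooth cx' ws' sq).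
Qed.

Lemma smooth_form_mul q x f w : hol x f -> smooth_form q x w -> Reg S x ->
  smooth_form q x (form_mul f w).
Proof.
move=> fh ws [c cx]; apply: smooth_formP.
  exists c => //.
  apply: filterS (near_cmap cx (smooth_form_alt cx ws)) => y [wl wa].
  have E s : coef (form_mul f w) s (cmap c y) = f (cinv c (cmap c y)) * coef w s (cmap c y).
    by [].
  split=> [s1 s2 u v a h|s1 s2 s3 v h].
    by rewrite !E wl// mulrDr mulrCA.
  by rewrite E wa// mulr0.
move=> c' cx' s sq; apply: smooth_atM (smooth_form_smooth cx' ws sq).
exact/holomorphic_at_smooth/(holP _ cx').
Qed.
End FormsOnCharts.

(** * The operator dbar read in an arbitrary chart *)

Section DbarOnCharts.
Context {R : realType} {S : fun_space R}.
Implicit Types (x y : S) (c : chart S) (w : Defs.form S).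

Lemma coef_change x c c' w (s : seq 'rV[R[i]]_(cdim c')) :
  chart_at x c -> chart_at x c' ->
  \forall z \near cmap c' x, coef w s z =
    pullW (transition c (c' := c')) (fun s z => @coef _ _ c w s z) s z.
Proof.
move=> cx cx'; apply: filterS (near_cinv cx' (chart_at_near cx)) => z [cz cz' zK].
rewrite /pullW coefE coefE /transition chart_atK//; congr (w _ _).
rewrite -map_comp; apply: eq_map => a /=.
by rewrite (cfield_change a cz' cz) zK.
Qed.

(** Trades the charts chosen inside [dbar], one for each [y], for the single chart [c]: [dbarV_pull]
    is applied at [y] to the transition map from the chosen chart. *)
Lemma dbarE q x c w : chart_at x c -> smooth_form q x w ->
  \forall y \near x, forall vs, tangents q.+1 y vs ->
    dbar w y vs = dbarV (fun s z => @coef _ _ c w s z) [seq coords c v | v <- vs] (cmap c y).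
Proof.
move=> cx ws; pose W (s : seq 'rV[R[i]]_(cdim c)) z := coef w s z.
have walt : \forall z \near cmap c x, alt_form q (W^~ z) := smooth_form_alt cx ws.
(* The chart is changed at [y] and not at [x], so smoothness and alternation are needed at the
   nearby points. *)
have wsm := smooth_family_open walt (smooth_form_smooth cx ws).
have walt2 := nbhs_interior walt.
apply: filterS (filterI (near_cmap cx wsm) (filterI (near_cmap cx walt2) (chart_at_near cx))).
move=> y [ysm [yalt cy]] vs [szv vt]; rewrite /dbar.
case: pselect => [h|]; last by case; exists c.
(* Of the chosen chart, only the fact that it is a chart at [y] is retained. *)
move: (projT1 _) (projT2 (cid h)) => c' /= cy'.
have hh := holmap_transition cy' cy.
have := @dbarV_pull _ _ _ (transition c (c' := c')) (cmap c' y) q W hh (transition_cvg cy' cy).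
rewrite (transition_cmap c cy') => /(_ yalt ysm [seq coords c' v | v <- vs]).
rewrite size_map => /(_ szv); rewrite -map_comp.
rewrite (_ : [seq _ | v <- vs] = [seq coords c v | v <- vs]); last first.
  elim: vs vt {szv} => //= v vs IH vt; rewrite IH; last exact: List.Forall_inv_tail vt.
  by rewrite -coords_change//; exact: List.Forall_inv vt.
move=> <-; rewrite /dbarV size_map; apply: eq_bigr => i _; congr (_ * _).
by apply: dbard_near; exact: coef_change cy cy'.
Qed.

Lemma alt_form_dbar_coef q x c w : chart_at x c -> smooth_form q x w ->
  \forall y \near x,
    alt_form q.+1 (fun s => dbarV (fun s z => @coef _ _ c w s z) s (cmap c y)).
Proof.
move=> cx ws; pose W (s : seq 'rV[R[i]]_(cdim c)) z := coef w s z.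
have walt : \forall z \near cmap c x, alt_form q (W^~ z) := smooth_form_alt cx ws.
have wsm := smooth_family_open walt (smooth_form_smooth cx ws).
have walt2 := nbhs_interior walt.
apply: filterS (filterI (near_cmap cx wsm) (near_cmap cx walt2)) => y [ysm yalt].
exact: alt_form_dbarV yalt ysm.
Qed.

Lemma coef_dbar q x c w s : chart_at x c -> smooth_form q x w -> size s = q.+1 ->
  \forall z \near cmap c x, coef (dbar w) s z = dbarV (fun s z => @coef _ _ c w s z) s z.
Proof.
move=> cx ws sq; apply: filterS (near_cinv cx (dbarE cx ws)) => z [wz cz zK].
rewrite coefE wz; last exact: tangents_cfield.
rewrite zK -map_comp; congr dbarV; rewrite -[RHS]map_id; apply: eq_map => a /=.
exact: coords_cfield.
Qed.

Lemma smooth_form_dbar q x w : Reg S x -> smooth_form q x w -> smooth_form q.+1 x (dbar w).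
Proof.
move=> [c cx] ws; apply: smooth_formP.
  exists c => //.
  apply: filterS (filterI (alt_form_dbar_coef cx ws) (filterI (dbarE cx ws) (chart_at_near cx))).
  move=> y [ay [wy cy]]; apply: alt_form_ext ay => s sq.
  rewrite coef_cmap// wy; last exact: tangents_cfield.
  rewrite -map_comp; congr dbarV; rewrite -[LHS]map_id; apply: eq_map => a /=.
  by rewrite coords_cfield.
move=> c' cx' s sq; apply: (@smooth_at_near _ _ (dbarV (fun s z => @coef _ _ c' w s z) s)).
  by apply: filterS (coef_dbar cx' ws sq) => z ->.
apply: smooth_at_sum => i; apply: smooth_atM; first exact: smooth_at_cst.
apply: smooth_at_dbard; apply: (smooth_form_smooth cx' ws).
by rewrite size_omit// sq.
Qed.

Lemma dbar_near q x w w' : Reg S x -> smooth_form q x w ->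
  (\forall y \near x, form_eq_at q y w w') ->
  \forall y \near x, form_eq_at q.+1 y (dbar w) (dbar w').
Proof.
move=> xr ws ww; have ws' := smooth_form_near xr ww ws; have [c cx] := xr.
have ww2 := nbhs_interior ww.
apply: filterS (filterI (dbarE cx ws) (filterI (dbarE cx ws') (filterI ww2 (chart_at_near cx)))).
move=> y [wy [wy' [wwy cy]]] vs tv; rewrite wy// wy'//; apply: eq_bigr => i _.
congr (_ * _); apply: dbard_near; apply: (coef_near cy _ wwy).
by have [sv _] := tv; rewrite size_omit// size_map sv.
Qed.

Lemma dbar_add q x w w' : Reg S x -> smooth_form q x w -> smooth_form q x w' ->
  \forall y \near x, form_eq_at q.+1 y (dbar (form_add w w')) (form_add (dbar w) (dbar w')).
Proof.
move=> xr ws ws'; have wws := smooth_form_add xr ws ws'; have [c cx] := xr.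
have sm := smooth_family_open (smooth_form_alt cx ws) (smooth_form_smooth cx ws).
have sm' := smooth_family_open (smooth_form_alt cx ws') (smooth_form_smooth cx ws').
apply: filterS (filterI (dbarE cx ws) (filterI (dbarE cx ws') (filterI (dbarE cx wws)
  (filterI (near_cmap cx sm) (near_cmap cx sm'))))).
move=> y [wy [wy' [wwy [sy sy']]]] vs tv; rewrite /form_add wwy// wy// wy'//.
rewrite /dbarV -big_split /=; apply: eq_bigr => i _.
have comb (a p r t : R[i]) : p = r + t -> a * p = a * r + a * t by move=> ->; rewrite mulrDr.
apply: comb.
have so : size (omit i [seq coords c v | v <- vs]) = q.
  by have [sv _] := tv; rewrite size_omit// size_map sv.
exact: is_dbard_val (is_dbardD (smooth_at_is_dbard _ (sy _ so)) (smooth_at_is_dbard _ (sy' _ so))).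
Qed.

(** The Leibniz term with the derivative of [f] vanishes since [f] is holomorphic. *)
Lemma dbar_mul q x f w : Reg S x -> hol x f -> smooth_form q x w ->
  \forall y \near x, form_eq_at q.+1 y (dbar (form_mul f w)) (form_mul f (dbar w)).
Proof.
move=> xr fh ws; have fws := smooth_form_mul fh ws xr; have [c cx] := xr.
have sm := smooth_family_open (smooth_form_alt cx ws) (smooth_form_smooth cx ws).
apply: filterS (filterI (dbarE cx ws) (filterI (dbarE cx fws) (filterI (near_cmap cx sm)
  (filterI (hol_open xr fh) (chart_at_near cx))))).
move=> y [wy [fwy [sy [fy cy]]]] vs tv; rewrite /form_mul fwy// wy//.
rewrite /dbarV mulr_sumr; apply: eq_bigr => i _.
have comb (a b p r : R[i]) : p = b * r -> a * p = b * (a * r) by move=> ->; rewrite mulrCA.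
apply: comb.
have so : size (omit i [seq coords c v | v <- vs]) = q.
  by have [sv _] := tv; rewrite size_omit// size_map sv.
have fd := holomorphic_at_is_dbard (nth 0 [seq coords c v | v <- vs] i) ((holP _ cy).1 fy).
apply: etrans (is_dbard_val (is_dbardM fd (smooth_at_is_dbard _ (sy _ so)))) _.
by rewrite mul0r add0r /= chart_atK.
Qed.
End DbarOnCharts.

(** * Isomorphisms of spaces *)

Section SpaceIsomorphisms.
Context {R : realType}.
Implicit Types S : fun_space R.

(** The stalks are compared at regular points: a product gets its functions from charts of the
    factors, so over a singular point of [X] the stalk of [prod1 X] is empty. *)
Definition space_iso S S' (k : S -> S') (p : S' -> S) : Prop :=
  [/\ cancel k p, cancel p k, continuous k, continuous p &
   (forall x f, Reg S x -> hol x f <-> hol (k x) (f \o p)) /\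
   (forall x f, Reg S' x -> hol x f <-> hol (p x) (f \o k))].

Lemma space_iso_sym S S' (k : S -> S') (p : S' -> S) : space_iso k p -> space_iso p k.
Proof. by move=> [? ? ? ? []]; split. Qed.

Definition transport_chart S S' (k : S -> S') (p : S' -> S) (c : chart S') : chart S :=
  @Chart R S (cdim c) (k @^-1` cdom c) (cmap c \o k) (p \o cinv c).

Section Transport.
Variables (S S' : fun_space R) (k : S -> S') (p : S' -> S).
Hypothesis kp : space_iso k p.

Lemma near_iso x (P : set S') : (\forall y \near k x, P y) -> \forall y \near x, P (k y).
Proof. by have [_ _ kc _ _] := kp; move=> h; exact: (kc x P h). Qed.

Lemma near_iso_inv x (P : set S) : (\forall y \near x, P y) -> \forall y \near k x, P (p y).
Proof.
have [kpK _ _ pc _] := kp; move=> h; have /(_ P) := pc (k x); rewrite kpK; exact.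
Qed.

Lemma transport_chart_at x (c : chart S') : chart_at (k x) c -> chart_at x (transport_chart k p c).
Proof.
move=> cx; have [kpK pkK kc pc [_ hp]] := kp; have [oc xd oi ck [inj emb hl]] := cx.
split=> //=.
- by move/continuousP: kc; exact.
- rewrite (_ : _ @` _ = cmap c @` cdom c)//; apply/seteqP; split=> z /=.
    by move=> [y yd <-]; exists (k y).
  by move=> [y yd <-]; exists (p y); rewrite /= ?pkK.
- by move=> y yd; rewrite ck// kpK.
split.
- by move=> y y' yd yd' /= /inj E; apply: (can_inj kpK); exact: E.
- move=> y yd N; split=> [yN|[M MN sM]].
    have [M MN sM] := (emb (k y) yd (p @^-1` N)).1 (near_iso_inv yN).
    by exists M => // y' [yd' My']; have := sM (k y') (conj yd' My'); rewrite /= kpK.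
  have : nbhs (k y) (p @^-1` N).
    by apply/(emb _ yd); exists M => // y' [yd' My']; apply: sM; split; rewrite /= pkK.
  by move/near_iso; apply: filterS => y' /=; rewrite kpK.
move=> y yd f; have cy := chart_at_dom cx yd.
have ky : Reg S' (k y) by exists c.
have := hp (k y) (f \o p) ky; rewrite kpK.
rewrite (_ : (f \o p) \o k = f); last by apply/funext => t /=; rewrite kpK.
move=> <-; split=> [/(hl _ yd)[F Fh fF]|[F Fh fF]].
  by exists F => //; have := near_iso fF; apply: filterS => t /=; rewrite kpK.
apply/(hl _ yd); exists F => //.
by have := near_iso_inv fF; apply: filterS => t /=; rewrite pkK.
Qed.

Lemma Reg_iso x : Reg S' (k x) -> Reg S x.
Proof. by move=> [c cx]; exists (transport_chart k p c); exact: transport_chart_at. Qed.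
End Transport.

Section Pullback.
Variables (S S' : fun_space R) (k : S -> S') (p : S' -> S).
Hypothesis kp : space_iso k p.
Let pk := space_iso_sym kp.

Lemma Reg_isoE x : Reg S x -> Reg S' (k x).
Proof. by have [kpK _ _ _ _] := kp; move=> xr; apply: (Reg_iso pk); rewrite kpK. Qed.

Lemma transport_chart_at_inv x (c : chart S) : chart_at x c ->
  chart_at (k x) (transport_chart p k c).
Proof.
by have [kpK _ _ _ _] := kp; move=> cx; apply: (transport_chart_at pk); rewrite kpK.
Qed.

(** The transported chart has the same coordinates, so the coefficient vector does not change. *)
Lemma pushforward_cfield x (c : chart S) a : chart_at x c ->
  Defs.pushforward k x (cfield a x) = @cfield _ _ (transport_chart p k c) a (k x).
Proof.
move=> cx; have [kpK pkK _ _ [hk hp]] := kp.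
have cx' := transport_chart_at_inv cx; have kx : Reg S' (k x) by eexists; exact: cx'.
apply/funext => f; rewrite /Defs.pushforward /cfield /=; case: asboolP => // fh.
have /asboolT -> : hol x (f \o k) by have := (hp _ _ kx).1 fh; rewrite kpK.
by rewrite kpK.
Qed.

Lemma tangent_pushforward x v : tangent x v -> tangent (k x) (Defs.pushforward k x v).
Proof.
move=> [c [a [cx ->]]]; rewrite pushforward_cfield//.
exact/tangent_cfield/transport_chart_at_inv.
Qed.

Lemma tangents_pushforward q x vs : tangents q x vs ->
  tangents q (k x) [seq Defs.pushforward k x v | v <- vs].
Proof.
move=> [sz vt]; split; first by rewrite size_map.
apply/List.Forall_map; elim: vt => [|v s vt _ IH]; first exact: List.Forall_nil.
by apply: List.Forall_cons => //; exact: tangent_pushforward.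
Qed.

(** Tangency enters because a pushforward is 0 off the stalk, as a tangent vector is, but not an
    arbitrary [vec]. *)
Lemma pushforwardK x v : tangent x v -> Defs.pushforward p (k x) (Defs.pushforward k x v) = v.
Proof.
move=> [c [a [cx ->]]]; have [kpK pkK _ _ [hk hp]] := kp.
apply/funext => f; rewrite /Defs.pushforward kpK; case: asboolP => fh.
  rewrite (asboolT ((hk _ _ _).1 fh)); last by exists c.
  by congr (cfield _ _ _); apply/funext => t /=; rewrite kpK.
by rewrite /cfield; case: asboolP.
Qed.

Lemma pushforwardsK q x vs : tangents q x vs ->
  [seq Defs.pushforward p (k x) v | v <- [seq Defs.pushforward k x v | v <- vs]] = vs.
Proof.
move=> [_ vt]; rewrite -map_comp.
by elim: vt => //= v s vt _ ->; rewrite pushforwardK.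
Qed.

Lemma pullback_near q x w w' : (\forall y \near k x, form_eq_at q y w w') ->
  \forall y \near x, form_eq_at q y (pullback k w) (pullback k w').
Proof.
move=> /(near_iso kp); apply: filterS => y ww vs tv.
by apply: ww; exact: tangents_pushforward.
Qed.

Lemma pullback_pullback q x (w : Defs.form S) :
  form_eq_at q x (pullback k (pullback p w)) w.
Proof.
have [kpK _ _ _ _] := kp; move=> vs tv.
by rewrite /pullback kpK (pushforwardsK tv).
Qed.

Lemma coef_pullback x (c : chart S) w s : chart_at x c ->
  \forall z \near cmap c x,
    coef (pullback k w) s z = @coef _ _ (transport_chart p k c) w s z.
Proof.
move=> cx; apply: filterS (near_cinv cx (filterT : nbhs x setT)) => z [_ cz _].
rewrite !coefE /pullback /= -map_comp; congr (w _ _); apply: eq_map => a /=.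
exact: pushforward_cfield.
Qed.

Lemma cmap_transport x (c : chart S) : cmap (transport_chart p k c) (k x) = cmap c x.
Proof. by have [kpK _ _ _ _] := kp; rewrite /= kpK. Qed.

Lemma smooth_form_pullback q x w : Reg S x ->
  smooth_form q (k x) w -> smooth_form q x (pullback k w).
Proof.
move=> [c cx] ws; have cx' := transport_chart_at_inv cx.
apply: smooth_formP; last first.
  move=> c1 cx1 s sq; have cx1' := transport_chart_at_inv cx1.
  have := smooth_form_smooth cx1' ws sq; rewrite cmap_transport.
  by apply: smooth_at_near; apply: filterS (coef_pullback w s cx1) => z ->.
exists c => //.
have := near_iso kp (near_cmap cx' (smooth_form_alt cx' ws)) => wa.
apply: filterS (filterI wa (chart_at_near cx)) => y [wy cy].
move: wy; rewrite cmap_transport; apply: alt_form_ext => s _.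
by have := nbhs_singleton (coef_pullback w s cy).
Qed.

Lemma coords_pushforward x (c : chart S) v : chart_at x c -> tangent x v ->
  coords (transport_chart p k c) (Defs.pushforward k x v) = coords c v.
Proof.
move=> cx /(tangentP cx) E; rewrite {1}E pushforward_cfield// coords_cfield//.
exact: transport_chart_at_inv.
Qed.

(** By [dbarE] both sides may be computed in [c] and in its transport, where the coefficients of the
    two forms coincide. *)
Lemma dbar_pullback q x w : Reg S x -> smooth_form q (k x) w ->
  \forall y \near x, form_eq_at q.+1 y (dbar (pullback k w)) (pullback k (dbar w)).
Proof.
move=> xr ws; have ws' := smooth_form_pullback xr ws; have [c cx] := xr.
have cx' := transport_chart_at_inv cx.
apply: filterS (filterI (dbarE cx ws') (filterI (near_iso kp (dbarE cx' ws)) (chart_at_near cx))).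
move=> y [wy [wy' cy]] vs tv.
rewrite wy// {2}/pullback wy'; last exact: tangents_pushforward.
rewrite cmap_transport -map_comp (_ : map (_ \o _) vs = [seq coords c v | v <- vs]); last first.
  have [_ vt] := tv; elim: vt {tv} => //= v s vt _ ->.
  by rewrite coords_pushforward.
rewrite /dbarV; apply: eq_bigr => i _; congr (_ * _); apply: dbard_near.
exact: coef_pullback.
Qed.
End Pullback.
End SpaceIsomorphisms.

(** The dimension of a one-block row is a sum over one index, equal but not convertible to that of
    the block; hence the cast. *)
Lemma mxrow1E (T : Type) (q : 'I_1 -> nat) (v : forall i, 'rV[T]_(q i))
    (E : q ord0 = (\sum_i q i)%N) :
  \mxrow_i v i = castmx (erefl 1%N, E) (v ord0).
Proof.
apply/mxrowP => j; rewrite (ord1 j) mxrowK; apply/rowP => k.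
rewrite [RHS]mxE castmxE cast_ord_id; congr (v ord0 _ _); apply: val_inj.
by rewrite [RHS]tagnat.RankEsum big_pred0.
Qed.

Lemma castmx_rowK (T : Type) m n (E : m = n) (z : 'rV[T]_m) :
  castmx (erefl 1%N, esym E) (castmx (erefl 1%N, E) z) = z.
Proof. by case: _ / E. Qed.

Lemma holomorphic_at_castmx (R : realType) m n (E : m = n) (F : 'rV[R[i]]_n -> R[i]) z :
  holomorphic_at (castmx (erefl 1%N, E) z) F <->
  holomorphic_at z (F \o castmx (erefl 1%N, E)).
Proof.
case: _ / E F => F; rewrite castmx_id.
by rewrite (_ : F \o _ = F)//; apply/funext => y; rewrite /= castmx_id.
Qed.

(** * Products with a single factor *)

Section UnaryProduct.
Context {R : realType}.
Variable X : fun_space R.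

Definition prod1 : fun_space R := prod_space (fun _ : 'I_1 => X).
Definition to_prod1 (x : X) : prod1 := fun=> x.
Definition of_prod1 (y : prod1) : X := y ord0.

Lemma of_prod1K : cancel of_prod1 to_prod1.
Proof. by move=> y; apply: functional_extensionality_dep => l; rewrite (ord1 l). Qed.

Lemma to_prod1_continuous : continuous to_prod1.
Proof.
move=> x; have := @dfwith_continuous 'I_1 (fun=> carrier X) (to_prod1 x) ord0 x.
have E y : dfwith (to_prod1 x) ord0 y = to_prod1 y.
  by apply: functional_extensionality_dep => l; rewrite (ord1 l) dfwithin.
by rewrite /continuous_at E; rewrite (_ : dfwith _ ord0 = to_prod1)//; apply/funext => y; exact: E.
Qed.

Lemma of_prod1_continuous : continuous of_prod1.
Proof. exact: (@proj_continuous 'I_1 (fun=> carrier X) ord0). Qed.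

(** Regularity appears on the right because membership in the stalk of a product already supplies
    charts at the factors. *)
Lemma hol_prod1 x (g : prod1 -> R[i]) :
  hol (to_prod1 x) g <-> Reg X x /\ hol x (g \o to_prod1).
Proof.
have Ed (d : 'I_1 -> nat) : d ord0 = (\sum_i d i)%N by rewrite big_ord1.
split=> [[c [cx [F Fh gF]]]|[[c cx] gh]].
  have cx0 := cx ord0; split; first by exists (c ord0).
  apply/(holP _ cx0).
  move: Fh; rewrite (mxrow1E _ (Ed _)) => /holomorphic_at_castmx.
  apply: holomorphic_at_near.
  have gF' : \forall y \near x, g (to_prod1 y) = F (\mxrow_i (cmap (c i) y : 'rV_(cdim (c i)))).
    exact: (to_prod1_continuous gF).
  apply: filterS (near_cinv cx0 gF') => z [gz _ zK].
  by rewrite /= gz (mxrow1E _ (Ed _)) zK.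
have {gh}/(holP _ cx) gh := gh.
exists (fun=> c); split; first by move=> l.
(* [g] read in the chart, after undoing the cast of the dimension. *)
exists ((g \o to_prod1 \o cinv c) \o castmx (erefl 1%N, esym (Ed (fun=> cdim c)))).
  rewrite (mxrow1E _ (Ed (fun=> cdim c))); apply/holomorphic_at_castmx.
  apply: holomorphic_at_near gh; near=> z.
  by rewrite /= castmx_rowK.
have nc : \forall y \near to_prod1 x, chart_at (of_prod1 y) c.
  exact: (@of_prod1_continuous (to_prod1 x) _ (chart_at_near cx)).
apply: filterS nc => y cy.
rewrite (mxrow1E _ (Ed (fun=> cdim c))) /= castmx_rowK chart_atK//.
by rewrite -[in LHS](of_prod1K y).
Unshelve. all: by end_near. Qed.

Lemma prod1_iso : space_iso to_prod1 of_prod1.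
Proof.
split=> //; [exact: of_prod1K|exact: to_prod1_continuous|exact: of_prod1_continuous|].
split=> [x f xr|y f yr].
  rewrite hol_prod1 (_ : (f \o of_prod1) \o to_prod1 = f)//.
  by split=> [|[]].
have := hol_prod1 (of_prod1 y); rewrite of_prod1K => H; rewrite H.
split=> [[]//|fh]; split=> //.
by have /H[] := hol_cst 0 yr.
Qed.
End UnaryProduct.

(** * Tensor products along an isomorphism *)

Section TensorClasses.
Context {R : realType} {X S : fun_space R}.
Variables (k : X -> S) (q : nat) (x : X).
Implicit Types t u : fsum X S.

Lemma tcls_eq t u : fsum_eq k q x t u -> tcls k q x t = tcls k q x u.
Proof.
move=> tu; apply/seteqP; split=> v tv; first exact: FeTrans (FeSym tu) tv.
exact: FeTrans tu tv.
Qed.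

(** Reflexivity is granted to valid sums, so validity is what puts [u] into its own class. *)
Lemma tcls_inj t u : fsum_valid k q x u -> tcls k q x t = tcls k q x u -> fsum_eq k q x t u.
Proof. by move=> uv E; have : tcls k q x u u by [exact: FeRefl]; rewrite -E. Qed.

Lemma tadd_tcls t u : fsum_valid k q x t -> fsum_valid k q x u ->
  tadd k q x (tcls k q x t) (tcls k q x u) = tcls k q x (t ++ u).
Proof.
move=> tv uv; apply/seteqP; split=> [v [t' [u' [tt' uu' v']]]|v tuv].
  exact: FeTrans (FeCat tt' uu') v'.
by exists t, u; split=> //; exact: FeRefl.
Qed.

(** [tmap] admits every representative; when [h] respects equivalence, one of them suffices. *)
Lemma tmap_tcls (S' : fun_space R) (k' : X -> S') q' h (t : fsum X S') :
  fsum_valid k' q' x t ->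
  (forall u : fsum X S', fsum_eq k' q' x t u -> fsum_eq k q x [seq h e | e <- t] [seq h e | e <- u]) ->
  tmap k q x h (tcls k' q' x t) = tcls k q x [seq h e | e <- t].
Proof.
move=> tv H; apply/seteqP; split=> [v [u tu uv]|v tv'].
  exact: FeTrans (H u tu) uv.
by exists t => //; exact: FeRefl.
Qed.
End TensorClasses.

Section TensorOverIsomorphism.
Context {R : realType} {X S : fun_space R}.
Variables (k : X -> S) (p : S -> X).
Hypothesis kp : space_iso k p.
Implicit Types (t u : fsum X S) (w : Defs.form X).

(** The map [w (x) s |-> s k^* w], inverse on classes to [unit_fsum] when [k] is an isomorphism. *)
Definition eval_fsum t : Defs.form X :=
  fun y vs => \sum_(e <- t) e.2 y * pullback k e.1 y vs.

Lemma eval_fsum_nil : eval_fsum [::] = @form0 R X.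
Proof. by apply/funext => y; apply/funext => vs; rewrite /eval_fsum big_nil. Qed.

Lemma eval_fsum_cons e t :
  eval_fsum (e :: t) = form_add (form_mul e.2 (pullback k e.1)) (eval_fsum t).
Proof. by apply/funext => y; apply/funext => vs; rewrite /eval_fsum big_cons. Qed.

Lemma eval_fsum_cat t u y vs :
  eval_fsum (t ++ u) y vs = eval_fsum t y vs + eval_fsum u y vs.
Proof. by rewrite /eval_fsum big_cat. Qed.

Lemma eval_fsum1 (w : Defs.form S) s y vs : eval_fsum [:: (w, s)] y vs = s y * pullback k w y vs.
Proof. by rewrite /eval_fsum big_seq1. Qed.

Definition unit_fsum w : fsum X S := [:: (pullback p w, fun=> 1)].

Lemma eval_unit_fsum q y w : form_eq_at q y (eval_fsum (unit_fsum w)) w.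
Proof.
by move=> vs tv; rewrite eval_fsum1 mul1r; exact: (pullback_pullback kp w tv).
Qed.

Variables (q : nat) (x : X).
Hypothesis xr : Reg X x.

Let kx : Reg S (k x). Proof. exact: Reg_isoE kp _ xr. Qed.

Lemma smooth_form_unpull w : smooth_form q x w -> smooth_form q (k x) (pullback p w).
Proof.
have [kpK _ _ _ _] := kp; move=> ws.
by apply: (smooth_form_pullback (space_iso_sym kp)) => //; rewrite kpK.
Qed.

Lemma unit_fsum_valid w : smooth_form q x w -> fsum_valid k q x (unit_fsum w).
Proof.
move=> ws; apply: List.Forall_cons; last exact: List.Forall_nil.
by split; [exact: smooth_form_unpull|exact: hol_cst].
Qed.

Lemma smooth_eval_fsum t : fsum_valid k q x t -> smooth_form q x (eval_fsum t).
Proof.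
elim: t => [|e t IH] tv; first by rewrite eval_fsum_nil; exact: smooth_form0.
have [[es eh] /IH ts] := (List.Forall_inv tv, List.Forall_inv_tail tv).
rewrite eval_fsum_cons; apply: smooth_form_add => //; apply: smooth_form_mul => //.
exact: (smooth_form_pullback kp xr es).
Qed.

Lemma fsum_eq_valid t u : fsum_eq k q x t u -> fsum_valid k q x t /\ fsum_valid k q x u.
Proof.
have v1 (e : Defs.form S * (X -> R[i])) : smooth_form q (k x) e.1 -> hol x e.2 -> fsum_valid k q x [:: e].
  by move=> es eh; apply: List.Forall_cons => //; exact: List.Forall_nil.
have i1 (e : Defs.form S * (X -> R[i])) t' : fsum_valid k q x (e :: t') ->
    [/\ smooth_form q (k x) e.1, hol x e.2 & fsum_valid k q x t'].
  by move=> h; have [? ?] := List.Forall_inv h; split=> //; exact: List.Forall_inv_tail h.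
elim=> {t u}.
- by [].
- by move=> t u _ [].
- by move=> t u v _ [tv _] _ [_ vv].
- by move=> t t' u u' _ [tv tv'] _ [uv uv']; split; apply/List.Forall_app.
- by move=> t u tv uv; split; apply/List.Forall_app.
- by [].
- by move=> s sv; split=> //; exact: List.Forall_nil.
- move=> w w' s wv; split=> //; have [ws sh /i1[ws' _ _]] := i1 _ _ wv.
  by apply: v1 => //; exact: smooth_form_add.
- move=> w s s' wv; split=> //; have [ws sh /i1[_ sh' _]] := i1 _ _ wv.
  by apply: v1 => //; exact: holD.
- move=> f w s fh wv; have [ws sh _] := i1 _ _ wv; split.
    by apply: v1 => //; exact: smooth_form_mul.
  apply: v1 => //; apply: holM => //; have [kpK _ _ _ [_ hp]] := kp.
  by have := (hp _ _ kx).1 fh; rewrite kpK.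
Qed.

(** Each generating relation preserves the evaluation; the conclusion holds near [x], as [FeGerm]
    relates pairs with equal germs. *)
Lemma fsum_eq_eval t u : fsum_eq k q x t u ->
  \forall y \near x, form_eq_at q y (eval_fsum t) (eval_fsum u).
Proof.
have all (w w' : Defs.form X) : (forall y vs, w y vs = w' y vs) ->
    \forall y \near x, form_eq_at q y w w'.
  by move=> ww; near=> y; move=> vs _; exact: ww.
elim=> {t u}.
- by move=> t _; exact: all.
- by move=> t u _; apply: filterS => y tu vs tv; rewrite tu.
- by move=> t u v _ tu _ uv; apply: filterS (filterI tu uv) => y [ty uy] vs tv; rewrite ty ?uy.
- move=> t t' u u' _ tt _ uu; apply: filterS (filterI tt uu) => y [ty uy] vs tv.
  by rewrite !eval_fsum_cat ty ?uy.
- by move=> t u _ _; apply: all => y vs; rewrite !eval_fsum_cat addrC.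
- move=> w w' s s' _ _ /(pullback_near kp) ww ss.
  apply: filterS (filterI ww ss) => y [wy sy] vs tv.
  by rewrite !eval_fsum1 sy wy.
- by move=> s _; apply: all => y vs; rewrite eval_fsum1 eval_fsum_nil /pullback mulr0.
- move=> w w' s _; apply: all => y vs.
  by rewrite -[[:: (w, s); _]]/([:: (w, s)] ++ _) eval_fsum_cat !eval_fsum1 -mulrDr.
- move=> w s s' _; apply: all => y vs.
  by rewrite -[[:: (w, s); _]]/([:: (w, s)] ++ _) eval_fsum_cat !eval_fsum1 -mulrDl.
- move=> f w s fh _; apply: all => y vs; rewrite !eval_fsum1 /pullback /form_mul.
  by rewrite mulrCA mulrA.
Unshelve. all: by end_near. Qed.

(* [w (x) s = w (x) (s o p o k) = (s o p) w (x) 1], as [s o p] is a function on [S]. *)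
Lemma fsum_eq_unit t : fsum_valid k q x t -> fsum_eq k q x t (unit_fsum (eval_fsum t)).
Proof.
have [kpK pkK _ _ [hk hp]] := kp.
have one : hol x (fun=> 1 : R[i]) by exact: hol_cst.
have v1 (w : Defs.form S) s : smooth_form q (k x) w -> hol x s -> fsum_valid k q x [:: (w, s)].
  by move=> es eh; apply: List.Forall_cons => //; exact: List.Forall_nil.
elim: t => [|[w s] t IH] tv.
  rewrite eval_fsum_nil; apply: FeSym; apply: FeZero; apply: v1 => //.
  exact: smooth_form0.
have [/= [ws sh] tv'] := (List.Forall_inv tv, List.Forall_inv_tail tv).
have ts := smooth_eval_fsum tv'; have {}IH := IH tv'.
have ks : smooth_form q x (form_mul s (pullback k w)).
  by apply: smooth_form_mul => //; exact: (smooth_form_pullback kp xr ws).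
have sp : hol (k x) (s \o p) by apply/(hk _ _ xr).
have mws : smooth_form q (k x) (form_mul (s \o p) w) by exact: smooth_form_mul.
have e1 : fsum_eq k q x [:: (w, s)] (unit_fsum (form_mul s (pullback k w))).
  have := FeBal sp (v1 _ _ ws one).
  have -> : (fun y => (s \o p) (k y) * 1) = s by apply/funext => y; rewrite /= kpK mulr1.
  (* The round trip through [p] and [k] is the identity on tangent vectors, and [FeGerm] compares
     the forms on these. *)
  move=> /FeSym bal; apply: FeTrans bal _; apply: FeGerm.
  - exact: v1.
  - exact: unit_fsum_valid.
  - near=> y; move=> vs tv0; rewrite /form_mul /pullback /=.
    by rewrite (pushforwardsK (space_iso_sym kp) tv0) pkK.
  - by near=> y.
have := FeCat e1 IH => e2; apply: FeTrans e2 _; apply: FeSym.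
rewrite eval_fsum_cons.
have va : fsum_valid k q x [:: (pullback p (form_mul s (pullback k w)), fun=> 1 : R[i]);
    (pullback p (eval_fsum t), fun=> 1 : R[i])].
  apply: List.Forall_cons (List.Forall_inv (unit_fsum_valid ks)) _.
  exact: unit_fsum_valid.
exact: FeAddl va.
Unshelve. all: by end_near. Qed.

Lemma unit_fsum_near w w' : smooth_form q x w ->
  (\forall y \near x, form_eq_at q y w w') ->
  fsum_eq k q x (unit_fsum w) (unit_fsum w').
Proof.
move=> ws ww; have ws' := smooth_form_near xr ww ws.
apply: FeGerm; [exact: unit_fsum_valid|exact: unit_fsum_valid| |by near=> y].
have [kpK _ _ _ _] := kp; apply: (pullback_near (space_iso_sym kp)).
by rewrite kpK.
Unshelve. all: by end_near. Qed.

(** Injectivity of the evaluation: both sums are equivalent to unit sums of forms with the same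
    germ. *)
Lemma fsum_eqP t u : fsum_valid k q x t -> fsum_valid k q x u ->
  (\forall y \near x, form_eq_at q y (eval_fsum t) (eval_fsum u)) -> fsum_eq k q x t u.
Proof.
move=> tv uv tu; apply: FeTrans (fsum_eq_unit tv) _.
apply: FeTrans (FeSym (fsum_eq_unit uv)); apply: unit_fsum_near tu.
exact: smooth_eval_fsum.
Qed.
End TensorOverIsomorphism.

Section FormGerms.
Context {R : realType} {X : fun_space R}.
Variables (q : nat) (x : X).
Implicit Types w : Defs.form X.

Lemma form_eq_near_sym w w' : (\forall y \near x, form_eq_at q y w w') ->
  \forall y \near x, form_eq_at q y w' w.
Proof. by apply: filterS => y ww vs tv; rewrite ww. Qed.

Lemma form_eq_near_trans w w' w'' : (\forall y \near x, form_eq_at q y w w') ->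
  (\forall y \near x, form_eq_at q y w' w'') -> \forall y \near x, form_eq_at q y w w''.
Proof. by move=> a b; apply: filterS (filterI a b) => y [wy wy'] vs tv; rewrite wy// wy'. Qed.
End FormGerms.

(** * Operations on classes over an isomorphism *)

Section TensorOperations.
Context {R : realType} {X S : fun_space R}.
Variables (k : X -> S) (p : S -> X).
Hypothesis kp : space_iso k p.
Variables (q : nat) (x : X).
Hypothesis xr : Reg X x.
Implicit Types (t u : fsum X S) (w : Defs.form X).

Lemma tcls_unitP w w' : smooth_form q x w -> smooth_form q x w' ->
  tcls k q x (unit_fsum p w) = tcls k q x (unit_fsum p w') <->
  \forall y \near x, form_eq_at q y w w'.
Proof.
move=> ws ws'; split=> [E|ww]; last exact/tcls_eq/unit_fsum_near.
have := fsum_eq_eval kp (tcls_inj (unit_fsum_valid kp xr ws') E).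
apply: filterS => y H vs tv.
exact: etrans (esym (eval_unit_fsum kp w tv)) (etrans (H vs tv) (eval_unit_fsum kp w' tv)).
Qed.

Lemma tadd_unit w w' : smooth_form q x w -> smooth_form q x w' ->
  tadd k q x (tcls k q x (unit_fsum p w)) (tcls k q x (unit_fsum p w')) =
  tcls k q x (unit_fsum p (form_add w w')).
Proof.
move=> ws ws'; have [uv uv'] := (unit_fsum_valid kp xr ws, unit_fsum_valid kp xr ws').
rewrite tadd_tcls//; apply/esym/tcls_eq/FeAddl.
exact: List.Forall_cons (List.Forall_inv uv) uv'.
Qed.

Lemma tadd_zero w : smooth_form q x w ->
  tadd k q x (tzero k q x) (tcls k q x (unit_fsum p w)) = tcls k q x (unit_fsum p w).
Proof.
move=> ws; rewrite /tzero tadd_tcls//; exact: unit_fsum_valid.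
Qed.

(** If [h] becomes [Phi] after evaluation, injectivity of the evaluation shows both that [h] is well
    defined on classes and what it does there, without going through the relations of [fsum_eq]. *)
Lemma tmap_unit q' (h : Defs.form S * (X -> R[i]) -> Defs.form S * (X -> R[i]))
    (Phi : Defs.form X -> Defs.form X) w :
  (forall t, fsum_valid k q x t -> fsum_valid k q' x [seq h e | e <- t]) ->
  (forall t, fsum_valid k q x t ->
     \forall y \near x, form_eq_at q' y (eval_fsum k [seq h e | e <- t]) (Phi (eval_fsum k t))) ->
  (forall w w', smooth_form q x w -> (\forall y \near x, form_eq_at q y w w') ->
     \forall y \near x, form_eq_at q' y (Phi w) (Phi w')) ->
  smooth_form q x w ->
  tmap k q' x h (tcls k q x (unit_fsum p w)) = tcls k q' x (unit_fsum p (Phi w)).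
Proof.
move=> hv he Pnear ws; have uv := unit_fsum_valid kp xr ws.
have heval t u : fsum_valid k q x t -> fsum_valid k q x u ->
    (\forall y \near x, form_eq_at q y (eval_fsum k t) (eval_fsum k u)) ->
    \forall y \near x, form_eq_at q' y (eval_fsum k [seq h e | e <- t])
      (eval_fsum k [seq h e | e <- u]).
  move=> tv uv' tu; apply: form_eq_near_trans (he _ tv) _.
  apply: form_eq_near_trans (form_eq_near_sym (he _ uv')).
  by apply: Pnear tu; exact: (smooth_eval_fsum kp xr tv).
rewrite tmap_tcls//; last first.
  move=> u tu; have [_ uv'] := fsum_eq_valid kp xr tu.
  apply: (fsum_eqP kp xr (hv _ uv) (hv _ uv')).
  by apply: heval => //; exact: (fsum_eq_eval kp tu).
have uw : \forall y \near x, form_eq_at q y (eval_fsum k (unit_fsum p w)) w.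
  by near=> y; exact: (eval_unit_fsum kp).
have e1 := form_eq_near_trans (he _ uv) (Pnear _ _ (smooth_eval_fsum kp xr uv) uw).
apply: tcls_eq; apply: FeTrans (fsum_eq_unit kp xr (hv _ uv)) _.
exact: (unit_fsum_near kp xr (smooth_eval_fsum kp xr (hv _ uv)) e1).
Unshelve. all: by end_near. Qed.

Lemma fsum_valid_map q' (h : Defs.form S * (X -> R[i]) -> Defs.form S * (X -> R[i])) t :
  (forall e, smooth_form q (k x) e.1 -> hol x e.2 ->
     smooth_form q' (k x) (h e).1 /\ hol x (h e).2) ->
  fsum_valid k q x t -> fsum_valid k q' x [seq h e | e <- t].
Proof.
move=> H; elim: t => [|e t IH] tv; first exact: List.Forall_nil.
apply: List.Forall_cons; last exact: IH (List.Forall_inv_tail tv).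
by have [es eh] := List.Forall_inv tv; exact: H.
Qed.

Lemma tmap_scale f w : hol x f -> smooth_form q x w ->
  tmap k q x (fun e => (e.1, fun y => f y * e.2 y)) (tcls k q x (unit_fsum p w)) =
  tcls k q x (unit_fsum p (form_mul f w)).
Proof.
move=> fh; apply: (@tmap_unit q _ (form_mul f)).
- by move=> t; apply: fsum_valid_map => e es eh; split=> //; exact: holM.
- move=> t _; near=> y; move=> vs _; rewrite /form_mul /eval_fsum big_map mulr_sumr.
  by apply: eq_bigr => e _; rewrite mulrA.
- by move=> w1 w2 _; apply: filterS => y ww vs tv; rewrite /form_mul ww.
Unshelve. all: by end_near. Qed.

Lemma dbar_form0 y vs : dbar (@form0 R X) y vs = 0.
Proof.
rewrite /dbar; case: pselect => // h; apply: big1 => i _.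
by rewrite (is_dbard_val (is_dbard_cst 0 _ _)) mulr0.
Qed.

(** [a] stands for the sign [(-1) ^+ 0] of Čech degree 0. The identity combines additivity of dbar,
    its linearity over holomorphic functions and its compatibility with [pullback]. *)
Lemma eval_fsum_dbar (a : R[i]) t : a = 1 -> fsum_valid k q x t ->
  \forall y \near x, form_eq_at q.+1 y
    (eval_fsum k [seq (form_mul (fun=> a) (dbar e.1), e.2) | e <- t]) (dbar (eval_fsum k t)).
Proof.
move=> ->; elim: t => [|[w s] t IH] tv.
  by near=> y; move=> vs _; rewrite eval_fsum_nil dbar_form0.
have [/= [ws sh] tv'] := (List.Forall_inv tv, List.Forall_inv_tail tv).
have kws := smooth_form_pullback kp xr ws; have ms := smooth_form_mul sh kws xr.
have ts := smooth_eval_fsum kp xr tv'.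
apply: filterS (filterI (IH tv') (filterI (dbar_add xr ms ts)
  (filterI (dbar_mul xr sh kws) (dbar_pullback kp xr ws)))) => y [IHy [ay [my py]]] vs tvs.
rewrite [in RHS]eval_fsum_cons /= ay// /form_add my// eval_fsum_cons /form_add /form_mul /=.
rewrite IHy//; congr (_ + _); congr (_ * _).
by rewrite py// /pullback mul1r.
Unshelve. all: by end_near. Qed.

Lemma tmap_dbar (a : R[i]) w : a = 1 -> smooth_form q x w ->
  tmap k q.+1 x (fun e => (form_mul (fun=> a) (dbar e.1), e.2))
    (tcls k q x (unit_fsum p w)) =
  tcls k q.+1 x (unit_fsum p (dbar w)).
Proof.
move=> a1; have kx := Reg_isoE kp xr; apply: (@tmap_unit q.+1 _ (@dbar _ X)).
- move=> t; apply: fsum_valid_map => e es eh; split=> //=.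
  by apply: (smooth_form_mul (hol_cst _ kx) _ kx); exact: (smooth_form_dbar kx es).
- by move=> t; exact: (eval_fsum_dbar a1).
- by move=> w1 w2 ws ww; exact: (dbar_near xr ws ww).
Qed.
End TensorOperations.

(** * The inductive limit over regular points *)

Section Separation.
Context {R : realType}.

(** A closed square with centre [a] is the continuous image of a product of two segments. *)
Lemma compact_nbhs_complex (a : R[i]) (P : set R[i]) : nbhs a P ->
  exists Q : set R[i], [/\ nbhs a Q, Q `<=` P & compact Q].
Proof.
move=> aP; pose f (p : R * R) : R[i] := (complex.Re a + p.1)%:C + 'i * (complex.Im a + p.2)%:C.
have fR p : complex.Re (f p) = complex.Re a + p.1.
  by rewrite /f cReD cReM -complexiE /=; ring.
have fI p : complex.Im (f p) = complex.Im a + p.2.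
  by rewrite /f cImD cImM -complexiE /=; ring.
have fc : continuous f.
  move=> p; apply: cvg_complex.
    rewrite fR; under eq_fun do rewrite fR.
    by apply: cvgD; [exact: cvg_cst|exact: cvg_fst].
  rewrite fI; under eq_fun do rewrite fI.
  by apply: cvgD; [exact: cvg_cst|exact: cvg_snd].
have f0 : f (0, 0) = a by rewrite /f /= !addr0 -complexE.
have : nbhs ((0 : R), (0 : R)) (f @^-1` P) by apply: fc; rewrite f0.
move=> [[A B] /= [/nbhs_ballP[r1 /= r10 rA] /nbhs_ballP[r2 /= r20 rB]] AB].
pose e := Num.min r1 r2 / 2.
have r0 : 0 < Num.min r1 r2 by rewrite lt_min r10 r20.
have e0 : 0 < e by rewrite divr_gt0.
have er : e < Num.min r1 r2 by rewrite /e ltr_pdivrMr// mulr_natr mulr2n ltrDl.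
have [e1 e2] : e < r1 /\ e < r2 by apply/andP; rewrite -lt_min.
exists (f @` (`[- e, e] `*` `[- e, e])); split.
- have near0 (g : R[i] -> R) : {for a, continuous g} -> \forall z \near a, `|g z - g a| <= e.
    by move=> /cvgrPdist_le/(_ _ e0); apply: filterS => z; rewrite distrC.
  have nR := near0 _ (@continuous_complexRe R a).
  have nI := near0 _ (@continuous_complexIm R a).
  apply: filterS (filterI nR nI) => z [zR zI].
  exists (complex.Re z - complex.Re a, complex.Im z - complex.Im a) => /=.
    by split; rewrite /= in_itv /= -ler_norml.
  by rewrite /f /= (addrC (complex.Re a)) (addrC (complex.Im a)) !subrK -complexE.
- move=> z [[s t] /= [sE tE] <-]; apply: (AB (s, t)); split=> /=.
    apply: rA; rewrite /ball /= sub0r normrN; apply: le_lt_trans e1.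
    by move: sE; rewrite in_itv /= -ler_norml.
  apply: rB; rewrite /ball /= sub0r normrN; apply: le_lt_trans e2.
  by move: tE; rewrite in_itv /= -ler_norml.
apply: continuous_compact; first exact: continuous_subspaceT.
by apply: compact_setX; exact: segment_compact.
Qed.

Lemma compact_nbhs_rV n (z : 'rV[R[i]]_n) (U : set 'rV[R[i]]_n) : nbhs z U ->
  exists B : set 'rV[R[i]]_n, [/\ nbhs z B, B `<=` U & compact B].
Proof.
move=> [P Pz PU].
have /choice[Q HQ] (j : 'I_n) := compact_nbhs_complex (Pz ord0 j).
exists [set v | forall j, Q j (v ord0 j)]; split.
- exists (fun _ j => Q j); first by move=> i j; rewrite (ord1 i); have [] := HQ j.
  by move=> v /= vQ j; exact: vQ.
- move=> v vQ; apply: PU => i j; rewrite (ord1 i).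
  by have [_ + _] := HQ j; apply; exact: vQ.
by apply: (@rV_compact R[i]) => j; have [] := HQ j.
Qed.

(** A compact set is carried over from the coordinates by [cinv], which is continuous on it because
    it lies in the image of the chart. *)
Lemma compact_nbhs_Reg (X : fun_space R) x : Reg X x ->
  exists K : set X, [/\ nbhs x K, K `<=` Reg X & compact K].
Proof.
move=> [c cx]; have [oc xd oi ck _] := cx.
have [|B [zB BU Bc]] := @compact_nbhs_rV _ (cmap c x) (cmap c @` cdom c).
  by apply: open_nbhs_nbhs; split=> //; exists x.
have inv z : B z -> exists2 y, cdom c y & cmap c y = z by move=> /BU[y]; exists y.
exists (cinv c @` B); split.
- have := near_cmap cx zB; move: (chart_at_near cx) => cn.
  move=> Bn; apply: filterS (filterI Bn cn) => y [By cy].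
  by exists (cmap c y) => //; exact: chart_atK.
- move=> _ [z /inv[y yd <-] <-]; rewrite ck//; exists c; exact: chart_at_dom cx yd.
apply: continuous_compact => //; apply: continuous_in_subspaceT => z /set_mem /inv[y yd yz].
have cy := chart_at_dom cx yd.
by move=> P; rewrite -yz ck// => /(near_cinv1 cy).
Qed.

(** Compact sets are closed in a Hausdorff space, so the complement of [K] is an open neighbourhood
    of [Sing X]. *)
Lemma separate_Reg (X : fun_space R) (J : Type) (W : J -> set X) x :
  hausdorff_space X -> neighbourhood_basis (Sing X) W -> Reg X x ->
  exists j, \forall y \near x, ~ W j y.
Proof.
move=> hX [_ Wb] /compact_nbhs_Reg[K [xK KR Kc]].
have [||j WK] := Wb (~` K).
- by rewrite openC; exact: compact_closed.
- by move=> y ys /KR.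
by exists j; apply: filterS xK => y Ky /WK.
Qed.
End Separation.

(** * Germs of the limit at regular points *)

Section Limit.
Context {R : realType} {X : fun_space R} {I J : Type}.
Variables (A : triples X I) (lt : option I -> option I -> Prop) (W : J -> set X).
Hypothesis hX : hausdorff_space X.
Hypothesis Wb : neighbourhood_basis (Sing X) W.
Hypothesis lto : strict_total_order lt.
Implicit Types (g h : rgerm (J := J) A) (s : cochain (with_reg A)) (x y : X) (w : Defs.form X).

Let iso := prod1_iso X.

(** [None] is the full triple adjoined by [shrink_reg]. If [A] itself is [with_reg T], its own
    regular triple is [Some None], cut down to [W j]. *)
Definition reg_index : 'I_1 -> option I := fun=> None.

Definition reg_comp s : X -> set (fsum X (prod1 X)) := s 0%N reg_index.

Notation k := (@to_prod1 R X).
Notation unit_cls n w x := (tcls k n x (unit_fsum (@of_prod1 R X) w)).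

Lemma reg_comp_unit n w x : reg_comp (unit_cochain (A := A) n w) x = unit_cls n w x.
Proof. by []. Qed.

(** Off [U] every index is [None], and two of them would give [lt None None]. The type of [al]
    depends on [p], hence [eq_rect]. *)
Lemma reg_simplex (U : set X) p (al : 'I_p.+1 -> option I) x : increasing lt al ->
  prod_src (shrink_reg A U) al x -> ~ U x ->
  exists E : p = 0%N, eq_rect p (fun p => 'I_p.+1 -> option I) al 0%N E = reg_index.
Proof.
move=> incr alx Ux.
have alN l : al l = None.
  by case E : (al l) => [i|//]; have := alx l; rewrite /= E => -[].
case: p al incr alx alN => [|p] al incr _ alN.
  by exists erefl; apply/funext => l /=; exact: alN.
have [irr _ _] := lto.
have := incr ord0 ord_max isT; rewrite !alN => /irr; by [].
Qed.

Lemma reg_increasing : increasing lt reg_index.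
Proof. by move=> l l'; rewrite (ord1 l) (ord1 l'). Qed.

Lemma reg_prod_src (U : set X) x : Reg X x -> prod_src (shrink_reg A U) reg_index x.
Proof. by move=> xr l. Qed.

Lemma dolb_section_reg n j (N : set X) s : dolb_section lt (A := shrink_reg A (W j)) n N s ->
  forall x, N x -> Reg X x -> open N ->
  exists t, \forall y \near x, fsum_valid k n y t /\ reg_comp s y = tcls k n y t.
Proof.
move=> sN x Nx xr oN; have := sN 0%N reg_index (leq0n n) reg_increasing.
rewrite subn0 => /(_ x (conj Nx (@reg_prod_src (W j) x xr)))[t Ht].
exists t; have := open_nbhs_nbhs (conj oN Nx); have := open_nbhs_nbhs (conj (@open_Reg R X) xr).
move=> Rn Nn; apply: filterS (filterI Ht (filterI Rn Nn)) => y [Hy [yr Ny]].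
exact: Hy (conj Ny (@reg_prod_src (W j) y yr)).
Qed.

Lemma dolb_section_of_reg n j (N : set X) s :
  (forall y, N y -> ~ W j y) ->
  (forall x, N x -> exists t, \forall y \near x, fsum_valid k n y t /\ reg_comp s y = tcls k n y t) ->
  dolb_section lt (A := shrink_reg A (W j)) n N s.
Proof.
move=> NW Ns p al pn incr x [Nx alx].
have [E alE] := reg_simplex incr alx (NW x Nx).
subst p; rewrite /= in alE; subst al; rewrite subn0.
have [t Ht] := Ns x Nx; exists t; apply: filterS Ht => y Hy _; exact: Hy.
Qed.

Lemma dolb_eq_of_reg n j (N : set X) s s' :
  (forall y, N y -> ~ W j y) -> (forall y, N y -> reg_comp s y = reg_comp s' y) ->
  dolb_eq lt (A := shrink_reg A (W j)) n N s s'.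
Proof.
move=> NW ss p al pn incr x [Nx alx].
have [E alE] := reg_simplex incr alx (NW x Nx).
by subst p; rewrite /= in alE; subst al; exact: ss.
Qed.

Lemma near_open x (P : set X) : (\forall y \near x, P y) ->
  exists2 N, open_nbhs x N & N `<=` P.
Proof. by rewrite /prop_near1 nbhsE. Qed.

Lemma rgerm_valid_reg n x g : Reg X x -> rgerm_valid lt W n x g ->
  exists t, \forall y \near x, fsum_valid k n y t /\ reg_comp g.2 y = tcls k n y t.
Proof. by move=> xr [N [oN Nx] gN]; exact: dolb_section_reg gN x Nx xr oN. Qed.

Lemma near_dolb_section n x j s (P : set X) :
  (\forall y \near x, ~ W j y) -> (\forall y \near x, P y) ->
  (exists t, \forall y \near x, fsum_valid k n y t /\ reg_comp s y = tcls k n y t) ->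
  exists N, [/\ open_nbhs x N, N `<=` P & dolb_section lt (A := shrink_reg A (W j)) n N s].
Proof.
move=> xW xP [t xt]; have [N oN NP] := near_open (filterI (filterI xW xP) xt).
exists N; split=> //; first by move=> y /NP[[]].
apply: dolb_section_of_reg; first by move=> y /NP[[]].
move=> y Ny; exists t; have [oN' _] := oN.
by apply: filterS (open_nbhs_nbhs (conj oN' Ny)) => z /NP[].
Qed.

Lemma rgerm_valid_of n x g : (\forall y \near x, ~ W g.1 y) ->
  (exists t, \forall y \near x, fsum_valid k n y t /\ reg_comp g.2 y = tcls k n y t) ->
  rgerm_valid lt W n x g.
Proof.
move=> xW xt; have [N [oN _ gN]] := near_dolb_section xW (filterT : nbhs x setT) xt.
by exists N.
Qed.

(** Near [x] both components are given by fixed formal sums. Equal classes at [x] make the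
    evaluations agree near [x], hence the classes agree at all nearby points. *)
Lemma rgerm_eqP n x g h : Reg X x ->
  rgerm_eq lt W n x g h <->
  [/\ rgerm_valid lt W n x g, rgerm_valid lt W n x h & reg_comp g.2 x = reg_comp h.2 x].
Proof.
move=> xr; split=> [[gv hv [j [N [_ [oN Nx] E]]]]|[gv hv E]].
  split=> //.
  exact: (E 0%N reg_index (leq0n n) reg_increasing x (conj Nx (@reg_prod_src (W j) x xr))).
split=> //.
have [t tn] := rgerm_valid_reg xr gv; have [u un] := rgerm_valid_reg xr hv.
have [[tv tE] [uv uE]] := (nbhs_singleton tn, nbhs_singleton un).
have tu : fsum_eq k n x t u by apply: tcls_inj uv _; rewrite -tE -uE.
have Rn := open_nbhs_nbhs (conj (@open_Reg R X) xr).
have nE : \forall y \near x, reg_comp g.2 y = reg_comp h.2 y.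
  apply: filterS (filterI (nbhs_interior (fsum_eq_eval iso tu)) (filterI Rn (filterI tn un))).
  move=> y [tuy [yr [[tvy tEy] [uvy uEy]]]].
  by rewrite tEy uEy; apply: tcls_eq; exact: (fsum_eqP iso yr tvy uvy tuy).
have [j0 xW] := separate_Reg hX Wb xr.
have [Wo Wsub] := Wb.
(* Both germs restrict to [W j], and [W j] misses a neighbourhood of [x] because [W j0] does. *)
have [||j Wj] := Wsub (W g.1 `&` W h.1 `&` W j0).
- by apply: openI; [apply: openI|]; exact: (Wo _).1.
- by move=> y ys; split; [split|]; exact: (Wo _).2.
have [N oN NP] := near_open (filterI xW nE).
exists j, N; split=> //; first by move=> y /Wj[].
apply: dolb_eq_of_reg => y /NP[nW //] _; by move/Wj => [_ /nW].
Qed.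

Lemma unit_germ n x w : Reg X x -> (\forall y \near x, smooth_form n y w) ->
  exists t, \forall y \near x,
    fsum_valid k n y t /\ reg_comp (unit_cochain (A := A) n w) y = tcls k n y t.
Proof.
move=> xr ws; exists (unit_fsum (@of_prod1 R X) w).
have Rn := open_nbhs_nbhs (conj (@open_Reg R X) xr).
apply: filterS (filterI ws Rn) => y [wy yr]; split=> //.
exact: (unit_fsum_valid iso yr wy).
Qed.

Notation phi n w := (canonical_map A lt W n w).

(** Frees the membership from the index [j], over which [canonical_map] takes a union. *)
Lemma canonical_mapP n x w h : Reg X x -> (\forall y \near x, smooth_form n y w) ->
  phi n w x h <-> rgerm_valid lt W n x h /\ reg_comp h.2 x = unit_cls n w x.
Proof.
move=> xr ws; split=> [[j /(rgerm_eqP _ _ _ xr)[_ hv <-]]|[hv hE]] //.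
have [j xW] := separate_Reg hX Wb xr.
exists j; apply/(rgerm_eqP _ _ _ xr); split=> //.
by apply: rgerm_valid_of => //; exact: unit_germ.
Qed.

Lemma canonical_map_germ n x w : Reg X x -> (\forall y \near x, smooth_form n y w) ->
  exists2 j, \forall y \near x, ~ W j y & phi n w x (j, unit_cochain (A := A) n w).
Proof.
move=> xr ws; have [j xW] := separate_Reg hX Wb xr.
exists j => //; apply/canonical_mapP => //; split=> //.
by apply: rgerm_valid_of => //; exact: unit_germ.
Qed.

Lemma canonical_map_rcls n x w g : Reg X x -> (\forall y \near x, smooth_form n y w) ->
  rgerm_valid lt W n x g -> reg_comp g.2 x = unit_cls n w x ->
  phi n w x = rcls lt W n x g.
Proof.
move=> xr ws gv gE; apply/seteqP; split=> h.
  by move=> /(canonical_mapP _ xr ws)[hv hE]; apply/(rgerm_eqP _ _ _ xr); rewrite gE hE.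
move=> /(rgerm_eqP _ _ _ xr)[_ hv E]; apply/(canonical_mapP _ xr ws).
by rewrite -E gE.
Qed.
End Limit.

(** * The canonical morphism is bijective and compatible with the operations *)

Section CanonicalMorphism.
Context {R : realType} {X : fun_space R} {I J : Type}.
Variables (A : triples X I) (lt : option I -> option I -> Prop) (W : J -> set X).
Hypothesis hX : hausdorff_space X.
Hypothesis Wb : neighbourhood_basis (Sing X) W.
Hypothesis lto : strict_total_order lt.
Implicit Types (s : cochain (with_reg A)) (x y : X) (w : Defs.form X).

Let iso := prod1_iso X.

Notation k := (@to_prod1 R X).
Notation unit_cls n w x := (tcls k n x (unit_fsum (@of_prod1 R X) w)).
Notation phi n w := (canonical_map A lt W n w).
Notation near_smooth n x w := (\forall y \near x, smooth_form n y w).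

(** The operations of [rDolb] run over all representatives; the result is one class as soon as [O]
    is controlled on the regular component. Two degrees occur because the differential raises the
    degree. *)
Lemma canonical_map_op1 n n' x w w' (O : J -> cochain (with_reg A) -> cochain (with_reg A)) :
  Reg X x -> near_smooth n x w -> near_smooth n' x w' ->
  (\forall y \near x, forall j a, reg_comp a y = unit_cls n w y ->
     reg_comp (O j a) y = unit_cls n' w' y) ->
  phi n' w' x = [set h | exists j a, phi n w x (j, a) /\ rcls lt W n' x (j, O j a) h].
Proof.
move=> xr ws ws' OE; have OEx := nbhs_singleton OE.
apply/seteqP; split=> h.
  move=> /(canonical_mapP hX Wb lto h xr ws')[hv hE].
  have [j jW pj] := canonical_map_germ A hX Wb lto xr ws.
  exists j, (unit_cochain (A := A) n w); split=> //.
  apply/(rgerm_eqP hX Wb lto _ _ _ xr); split=> //; last by rewrite hE /= OEx.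
  apply: (rgerm_valid_of lto) => //=.
  exists (unit_fsum (@of_prod1 R X) w').
  have Rn := open_nbhs_nbhs (conj (@open_Reg R X) xr).
  apply: filterS (filterI OE (filterI ws' Rn)) => y [Oy [wy yr]]; split; last exact: Oy.
  exact: (unit_fsum_valid iso yr wy).
move=> [j [a [/(canonical_mapP hX Wb lto _ xr ws)[_ aE]]]].
move=> /(rgerm_eqP hX Wb lto _ _ _ xr)[_ hv E]; apply/(canonical_mapP hX Wb lto _ xr ws').
by split=> //; rewrite -E /= OEx.
Qed.

Lemma canonical_map_op2 n x w1 w2 w'
    (O : J -> cochain (with_reg A) -> cochain (with_reg A) -> cochain (with_reg A)) :
  Reg X x -> near_smooth n x w1 -> near_smooth n x w2 -> near_smooth n x w' ->
  (\forall y \near x, forall j a b, reg_comp a y = unit_cls n w1 y ->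
     reg_comp b y = unit_cls n w2 y -> reg_comp (O j a b) y = unit_cls n w' y) ->
  phi n w' x = [set h | exists j a b,
    [/\ phi n w1 x (j, a), phi n w2 x (j, b) & rcls lt W n x (j, O j a b) h]].
Proof.
move=> xr ws1 ws2 ws' OE; have OEx := nbhs_singleton OE.
apply/seteqP; split=> h.
  move=> /(canonical_mapP hX Wb lto h xr ws')[hv hE].
  have [j jW pj] := canonical_map_germ A hX Wb lto xr ws1.
  exists j, (unit_cochain (A := A) n w1), (unit_cochain (A := A) n w2); split=> //.
    apply/(canonical_mapP hX Wb lto _ xr ws2); split=> //.
    by apply: (rgerm_valid_of lto) => //; exact: unit_germ.
  apply/(rgerm_eqP hX Wb lto _ _ _ xr); split=> //; last by rewrite hE /= OEx.
  apply: (rgerm_valid_of lto) => //=.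
  exists (unit_fsum (@of_prod1 R X) w').
  have Rn := open_nbhs_nbhs (conj (@open_Reg R X) xr).
  apply: filterS (filterI OE (filterI ws' Rn)) => y [Oy [wy yr]]; split; last exact: Oy.
  exact: (unit_fsum_valid iso yr wy).
move=> [j [a [b [/(canonical_mapP hX Wb lto _ xr ws1)[_ aE]]]]].
move=> /(canonical_mapP hX Wb lto _ xr ws2)[_ bE].
move=> /(rgerm_eqP hX Wb lto _ _ _ xr)[_ hv E]; apply/(canonical_mapP hX Wb lto _ xr ws').
by split=> //; rewrite -E /= OEx.
Qed.

Variables (n : nat) (V : set X).
Hypotheses (oV : open V) (VR : V `<=` Reg X).

Let near_V x (P : set X) : V x -> (forall y, V y -> P y) -> \forall y \near x, P y.
Proof. by move=> Vx VP; apply: filterS (open_nbhs_nbhs (conj oV Vx)). Qed.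

Lemma canonical_map_section w : (forall x, V x -> smooth_form n x w) ->
  sh_sec (rDolb A lt W) n V (phi n w).
Proof.
move=> ws x Vx; have xr := VR Vx; have wn := near_V Vx ws.
have [j jW] := separate_Reg hX Wb xr.
have [N [oN NV Nsec]] := near_dolb_section lto jW (near_V Vx (fun y h => h)) (unit_germ A xr wn).
exists (j, unit_cochain (A := A) n w), N; split=> // y Vy Ny.
apply: (canonical_map_rcls hX Wb lto (VR Vy)) => //; first exact: near_V.
by exists N => //; split=> //; have [] := oN.
Qed.

Lemma canonical_map_inj w w' :
  (forall x, V x -> smooth_form n x w) -> (forall x, V x -> smooth_form n x w') ->
  (forall x, V x -> form_eq_at n x w w') <->
  (forall x, V x -> phi n w x = phi n w' x).
Proof.
move=> ws ws'; split=> [ww x Vx|ww x Vx]; have xr := VR Vx.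
  apply/seteqP; split=> h.
    move=> /(canonical_mapP hX Wb lto _ xr (near_V Vx ws))[hv hE].
    apply/(canonical_mapP hX Wb lto _ xr (near_V Vx ws')); split=> //; rewrite hE.
    by apply/(tcls_unitP iso xr (ws x Vx) (ws' x Vx)); exact: near_V.
  move=> /(canonical_mapP hX Wb lto _ xr (near_V Vx ws'))[hv hE].
  apply/(canonical_mapP hX Wb lto _ xr (near_V Vx ws)); split=> //; rewrite hE.
  by apply/(tcls_unitP iso xr (ws' x Vx) (ws x Vx))/form_eq_near_sym; exact: near_V.
have [j _] := canonical_map_germ A hX Wb lto xr (near_V Vx ws).
rewrite ww// => /(canonical_mapP hX Wb lto _ xr (near_V Vx ws'))[_].
by rewrite /= reg_comp_unit => /(tcls_unitP iso xr (ws x Vx) (ws' x Vx))/nbhs_singleton.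
Qed.

(** The formal sums that represent [u] at [y]; one of them is chosen at each point to define the
    preimage of [u]. *)
Let germ_at (u : X -> set (rgerm A)) y (t : fsum X (prod1 X)) : Prop :=
  fsum_valid k n y t /\ exists g : rgerm A, [/\ rgerm_valid lt W n y g, u y = rcls lt W n y g
    & reg_comp g.2 y = tcls k n y t].

(** The sums chosen at different points are unrelated, but the value at [y] of the evaluation
    depends on [u y] alone. So near each point [w] agrees with the evaluation of one sum, hence is
    smooth. *)
Lemma canonical_map_surj (u : X -> set (rgerm A)) : sh_sec (rDolb A lt W) n V u ->
  exists2 w, (forall x, V x -> smooth_form n x w) & forall x, V x -> phi n w x = u x.
Proof.
move=> us.
pose w : Defs.form X := fun y vs => eval_fsum k (xget [::] [set t | germ_at u y t]) y vs.
have loc x : V x -> exists g t, [/\ rgerm_valid lt W n x g, u x = rcls lt W n x g,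
    reg_comp g.2 x = tcls k n x t, fsum_valid k n x t &
    \forall y \near x, form_eq_at n y w (eval_fsum k t)].
  move=> Vx; have xr := VR Vx; have [g [N [[oN Nx] Nsec ug]]] := us x Vx.
  have [t tn] := @dolb_section_reg _ _ _ _ A lt W n g.1 N g.2 Nsec x Nx xr oN.
  have [tv tE] := nbhs_singleton tn.
  exists g, t; split=> //; [by exists N|exact: ug|].
  have Nn := open_nbhs_nbhs (conj oN Nx); have Vn := open_nbhs_nbhs (conj oV Vx).
  apply: filterS (filterI tn (filterI Nn Vn)) => y [[tvy tEy] [Ny Vy]].
  have yr := VR Vy; have gy : rgerm_valid lt W n y g by exists N.
  have ex : exists t, germ_at u y t.
    by exists t; split=> //; exists g; split=> //; exact: ug.
  have [t'v [g' [g'v ug' t'E]]] := xgetPex [::] ex.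
  (* [g] and the germ [g'] of the chosen sum both represent [u y], so their sums are equivalent at
     [y]. *)
  have : rcls lt W n y g g by apply/(rgerm_eqP hX Wb lto _ _ _ yr).
  rewrite -ug// ug' => /(rgerm_eqP hX Wb lto _ _ _ yr)[_ _ E].
  have tt' := tcls_inj tvy (etrans (esym t'E) (etrans E tEy)).
  exact: nbhs_singleton (fsum_eq_eval iso tt').
have ws x : V x -> smooth_form n x w.
  move=> Vx; have xr := VR Vx; have [g [t [_ _ _ tv wt]]] := loc x Vx.
  exact: (smooth_form_near xr (form_eq_near_sym wt) (smooth_eval_fsum iso xr tv)).
exists w => // x Vx; have xr := VR Vx; have [g [t [gv -> gE tv wt]]] := loc x Vx.
apply: (canonical_map_rcls hX Wb lto xr (near_V Vx ws) gv); rewrite gE.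
rewrite (tcls_eq (fsum_eq_unit iso xr tv)).
apply/(tcls_unitP iso xr (smooth_eval_fsum iso xr tv) (ws x Vx)).
exact: form_eq_near_sym.
Qed.

Lemma reg_comp_add j a b y : reg_comp (A := A) (dolb_add (A := shrink_reg A (W j)) n a b) y =
  tadd k n y (reg_comp (A := A) a y) (reg_comp (A := A) b y).
Proof. by rewrite /reg_comp /dolb_add subn0. Qed.

Lemma reg_comp_scale j f a y : reg_comp (A := A) (dolb_scale (A := shrink_reg A (W j)) n f a) y =
  tmap k n y (fun e => (e.1, fun y => f y * e.2 y)) (reg_comp (A := A) a y).
Proof. by rewrite /reg_comp /dolb_scale subn0. Qed.

(** In Čech degree 0 the Čech differential contributes [tzero] and the sign of dbar is
    [(-1) ^+ 0]. *)
Lemma reg_comp_diff j a y : reg_comp (A := A) (dolb_diff (A := shrink_reg A (W j)) n a) y =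
  tadd k n.+1 y (tzero k n.+1 y)
    (tmap k n.+1 y (fun e => (form_mul (fun=> (-1) ^+ 0) (dbar e.1), e.2)) (reg_comp (A := A) a y)).
Proof. by rewrite /reg_comp /dolb_diff subn0. Qed.

Lemma canonical_map_add w w' x : V x ->
  (forall x, V x -> smooth_form n x w) -> (forall x, V x -> smooth_form n x w') ->
  phi n (form_add w w') x = sh_add (rDolb A lt W) n (phi n w) (phi n w') x.
Proof.
move=> Vx ws ws'; have wws y : V y -> smooth_form n y (form_add w w').
  by move=> Vy; exact: (smooth_form_add (VR Vy) (ws y Vy) (ws' y Vy)).
apply: (canonical_map_op2 (O := fun j => dolb_add (A := shrink_reg A (W j)) n)
  (VR Vx) (near_V Vx ws) (near_V Vx ws') (near_V Vx wws)).
apply: near_V => // y Vy j a b aE bE; rewrite reg_comp_add aE bE.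
exact: (tadd_unit iso (VR Vy) (ws y Vy) (ws' y Vy)).
Qed.

Lemma canonical_map_scale f w x : V x -> (forall x, V x -> hol x f) ->
  (forall x, V x -> smooth_form n x w) ->
  phi n (form_mul f w) x = sh_scale (rDolb A lt W) n f (phi n w) x.
Proof.
move=> Vx fh ws; have fws y : V y -> smooth_form n y (form_mul f w).
  by move=> Vy; exact: (smooth_form_mul (fh y Vy) (ws y Vy) (VR Vy)).
apply: (canonical_map_op1 (O := fun j => dolb_scale (A := shrink_reg A (W j)) n f)
  (VR Vx) (near_V Vx ws) (near_V Vx fws)).
apply: near_V => // y Vy j a aE; rewrite reg_comp_scale aE.
exact: (tmap_scale iso (VR Vy) (fh y Vy) (ws y Vy)).
Qed.

Lemma canonical_map_dbar w x : V x -> (forall x, V x -> smooth_form n x w) ->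
  phi n.+1 (dbar w) x = sh_diff (rDolb A lt W) n (phi n w) x.
Proof.
move=> Vx ws; have dws y : V y -> smooth_form n.+1 y (dbar w).
  by move=> Vy; exact: (smooth_form_dbar (VR Vy) (ws y Vy)).
have dwn := near_V Vx dws.
apply: (canonical_map_op1 (O := fun j => dolb_diff (A := shrink_reg A (W j)) n)
  (VR Vx) (near_V Vx ws) dwn).
apply: near_V => // y Vy j a aE; rewrite reg_comp_diff aE.
rewrite (tmap_dbar iso (VR Vy) (expr0 _) (ws y Vy)).
exact: (tadd_zero iso (VR Vy) (dws y Vy)).
Qed.
End CanonicalMorphism.

Theorem corollary6p2p3 (R : realType) (X : fun_space R) (I : Type)
    (T : triples X I) (J : Type) (W : J -> set X)
    (lt : option (option I) -> option (option I) -> Prop) :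
  reduced_analytic_space X ->
  embedding_triples T ->
  Sing X `<=` \bigcup_i src T i ->
  neighbourhood_basis (Sing X) W ->
  strict_total_order lt ->
  iso_of_complexes_on (Reg X)
    (dolbeault_complex X) (rDolb (with_reg T) lt W)
    (canonical_map (with_reg T) lt W).
Proof.
move=> [hX _] _ _ Wb lto n V oV VR; split.
- by move=> w ws; exact: canonical_map_section.
- by move=> w w' ws ws'; exact: canonical_map_inj.
- by move=> u us; exact: canonical_map_surj.
- move=> w w' f ws ws' fh; split=> x Vx; first exact: canonical_map_add Vx ws ws'.
  exact: canonical_map_scale Vx fh ws.
move=> w ws; have dws y : V y -> smooth_form n.+1 y (dbar w).
  by move=> Vy; exact: (smooth_form_dbar (VR y Vy) (ws y Vy)).
have E x : V x -> canonical_map (with_reg T) lt W n.+1 (dbar w) x =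
    sh_diff (rDolb (with_reg T) lt W) n (canonical_map (with_reg T) lt W n w) x.
  by move=> Vx; exact: canonical_map_dbar Vx ws.
split=> // x Vx.
(* The differential is a section because over [V] it equals the image of [dbar w]. *)
have [g [N [oN Nsec H]]] := canonical_map_section (with_reg T) hX Wb lto oV VR dws Vx.
by exists g, N; split=> // y Vy Ny; rewrite -E// H.
Qed.
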